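(* Let $d\ge 1$, $p>0$, let $f:\mathbb{Z}^d\to\mathbb{R}$ be bounded, and let $A=-\Delta+f$ on $\ell^2(\mathbb{Z}^d)$. Assume that $A$ has a bounded spectral gap $\Lambda=(\lambda_-,\lambda_+)$, i.e. $\Lambda\cap\sigma(A)=\emptyset$ and $\lambda_\pm\in\sigma(A)$, and that the density of states $\rho(\mu)$ of $A$ exists for every $\mu\in\mathbb{R}$. Let $\Psi$ be a continuous real function on the unit sphere $\{x\in\mathbb{R}^d:|x|=1\}$ and let $V:\mathbb{Z}^d\to[0,\infty)$ satisfy $V(n)\sim\Psi(\theta)|n|^{-p}$ as $|n|\to\infty$, where $\theta=n/|n|$. Let $\lambda\in\Lambda$, and let $N(\lambda,\alpha)$ be the number of eigenvalues of $A(t)=A-tV$ passing through $\lambda$ as $t$ increases from $0$ to $\alpha$. Then $$N(\lambda,\alpha)\sim\alpha^{d/p}\int_{\mathbb{R}^d}\Bigl(\rho\bigl(\lambda+\Psi(\theta)|x|^{-p}\bigr)-\rho(\lambda)\Bigr)\,dx\qquad\text{as }\alpha\to\infty,$$ where in the integral $\theta=x/|x|$; that is, $\lim_{\alpha\to\infty}\alpha^{-d/p}N(\lambda,\alpha)$ exists and equals the integral on the right-hand side.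
   Context: The operator $A=-\Delta+f$ is the bounded self-adjoint operator on $\ell^2(\mathbb{Z}^d)$ given by $$[Au]_n=-\sum_{|m-n|=1}u_m+2d\,u_n+f(n)u_n,\qquad n\in\mathbb{Z}^d,$$ where $|\cdot|$ is the Euclidean norm. $V$ also denotes the operator of multiplication by the function $V$. The asymptotic relation $V(n)\sim\Psi(n/|n|)|n|^{-p}$ means $|n|^pV(n)-\Psi(n/|n|)\to0$ as $|n|\to\infty$. In particular $V$ is a compact operator, and by Weyl's theorem the spectrum of $A(t)=A-tV$ in $\Lambda$ consists of isolated eigenvalues of finite multiplicity. They depend continuously on $t$ and move from right to left as $t$ grows. The number $N(\lambda,\alpha)$ of eigenvalues of $A(t)$ passing through $\lambda$ as $t$ increases from $0$ to $\alpha$ is counted with multiplicity: $N(\lambda,\alpha)=\sum_{0<t<\alpha}\dim\ker(A-tV-\lambda I)$. (Equivalently, by the Birman–Schwinger principle, it is the number of eigenvalues, with multiplicity, of $\sqrt V(A-\lambda I)^{-1}\sqrt V$ that are greater than $\alpha^{-1}$.) Density of states. For a set $\Omega\subset\mathbb{R}^d$ let $A_\Omega$ be the operator on $\ell^2(\Omega\cap\mathbb{Z}^d)$ given by $$[A_\Omega u]_n=-\sum_{|m-n|=1,\ m\in\Omega\cap\mathbb{Z}^d}u_m+2d\,u_n+f(n)u_n,\qquad n\in\Omega\cap\mathbb{Z}^d.$$ For bounded $\Omega$, $N(A_\Omega,\mu)$ denotes the number of eigenvalues of $A_\Omega$ (with multiplicity) that are strictly smaller than $\mu$. For $\beta>0$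 put $\beta\Omega=\{\beta y:y\in\Omega\}$. The assumption that the density of states exists means that for each $\mu\in\mathbb{R}$ the limit $$\rho(\mu)=\lim_{\beta\to\infty}\frac{N(A_{\beta\Omega},\mu)}{\beta^d\,\mathrm{vol}(\Omega)}$$ exists and has the same value for every nonempty bounded open set $\Omega\subset\mathbb{R}^d$ whose boundary has Lebesgue measure zero. *)

(* Defs.v *)
From HB Require Import structures.
From mathcomp Require Import all_boot all_order all_algebra complex.
From mathcomp Require Import all_classical all_reals all_analysis.

Set Implicit Arguments.
Unset Strict Implicit.
Unset Printing Implicit Defensive.

Import Order.TTheory GRing.Theory Num.Theory.
Import numFieldNormedType.Exports.

Local Open Scope classical_set_scope.
Local Open Scope ring_scope.

Definition borel_rV (R : realType) (n : nat) : measurableType _ :=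
  g_sigma_algebraType (@open 'rV[R]_n).

(* The library has no Lebesgue measure on R^n: it is built by recursion on n,
   transporting the product of the Lebesgue measures on R and R^n along the
   Borel isomorphism R * R^n ~ R^n.+1. *)
Section lebesgue_rV.
Context {R : realType}.
Local Notation MR := (measurableTypeR R).

Definition rV_cons n (z : MR * borel_rV R n) : borel_rV R n.+1 :=
  row_mx (const_mx z.1 : 'rV[R]_1) (z.2 : 'rV[R]_n).

Definition rV_uncons n (v : borel_rV R n.+1) : MR * borel_rV R n :=
  ((v : 'rV[R]_(1 + n)) 0 0, rsubmx (v : 'rV[R]_(1 + n))).

Lemma rV_consK n : cancel (@rV_cons n) (@rV_uncons n).
Proof.
move=> [x v]; rewrite /rV_cons /rV_uncons row_mxKr; congr pair.
rewrite (_ : 0 = lshift n (0 : 'I_1)); last exact: val_inj.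
by rewrite row_mxEl mxE.
Qed.

Lemma measurable_borel_rV n d (T : measurableType d) (g : T -> borel_rV R n) :
  (forall U : set 'rV[R]_n, open U -> measurable (g @^-1` U)) ->
  measurable_fun [set: T] g.
Proof.
move=> gU; apply: (@measurability _ _ _ _ setT g (@open 'rV[R]_n)) => //.
by move=> _ [U oU <-]; rewrite setTI; exact: gU.
Qed.

Lemma nbhs_rV_cons n (x : R) (v : 'rV[R]_n) (U : set 'rV[R]_n.+1) :
  nbhs (rV_cons (x, v) : 'rV[R]_n.+1) U ->
  exists2 e : R, 0 < e &
    exists2 B : set 'rV[R]_n, nbhs v B &
      forall y w, `|x - y| < e -> B w -> U (rV_cons (y, w)).
Proof.
move=> /nbhs_ballP[e /= e0 eU]; exists e => //.
exists (ball v e); first exact: nbhsx_ballx.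
move=> y w xy [_ vw]; apply: eU; split=> // i j.
rewrite /rV_cons/= !mxE.
case: splitP => k _; first by rewrite !mxE; exact: xy.
by rewrite (ord1 i); exact: vw.
Qed.

Lemma measurable_rV_cons n : measurable_fun setT (@rV_cons n).
Proof.
apply: measurable_borel_rV => U oU.
pose W (q r : rat) : set 'rV[R]_n :=
  [set v | forall y : R, ratr q < y < ratr r -> U (rV_cons (y, v))]°.
have -> : @rV_cons n @^-1` U = \bigcup_(q : rat) \bigcup_(r : rat)
    ([set` `]ratr q : R, ratr r[] `*` W q r).
  apply/seteqP; split => [[x v]/= Uxv|[x v] [q _ [r _ [/= xqr /interior_subset]]]].
    have := open_nbhs_nbhs (conj oU Uxv).
    move=> /nbhs_rV_cons[e e0 [B vB BU]].
    have [q qx] : exists q : rat, (ratr q : R) \in `]x - e, x[.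
      by apply: rat_in_itvoo; rewrite ltrBlDr ltrDl.
    have [r xr] : exists r : rat, (ratr r : R) \in `]x, x + e[.
      by apply: rat_in_itvoo; rewrite ltrDl.
    move: qx xr; rewrite !in_itv/= => /andP[q1 q2] /andP[r1 r2].
    exists q => //; exists r => //; split => /=; first by rewrite in_itv/= q2.
    apply: filterS vB => w Bw y /andP[qy yr]; apply: BU => //.
    rewrite ltr_distlC; apply/andP; split; [exact: lt_trans q1 qy|exact: lt_trans yr r2].
  by apply; move: xqr; rewrite in_itv.
apply: bigcupT_measurable_rat => q; apply: bigcupT_measurable_rat => r.
apply: measurableX; first exact: measurable_itv.
by apply: sub_sigma_algebra; exact: open_interior.
Qed.

Lemma measurable_rV_uncons n : measurable_fun setT (@rV_uncons n).
Proof.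
apply/measurable_fun_pairP; split.
  apply: (measurability _ (measurable_realfun.RGenOpens.measurableE R)).
  move=> _ [_ [a [b ->] <-]]; rewrite setTI; apply: sub_sigma_algebra.
  have /continuousP := @coord_continuous R 1 n.+1 0 0.
  by apply; exact: interval_open.
apply: measurable_borel_rV => U oU; apply: sub_sigma_algebra.
by have /continuousP := @continuous_rsubmx R 1 1 n; apply.
Qed.

Section step.
Context n (m : {sigma_finite_measure set (borel_rV R n) -> \bar R}).

Definition lebesgue_rV_step : set (borel_rV R n.+1) -> \bar R :=
  pushforward (@lebesgue_measure R \x m)%E (@rV_cons n).

Let measurable_preimage (A : set (borel_rV R n.+1)) :
  measurable A -> measurable (@rV_cons n @^-1` A).
Proof.
by move=> mA; rewrite -[X in measurable X]setTI; exact: measurable_rV_cons.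
Qed.

Let step0 : lebesgue_rV_step set0 = 0%E.
Proof. by rewrite /lebesgue_rV_step /pushforward preimage_set0 measure0. Qed.

Let step_ge0 A : (0 <= lebesgue_rV_step A)%E.
Proof. by rewrite /lebesgue_rV_step /pushforward; exact: measure_ge0. Qed.

Let step_sigma_additive : semi_sigma_additive lebesgue_rV_step.
Proof.
move=> F mF tF mUF; rewrite /lebesgue_rV_step /pushforward preimage_bigcup.
apply: measure_semi_sigma_additive.
- by move=> k; exact: measurable_preimage.
- apply/trivIsetP => /= i j _ _ ij; rewrite -preimage_setI.
  by move/trivIsetP : tF => /(_ _ _ _ _ ij) ->//; rewrite preimage_set0.
- by rewrite -preimage_bigcup; exact: measurable_preimage.
Qed.

HB.instance Definition _ := isMeasure.Build _ _ _ lebesgue_rV_step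
  step0 step_ge0 step_sigma_additive.

(* Proved from the factors: in this version of the library the sigma-finite
   instance of a product measure is masked by the one for subprobabilities. *)
Lemma lebesgue_rV_step_sigma_finite : sigma_finite setT lebesgue_rV_step.
Proof.
have /sigma_finiteP[F [FT ndF Foo]] := sigma_finiteT (@lebesgue_measure R).
have /sigma_finiteP[G [GT ndG Goo]] := sigma_finiteT m.
exists (fun k => @rV_uncons n @^-1` (F k `*` G k)).
  apply/seteqP; split => // v _.
  have [k _ Fk] : (\bigcup_k F k) (rV_uncons v).1 by rewrite -FT.
  have [l _ Gl] : (\bigcup_k G k) (rV_uncons v).2 by rewrite -GT.
  exists (maxn k l) => //; split => /=.
    by move: Fk; exact/subsetPset/ndF/leq_maxl.
  by move: Gl; exact/subsetPset/ndG/leq_maxr.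
move=> k; have [mF Fkoo] := Foo k; have [mG Gkoo] := Goo k; split.
  rewrite -[X in measurable X]setTI.
  by apply: measurable_rV_uncons => //; exact: measurableX.
rewrite /lebesgue_rV_step /pushforward -comp_preimage.
rewrite (_ : _ \o _ = id); last by apply/funext => z; exact: rV_consK.
by rewrite preimage_id product_measure1E// lte_mul_pinfty// ge0_fin_numE.
Qed.

HB.instance Definition _ := Measure_isSigmaFinite.Build _ _ _ lebesgue_rV_step
  lebesgue_rV_step_sigma_finite.

End step.

Fixpoint lebesgue_rV n : {sigma_finite_measure set (borel_rV R n) -> \bar R} :=
  match n with
  | 0%N => \d_(0 : borel_rV R 0)
  | n'.+1 => lebesgue_rV_step (lebesgue_rV n')
  end.

End lebesgue_rV.

Section lattice.
Context {R : realType} {d : nat}.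
Local Notation C := R[i].
Local Notation Zd := 'rV[int]_d.
Local Notation fctZd := (Zd -> C).
Local Notation normc := (@ComplexField.Normc.normc R).

Definition enorm (x : 'rV[R]_d) : R := Num.sqrt (\sum_(i < d) x 0 i ^+ 2).

Definition embed (n : Zd) : 'rV[R]_d := map_mx intr n.

Definition unit_sphere : set 'rV[R]_d := [set x | enorm x = 1].

(* ell^2(S) is realized by the functions on Z^d that vanish outside S. *)
Definition l2 (S : set Zd) : set fctZd :=
  [set u | (forall n, ~ S n -> u n = 0) /\
           summable [set: Zd] (fun n => (normc (u n) ^+ 2)%:E)].

Definition l2norm (u : fctZd) : R :=
  Num.sqrt (fine (\esum_(n in [set: Zd]) (normc (u n) ^+ 2)%:E)).

(* For S = Omega `&` Z^d this is A_Omega, and for S = Z^d it is A. The set of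
   m below is finite, so that the \sum over it is a genuine sum. *)
Definition schrodinger (S : set Zd) (f : Zd -> R) (u : fctZd) : fctZd :=
  fun n => if n \in S then
    - (\sum_(m \in [set m | S m /\ enorm (embed (m - n)) = 1]) u m)
    + (2 * d)%:R * u n + (f n)%:C%C * u n
  else 0.

Definition perturbed (f V : Zd -> R) (t : R) (u : fctZd) : fctZd :=
  fun n => schrodinger [set: Zd] f u n - (t * V n)%:C%C * u n.

Definition eigenfunctions (S : set Zd) (T : fctZd -> fctZd) (z : C) : set fctZd :=
  [set u | l2 S u /\ forall n, T u n = z * u n].

Definition lin_indep k (v : 'I_k -> fctZd) : Prop :=
  forall c : 'I_k -> C,
    (forall n, \sum_(i < k) c i * v i n = 0) -> forall i, c i = 0.

Definition dim (E : set fctZd) : \bar R :=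
  ereal_sup [set (k%:R)%:E | k in
    [set k : nat | exists v : 'I_k -> fctZd, (forall i, E (v i)) /\ lin_indep v]].

Definition resolvent_set (T : fctZd -> fctZd) : set C :=
  [set z | (forall w, l2 setT w ->
              exists! u, l2 setT u /\ forall n, T u n - z * u n = w n) /\
           exists M : R, forall u, l2 setT u ->
              l2norm u <= M * l2norm (fun n => T u n - z * u n)].

Definition spectrum (T : fctZd -> fctZd) : set C := ~` resolvent_set T.

Definition spectral_gap (T : fctZd -> fctZd) (a b : R) : Prop :=
  [/\ a < b,
      (forall x : R, a < x < b -> ~ spectrum T x%:C%C),
      spectrum T a%:C%C & spectrum T b%:C%C].

(* A_Omega is self-adjoint: its eigenvalues are real, and their multiplicities
   are the dimensions of the eigenspaces. *)
Definition eig_count (Omega : set 'rV[R]_d) (f : Zd -> R) (mu : R) : \bar R :=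
  let S := embed @^-1` Omega in
  \esum_(a in [set a : R | a < mu]) dim (eigenfunctions S (schrodinger S f) a%:C%C).

Definition density_domain (Omega : set 'rV[R]_d) : Prop :=
  [/\ Omega !=set0,
      open Omega,
      (exists r : R, forall x, Omega x -> enorm x <= r) &
      lebesgue_rV d (closure Omega `\` Omega°) = 0%E].

Definition density_of_states (f : Zd -> R) (rho : R -> R) : Prop :=
  forall (mu : R) (Omega : set 'rV[R]_d), density_domain Omega ->
    (eig_count [set beta *: y | y in Omega] f mu
       * ((beta ^+ d * fine (lebesgue_rV d Omega))^-1)%:E)%E
      @[beta --> +oo] --> (rho mu)%:E.

Definition asymptotic_potential (V : Zd -> R) (Psi : 'rV[R]_d -> R) (p : R) :=
  forall eps : R, 0 < eps -> exists r : R, forall n : Zd,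
    r < enorm (embed n) ->
    `|enorm (embed n) `^ p * V n
      - Psi ((enorm (embed n))^-1 *: embed n)| < eps.

Definition crossing_count (f V : Zd -> R) (lam alpha : R) : \bar R :=
  \esum_(t in [set t : R | 0 < t < alpha])
    dim (eigenfunctions setT (perturbed f V t) lam%:C%C).

(* The integrand; its (junk) value at x = 0 does not affect the integral. *)
Definition limit_density (rho : R -> R) (Psi : 'rV[R]_d -> R) (p lam : R)
    (x : borel_rV R d) : R :=
  rho (lam + Psi ((enorm x)^-1 *: (x : 'rV[R]_d)) * enorm x `^ (- p)) - rho lam.

End lattice.

(* Main.v *)
Require Import Defs.
From mathcomp Require Import all_boot all_order all_algebra complex.
From mathcomp Require Import all_classical all_reals all_analysis.
From mathcomp Require Import measurable_realfun.
From mathcomp Require Import ring lra zify.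

(** Write W = f - lam. The proof turns the number of crossings into indices of
    finite symmetric matrices, and evaluates these by the density of states.

    Birman-Schwinger. Let s be a finite set of sites outside which alpha V is
    small. As lam lies in the gap, -Delta + W - t V 1_(outside s) is invertible
    for all t <= alpha; let G_t be the compression of its inverse to s. Then
    ker (A - t V - lam) is isomorphic to the kernel of the matrix
    D t = 1/t - sqrt(V) G_t sqrt(V) on s ([dim_crossing]). D decreases strictly
    with t and is positive for small t, so each vanishing eigenvalue adds 1 to
    the number of negative eigenvalues for good: N(lam, alpha) is the index
    [negi (D alpha)] ([crossing_number], [crossing_countE]).

    Localization. Let H be the matrix of -Delta + W restricted to s. The product
    of H with G_alpha is the identity except in the rows of the boundary sites.
    For a true inverse, the two Schur complements of the block matrix with
    entries H, sqrt(V), sqrt(V), 1/alpha give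
    negi (D alpha) = negi (H - alpha V) - negi H; the defect costs at most twice
    its rank ([schur_comparison], [crossing_count_bounds]). Likewise, cutting s
    into cells changes these indices by at most the number of sites next to a
    wall ([decouple]).

    Scaling. Put alpha = kappa beta^p and let h(x) = Psi(x/|x|)|x|^-p. On the
    cell beta Q the potential alpha V is close to kappa h on Q, which is nearly
    constant if Q is small and away from 0, and the density of states says that
    -Delta + f restricted to beta Q has about beta^d vol(Q) rho(mu) eigenvalues
    below mu. The walls carry O(beta^(d-1)) sites, and the cells close to 0 have
    a small total volume. So beta^-d N(lam, alpha) is close to a Riemann sum for
    the integral of rho(lam + kappa h) - rho(lam)
    ([crossing_count_le], [crossing_count_ge]).

    Since rho may have jumps, the errors made in h cannot be absorbed by
    continuity of rho. They are absorbed by kappa: for kappa < 1,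
    kappa h + error <= h wherever h is not small, and where h is small
    rho(lam + kappa h + error) = rho(lam), because rho is constant in the gap
    ([rho_const]). This bounds the upper limit by the integral, kappa > 1 bounds
    the lower limit ([crossing_count_upper], [crossing_count_lower]), and
    alpha^(-d/p) = kappa^(-d/p) beta^-d allows kappa to tend to 1. *)

Set Implicit Arguments.
Unset Strict Implicit.
Unset Printing Implicit Defensive.

Import Order.TTheory GRing.Theory Num.Theory.
Import numFieldNormedType.Exports.

Local Open Scope classical_set_scope.
Local Open Scope ring_scope.

(** * The index of a symmetric matrix *)

Section bilinear_forms.
Context {R : realType}.

Definition bf m n (H : 'M[R]_(m, n)) (x : 'rV[R]_m) (y : 'rV[R]_n) : R :=
  (x *m H *m y^T) 0 0.

Definition qf n (H : 'M[R]_n) (x : 'rV[R]_n) : R := bf H x x.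

Lemma bfE m n (H : 'M[R]_(m, n)) x y :
  bf H x y = \sum_i \sum_j x 0 i * H i j * y 0 j.
Proof.
rewrite /bf mxE exchange_big/=; apply: eq_bigr => j _.
by rewrite !mxE mulr_suml; apply: eq_bigr => i _.
Qed.

Lemma bfDl m n (H : 'M[R]_(m, n)) x x' y : bf H (x + x') y = bf H x y + bf H x' y.
Proof. by rewrite /bf !mulmxDl mxE. Qed.

Lemma bfDr m n (H : 'M[R]_(m, n)) x y y' : bf H x (y + y') = bf H x y + bf H x y'.
Proof. by rewrite /bf linearD/= mulmxDr mxE. Qed.

Lemma bfDm m n (H K : 'M[R]_(m, n)) x y : bf (H + K) x y = bf H x y + bf K x y.
Proof. by rewrite /bf mulmxDr mulmxDl mxE. Qed.

Lemma bfZl m n (H : 'M[R]_(m, n)) a x y : bf H (a *: x) y = a * bf H x y.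
Proof. by rewrite /bf -!scalemxAl mxE. Qed.

Lemma bfZr m n (H : 'M[R]_(m, n)) a x y : bf H x (a *: y) = a * bf H x y.
Proof. by rewrite /bf linearZ/= -!scalemxAr mxE. Qed.

Lemma bfZm m n (H : 'M[R]_(m, n)) a x y : bf (a *: H) x y = a * bf H x y.
Proof. by rewrite /bf -scalemxAr -!scalemxAl mxE. Qed.

Lemma bfNl m n (H : 'M[R]_(m, n)) x y : bf H (- x) y = - bf H x y.
Proof. by rewrite /bf !mulNmx mxE. Qed.

Lemma bfNr m n (H : 'M[R]_(m, n)) x y : bf H x (- y) = - bf H x y.
Proof. by rewrite /bf linearN/= mulmxN mxE. Qed.

Lemma bfNm m n (H : 'M[R]_(m, n)) x y : bf (- H) x y = - bf H x y.
Proof. by rewrite /bf mulmxN mulNmx mxE. Qed.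

Lemma bf0m m n x y : bf (0 : 'M[R]_(m, n)) x y = 0.
Proof. by rewrite /bf mulmx0 mul0mx mxE. Qed.

Lemma bf0l m n (H : 'M[R]_(m, n)) y : bf H 0 y = 0.
Proof. by rewrite /bf !mul0mx mxE. Qed.

Definition bflin := (bfDl, bfDr, bfDm, bfZl, bfZr, bfZm, bfNl, bfNr, bfNm).

Lemma bfC n (H : 'M[R]_n) x y : H^T = H -> bf H x y = bf H y x.
Proof.
by move=> Hs; rewrite /bf -[in LHS](trmxK (_ *m _)) mxE !trmx_mul !trmxK Hs mulmxA.
Qed.

Lemma bf_mulr m n p (H : 'M[R]_(m, n)) (T : 'M[R]_(p, n)) x y :
  bf H x (y *m T) = bf (H *m T^T) x y.
Proof. by rewrite /bf trmx_mul !mulmxA. Qed.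

Lemma bf_mull m n p (H : 'M[R]_(m, n)) (T : 'M[R]_(p, m)) x y :
  bf H (x *m T) y = bf (T *m H) x y.
Proof. by rewrite /bf !mulmxA. Qed.

Lemma qf_pull m n (H : 'M[R]_n) (L : 'M[R]_(m, n)) c :
  qf (L *m H *m L^T) c = qf H (c *m L).
Proof. by rewrite /qf bf_mulr bf_mull mulmxA. Qed.

Lemma qf1E n (x : 'rV[R]_n) : qf 1%:M x = \sum_i x 0 i ^+ 2.
Proof.
by rewrite /qf /bf mulmx1 mxE; apply: eq_bigr => i _; rewrite !mxE expr2.
Qed.

Lemma qf1_ge0 n (x : 'rV[R]_n) : 0 <= qf 1%:M x.
Proof. by rewrite qf1E; apply: sumr_ge0 => i _; exact: sqr_ge0. Qed.

Lemma qf1_gt0 n (x : 'rV[R]_n) : x != 0 -> 0 < qf 1%:M x.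
Proof.
move=> x0; rewrite lt_neqAle qf1_ge0 andbT eq_sym; apply: contra x0.
rewrite qf1E psumr_eq0 => [/allP x0|i _]; last exact: sqr_ge0.
apply/eqP/rowP => i; rewrite mxE; apply/eqP.
by rewrite -sqrf_eq0; apply: x0; rewrite mem_index_enum.
Qed.

Lemma qf0 n (H : 'M[R]_n) : qf H 0 = 0.
Proof. exact: bf0l. Qed.

Lemma rank_capmx_ge n m1 m2 (A : 'M[R]_(m1, n)) (B : 'M[R]_(m2, n)) :
  (\rank A + \rank B <= n + \rank (A :&: B)%MS)%N.
Proof. by rewrite -mxrank_sum_cap leq_add2r rank_leq_col. Qed.

(** The preimage is a kernel, so that rank-nullity gives its dimension. *)
Lemma preim_mx n p m (T : 'M[R]_(n, p)) (W : 'M[R]_(m, p)) :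
  exists2 K : 'M[R]_n, (n + \rank W <= p + \rank K)%N &
    forall x : 'rV[R]_n, (x <= K)%MS = (x *m T <= W)%MS.
Proof.
exists (kermx (T *m cokermx W)); last first.
  by move=> x; rewrite sub_kermx submxE mulmxA.
rewrite mxrank_ker; have := mxrankM_maxr T (cokermx W); rewrite mxrank_coker.
have := rank_leq_col W; have := rank_leq_row (T *m cokermx W); set a := \rank (T *m _); set b := \rank W; clearbody a b; lia.
Qed.

End bilinear_forms.

Section negative_index.
Context {R : realType}.

Definition negdef_on n (H : 'M[R]_n) k (L : 'M[R]_(k, n)) : Prop :=
  forall c : 'rV[R]_k, c != 0 -> qf H (c *m L) < 0.

(** The largest dimension of a subspace on which the form is negative definite,
    that is, the number of negative eigenvalues of a symmetric H. A subspace is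
    given by rows L, which [negdef_on] forces to be linearly independent. *)
Definition negi n (H : 'M[R]_n) : nat :=
  (\max_(k < n.+1 | `[< exists L : 'M[R]_(k, n), negdef_on H L >]) k)%N.

Lemma negi_ge n (H : 'M[R]_n) k (L : 'M[R]_(k, n)) :
  negdef_on H L -> (k <= negi H)%N.
Proof.
move=> HL.
have kn : (k < n.+1)%N.
  rewrite ltnS; suff /eqP <- : row_free L by exact: rank_leq_col.
  rewrite -kermx_eq0; apply/eqP/row_matrixP => i; rewrite row0.
  apply/eqP; apply/negP => /negP /HL; rewrite -row_mul mulmx_ker row0 qf0.
  by rewrite ltxx.
by apply: (leq_bigmax_cond (Ordinal kn)); apply/asboolP; exists L.
Qed.

Lemma negi_ex n (H : 'M[R]_n) : exists L : 'M[R]_(negi H, n), negdef_on H L.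
Proof.
have P0 : `[< exists L : 'M[R]_(@ord0 n, n), negdef_on H L >].
  apply/asboolP; exists 0 => c /negP[]; apply/eqP; exact: thinmx0.
rewrite /negi (bigop.bigmax_eq_arg ord0)//.
by case: arg_maxnP => // i /asboolP.
Qed.

(** A negative subspace may be exhibited through a linear map T: on U it is
    injective, as the form vanishes at 0. *)
Lemma negi_subspace n p (H : 'M[R]_p) m (U : 'M[R]_(m, n)) (T : 'M[R]_(n, p)) :
  (forall x : 'rV_n, (x <= U)%MS -> x != 0 -> qf H (x *m T) < 0) ->
  (\rank U <= negi H)%N.
Proof.
move=> UH; apply: (@negi_ge _ _ _ (row_base U *m T)) => c c0.
rewrite mulmxA; apply: UH.
  by rewrite (submx_trans (submxMl _ _))// eq_row_base.
apply: contra c0 => /eqP cU; apply/eqP.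
by apply: (row_free_inj (row_base_free U)); rewrite cU mul0mx.
Qed.

Lemma negi_space n (H : 'M[R]_n) :
  exists2 U : 'M[R]_n, \rank U = negi H &
    forall x : 'rV_n, (x <= U)%MS -> x != 0 -> qf H x < 0.
Proof.
have [L HL] := negi_ex H.
have neg (x : 'rV_n) : (x <= L)%MS -> x != 0 -> qf H x < 0.
  move=> /submxP[c ->] cL; apply: HL; apply: contra cL => /eqP ->.
  by rewrite mul0mx.
exists (<<L>>)%MS; last by move=> x; rewrite genmxE; exact: neg.
rewrite genmxE; suff /eqP : row_free L by [].
rewrite -kermx_eq0; apply/rowV0P => c /sub_kermxP cL; apply/eqP.
by apply: contraT => /HL; rewrite cL qf0 ltxx.
Qed.

(** W is the orthogonal complement for H of a maximal negative subspace U: a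
    vector of W with negative value would enlarge U. *)
Lemma inertia n (H : 'M[R]_n) : H^T = H -> exists U W : 'M[R]_n,
  [/\ \rank U = negi H, (n <= \rank W + negi H)%N,
      forall x : 'rV_n, (x <= U)%MS -> x != 0 -> qf H x < 0,
      forall x : 'rV_n, (x <= W)%MS -> 0 <= qf H x &
      forall x y : 'rV_n, (x <= W)%MS -> (y <= U)%MS -> bf H x y = 0].
Proof.
move=> Hs; have [U rU HU] := negi_space H.
exists U, (kermx (H *m U^T)).
have orth (x y : 'rV_n) :
    (x <= kermx (H *m U^T))%MS -> (y <= U)%MS -> bf H x y = 0.
  by move=> /sub_kermxP xU /submxP[c ->]; rewrite bf_mulr /bf xU mul0mx mxE.
split=> //.
  by rewrite mxrank_ker; have := mxrankM_maxr H U^T; rewrite mxrank_tr rU; set a := \rank _; clearbody a; lia.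
move=> x xW; rewrite leNgt; apply/negP => Hx.
have x0 : x != 0 by apply: contraTneq Hx => ->; rewrite qf0 ltxx.
have xU0 : ~~ (x <= U)%MS.
  by apply/negP => /(orth _ _ xW) x2; move: Hx; rewrite /qf x2 ltxx.
have : (\rank (x + U)%MS <= negi H)%N.
  apply: (negi_subspace (T := 1%:M)) => y /sub_addsmxP[[/= a b] ->] y0.
  rewrite mulmx1; move: y0; rewrite (mx11_scalar a) mul_scalar_mx.
  move: (a 0 0) => k y0.
  have bU : (b *m U <= U)%MS by exact: submxMl.
  have -> : qf H (k *: x + b *m U) = k ^+ 2 * qf H x + qf H (b *m U).
    by rewrite /qf !bflin (bfC _ x Hs) (orth _ _ xW bU); ring.
  have [b0|b0] := eqVneq (b *m U) 0.
    rewrite b0 qf0 addr0 pmulr_rlt0// exprn_even_gt0//=.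
    by apply: contraNneq y0 => ->; rewrite b0 addr0 scale0r.
  rewrite -[ltRHS]addr0; apply: ler_ltD; last exact: HU.
  by apply: mulr_ge0_le0; [exact: sqr_ge0|exact: ltW].
rewrite -rU leqNgt => /negP; apply; apply: rank_ltmx.
by rewrite ltmxE addsmxSr addsmx_sub negb_and xU0.
Qed.

Lemma psd_space n (H : 'M[R]_n) : H^T = H ->
  exists2 W : 'M[R]_n, (n <= \rank W + negi H)%N &
    forall x : 'rV_n, (x <= W)%MS -> 0 <= qf H x.
Proof. by move=> /inertia[_ [W [_ rW _ HW _]]]; exists W. Qed.

(** On the nonnegative complement W of a maximal negative subspace the isotropic
    vectors are in the radical of H, hence H is positive definite on a complement
    in W of the kernel. *)
Lemma sylvester n (H : 'M[R]_n) : H^T = H ->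
  (\rank H <= negi H + negi (- H))%N.
Proof.
move=> Hs; have [U [W [rU rW HU HW orth]]] := inertia Hs.
have UW0 : (U :&: W)%MS = 0.
  apply/eqP/rowV0P => x; rewrite sub_capmx => /andP[xU xW]; apply/eqP.
  by apply: contraT => /(HU _ xU); rewrite ltNge HW.
have full (z : 'rV_n) : (z <= U + W)%MS.
  apply: submx_full; rewrite /row_full eqn_leq rank_leq_col/=.
  by rewrite (mxrank_disjoint_sum UW0) rU addnC.
have null (x : 'rV_n) : (x <= W)%MS -> qf H x = 0 -> (x <= kermx H)%MS.
  move=> xW x0; apply/sub_kermxP.
  have xw (w : 'rV_n) : (w <= W)%MS -> bf H x w = 0.
    move=> wW; have nneg s : 0 <= qf H w + s * bf H x w.
      have : 0 <= qf H (w + (s / 2) *: x).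
        by apply: HW; rewrite addmx_sub// scalemx_sub.
      by rewrite {1}/qf !bflin (bfC w) // -!/(qf _ _) x0; lra.
    apply/eqP; apply: contraT => xw0.
    have := nneg (- (qf H w + 1) / bf H x w).
    by rewrite divfK//; lra.
  apply/rowP => j; rewrite [RHS]mxE.
  have /sub_addsmxP[[/= a c] ac] := full (delta_mx 0 j).
  have : bf H x (delta_mx 0 j) = 0.
    by rewrite ac bfDr orth ?submxMl// xw ?submxMl// addr0.
  rewrite bfE => E; rewrite mxE -[RHS]E; apply: eq_bigr => i _.
  rewrite (bigD1 j)//= mxE !eqxx mulr1 big1 ?addr0// => k kj.
  by rewrite mxE (negbTE kj) andbF mulr0.
have : (\rank (W :\: kermx H)%MS <= negi (- H))%N.
  apply: (negi_subspace (T := 1%:M)) => x xD x0; rewrite mulmx1 /qf bfNm oppr_lt0.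
  have xW : (x <= W)%MS by apply: submx_trans xD (diffmxSl _ _).
  rewrite lt_neqAle HW// andbT eq_sym; apply: contra x0 => /eqP /(null _ xW) xK.
  have : (x <= (W :\: kermx H) :&: kermx H)%MS by rewrite sub_capmx xD.
  by rewrite capmx_diff submx0.
have := mxrank_cap_compl W (kermx H); have := mxrankS (capmxSr W (kermx H)).
rewrite mxrank_ker; have := rank_leq_row H; move: rW.
set a := \rank W; set b := \rank H; set c := \rank (_ :\: _); set e := \rank (_ :&: _).
by clearbody a b c e; clear; lia.
Qed.

(** A negative definite subspace meets a nonnegative one trivially. *)
Lemma negi_le_psd n (H : 'M[R]_n) m (W : 'M[R]_(m, n)) :
  (forall x : 'rV_n, (x <= W)%MS -> 0 <= qf H x) ->
  (negi H + \rank W <= n)%N.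
Proof.
move=> HW; have [U <- HU] := negi_space H.
have := rank_capmx_ge U W; suff -> : (U :&: W)%MS = 0 by rewrite mxrank0 addn0.
apply/eqP/rowV0P => x; rewrite sub_capmx => /andP[xU xW]; apply/eqP.
by apply: contraT => /(HU _ xU); rewrite ltNge HW.
Qed.

Lemma negi_pull m n (H : 'M[R]_n) (L : 'M[R]_(m, n)) :
  (negi (L *m H *m L^T) <= negi H)%N.
Proof.
have [M HM] := negi_ex (L *m H *m L^T).
by apply: (negi_ge (L := M *m L)) => c c0; rewrite mulmxA -qf_pull; exact: HM.
Qed.

Lemma negi_le_pull m n (H : 'M[R]_n) (L : 'M[R]_(m, n)) :
  (negi H + \rank L <= negi (L *m H *m L^T) + n)%N.
Proof.
have [U <- HU] := negi_space H.
apply: leq_trans (rank_capmx_ge U L) _; rewrite addnC leq_add2r.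
apply: (negi_subspace (T := pinvmx L)) => x; rewrite sub_capmx => /andP[xU xL] x0.
by rewrite qf_pull mulmxKpV//; exact: HU.
Qed.

Lemma negi_mono n (H K : 'M[R]_n) :
  (forall x, qf K x <= qf H x) -> (negi H <= negi K)%N.
Proof.
move=> KH; have [L HL] := negi_ex H.
by apply: (negi_ge (L := L)) => c c0; exact: le_lt_trans (KH _) (HL _ c0).
Qed.

(** The form of A + B is nonnegative where those of A and B are. *)
Lemma negi_subadd n (A B : 'M[R]_n) : A^T = A -> B^T = B ->
  (negi (A + B) <= negi A + negi B)%N.
Proof.
move=> As Bs; have [W rW AW] := psd_space As; have [X rX BX] := psd_space Bs.
have := rank_capmx_ge W X; have : (negi (A + B) + \rank (W :&: X) <= n)%N.
  apply: negi_le_psd => x; rewrite sub_capmx => /andP[xW xX].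
  by rewrite /qf bfDm addr_ge0; [|exact: AW|exact: BX].
move: rW rX; set w := \rank W; set y := \rank X; set z := \rank _.
clearbody w y z; lia.
Qed.

Lemma negi0 n : negi (0 : 'M[R]_n) = 0%N.
Proof.
have : (negi (0 : 'M[R]_n) + \rank (1%:M : 'M[R]_n) <= n)%N.
  by apply: negi_le_psd => x _; rewrite /qf bf0m.
by rewrite mxrank1; lia.
Qed.

Definition coordmx n (P : pred 'I_n) : 'M[R]_n := diag_mx (\row_i (P i)%:R).

Lemma coordmx_tr n (P : pred 'I_n) : (coordmx P)^T = coordmx P.
Proof. exact: tr_diag_mx. Qed.

Lemma coordmxM n (P Q : pred 'I_n) : coordmx P *m coordmx Q = coordmx (predI P Q).
Proof.
rewrite /coordmx mulmx_diag; congr diag_mx; apply/rowP => i.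
by rewrite !mxE /= -natrM mulnb.
Qed.

Lemma coordmx_mulE n (P Q : pred 'I_n) (A : 'M[R]_n) i j :
  (coordmx P *m A *m coordmx Q) i j = (P i)%:R * A i j * (Q j)%:R.
Proof.
by rewrite /coordmx mul_mx_diag mul_diag_mx !mxE.
Qed.

Lemma rank_coordmx n (P : pred 'I_n) : (\rank (coordmx P) <= #|P|)%N.
Proof.
rewrite /coordmx diag_mx_sum_delta -sum1_card [leqRHS]big_mkcond/=.
elim/big_rec2 : _ => [|i a A _ aA]; first by rewrite mxrank0.
apply: leq_trans (mxrank_add _ _) _; rewrite leq_add// mxE -topredE/=.
by case: (P i); rewrite ?scale1r ?mxrank_delta// scale0r mxrank0.
Qed.

Lemma rank_coordmx_ge n (P : pred 'I_n) : (n <= \rank (coordmx P) + #|predC P|)%N.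
Proof.
have : (\rank (1%:M : 'M[R]_n) <= \rank (coordmx P) + #|predC P|)%N; last by rewrite mxrank1.
have -> : 1%:M = coordmx P + coordmx (predC P).
  apply/matrixP => i j; rewrite !mxE /=; case: (P i); case: (i == j);
    by rewrite ?mulr1n ?mulr0n ?addr0 ?add0r.
by apply: leq_trans (mxrank_add _ _) _; rewrite leq_add2l rank_coordmx.
Qed.

Lemma negi_le_coordmx n (H : 'M[R]_n) (P : pred 'I_n) :
  (negi H <= negi (coordmx P *m H *m coordmx P) + #|predC P|)%N.
Proof.
have := negi_le_pull H (coordmx P); rewrite coordmx_tr; have := rank_coordmx_ge P.
set a := \rank _; clearbody a; lia.
Qed.

Lemma negi_coordmx_le n (H : 'M[R]_n) (P : pred 'I_n) :
  (negi (coordmx P *m H *m coordmx P) <= negi H)%N.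
Proof. by have := negi_pull H (coordmx P); rewrite coordmx_tr. Qed.

(** H and K have the same compression to the coordinates in P, and a compression
    lowers the index by at most one per deleted coordinate. *)
Lemma negi_agree n (H K : 'M[R]_n) (P : pred 'I_n) :
  (forall i j, P i -> P j -> H i j = K i j) ->
  (negi H <= negi K + #|predC P|)%N.
Proof.
move=> HK; apply: leq_trans (negi_le_coordmx H P) _; rewrite leq_add2r.
apply: leq_trans (negi_coordmx_le K P); apply: eq_leq; congr negi.
apply/matrixP => i j; rewrite !coordmx_mulE.
by case: (boolP (P i)) => Pi; case: (boolP (P j)) => Pj;
  rewrite ?mul0r ?mulr0// HK.
Qed.

(** Negative subspaces carried by disjoint sets of coordinates add up. *)
Lemma negi_direct n (A B : 'M[R]_n) (P Q : pred 'I_n) : A^T = A -> B^T = B ->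
  coordmx P *m A *m coordmx P = A -> coordmx Q *m B *m coordmx Q = B ->
  (forall i, P i -> ~~ Q i) ->
  negi (A + B) = (negi A + negi B)%N.
Proof.
move=> As Bs AP BQ PQ; apply/eqP; rewrite eqn_leq negi_subadd//=.
have PQ0 : coordmx P *m coordmx Q = 0.
  rewrite coordmxM; apply/matrixP => i j; rewrite !mxE /=.
  by case: (boolP (P i)) => [/PQ/negbTE ->|_]; rewrite mul0rn.
have QP0 : coordmx Q *m coordmx P = 0 by rewrite -[LHS]trmxK trmx_mul !coordmx_tr PQ0 trmx0.
have id S : coordmx S *m coordmx S = coordmx S :> 'M[R]_n.
  by rewrite coordmxM; apply/matrixP => i j; rewrite !mxE /= andbb.
have qA x : qf A x = qf A (x *m coordmx P) by rewrite -qf_pull coordmx_tr AP.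
have qB x : qf B x = qf B (x *m coordmx Q) by rewrite -qf_pull coordmx_tr BQ.
have [L HL] := negi_ex A; have [M HM] := negi_ex B.
apply: (negi_ge (L := col_mx (L *m coordmx P) (M *m coordmx Q))) => c c0.
rewrite -(hsubmxK c) mul_row_col !mulmxA.
set x := lsubmx c *m L; set y := rsubmx c *m M.
have -> : qf (A + B) (x *m coordmx P + y *m coordmx Q) = qf A x + qf B y.
  rewrite {1}/qf bfDm -!/(qf _ _) qA qB !mulmxDl -!mulmxA !id PQ0 QP0.
  by rewrite !mulmx0 addr0 add0r !mulmxA -qA -qB.
have leA : qf A x <= 0.
  have [l0|/HL/ltW//] := eqVneq (lsubmx c) 0.
  by rewrite /x l0 mul0mx qf0.
have [r0|/HM yB] := eqVneq (rsubmx c) 0; last by rewrite -[ltRHS]addr0 ler_ltD.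
rewrite /y r0 mul0mx qf0 addr0; apply: HL.
by apply: contra c0 => /eqP l0; rewrite -(hsubmxK c) l0 r0 row_mx0.
Qed.

Lemma negi_direct_sum n (H : 'M[R]_n) (J : eqType) (P : J -> pred 'I_n) (l : seq J) :
  H^T = H -> uniq l ->
  (forall i j k, P j i -> P k i -> j = k) ->
  negi (\sum_(j <- l) coordmx (P j) *m H *m coordmx (P j)) =
  (\sum_(j <- l) negi (coordmx (P j) *m H *m coordmx (P j)))%N.
Proof.
move=> Hs + Pd; elim: l => [|j l IH] /=; first by rewrite !big_nil negi0.
move=> /andP[jl /IH {}IH]; rewrite !big_cons.
have sym k : (coordmx (P k) *m H *m coordmx (P k))^T = coordmx (P k) *m H *m coordmx (P k).
  by rewrite !trmx_mul !coordmx_tr Hs mulmxA.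
rewrite (negi_direct (P := P j) (Q := fun i => has (P^~ i) l)) ?IH//.
- by rewrite linear_sum/=; apply: eq_bigr => k _; exact: sym.
- by apply/matrixP => i k; rewrite !coordmx_mulE; case: (P j i); case: (P j k);
    rewrite ?(mul0r, mulr0, mul1r, mulr1).
- apply/matrixP => i k; rewrite coordmx_mulE summxE mulr_sumr mulr_suml.
  apply: eq_big_seq => m ml; rewrite coordmx_mulE.
  have [Pi|] := boolP (P m i); last by rewrite !(mul0r, mulr0).
  have [Pk|] := boolP (P m k); last by rewrite !(mul0r, mulr0).
  have -> : has (P^~ i) l by apply/hasP; exists m.
  have -> : has (P^~ k) l by apply/hasP; exists m.
  by rewrite !(mul1r, mulr1).
move=> i Pji; apply/hasPn => k kl; apply/negP => /(Pd _ _ _ Pji) jk.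
by move: jl; rewrite jk kl.
Qed.

Lemma rank_mulmxC_sub1 n (H G : 'M[R]_n) : H^T = H -> G^T = G ->
  \rank (H *m G - 1%:M)%R = \rank (G *m H - 1%:M)%R.
Proof.
by move=> Hs Gs; rewrite -mxrank_tr linearB/= trmx_mul Hs Gs trmx1.
Qed.

(** If G inverts H then x |-> x H carries the form of H to that of G. In general
    this holds on the kernel of H G - 1. *)
Lemma negi_inverse n (H G : 'M[R]_n) : H^T = H ->
  (negi H <= negi G + \rank (H *m G - 1%:M)%R)%N.
Proof.
move=> Hs; have [U <- HU] := negi_space H; set r := \rank (_ - _)%R.
have := rank_capmx_ge U (kermx (H *m G - 1%:M)%R); rewrite mxrank_ker -/r.
have := rank_leq_row (H *m G - 1%:M); rewrite -/r.
have : (\rank (U :&: kermx (H *m G - 1%:M)%R) <= negi G)%N; last first.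
  by set a := \rank (_ :&: _); set b := \rank U; clearbody a b r; lia.
apply: (negi_subspace (T := H)) => x; rewrite sub_capmx => /andP[xU].
move=> /sub_kermxP /eqP; rewrite mulmxBr mulmx1 mulmxA subr_eq0 => /eqP xHG x0.
have -> : qf G (x *m H) = qf H x; last exact: HU.
by rewrite /qf /bf xHG trmx_mul Hs mulmxA.
Qed.

Section schur.
Variables (n : nat) (H G S : 'M[R]_n) (a : R).
Hypotheses (Hs : H^T = H) (Gs : G^T = G) (Ss : S^T = S) (a0 : 0 < a).
Let D := a *: 1%:M - S *m G *m S.
Let Ha := H - a^-1 *: (S *m S).

Let qfS x : qf (S *m S) x = qf 1%:M (x *m S).
Proof. by rewrite /qf bf_mulr bf_mull Ss mul1mx. Qed.

Let square x b : - (a^-1 * qf 1%:M (x *m S)) <= 2 * bf 1%:M (x *m S) b + a * qf 1%:M b.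
Proof.
have := qf1_ge0 (a^-1 *: (x *m S) + b); rewrite -(pmulr_rge0 _ a0).
rewrite {1}/qf !bflin -!/(qf _ _) (bfC b) ?trmx1// => h; rewrite -subr_ge0.
apply: le_trans h _; rewrite le_eqVlt; apply/orP; left; apply/eqP.
by field; rewrite gt_eqF.
Qed.

(** For G inverse to H, the matrices D and Ha are the Schur complements of the
    block matrix with rows (H, S) and (S, a). Here a negative direction y of G and
    a negative direction b of D are combined into the direction (y - b S) G for Ha;
    the defect G H - 1 costs its rank. *)
Lemma schur_le : (negi D + negi G <= negi Ha + \rank (H *m G - 1%:M)%R)%N.
Proof.
rewrite rank_mulmxC_sub1//; set r := \rank (_ - _)%R.
have [LG HG] := negi_ex G; have [LD HD] := negi_ex D.
pose T := col_mx LG (- (LD *m S)).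
have rT : (\rank (T *m (G *m H - 1%:M))%R <= r)%N by exact: mxrankM_maxr.
have : (\rank (kermx (T *m (G *m H - 1%:M))%R) <= negi Ha)%N; last first.
  rewrite mxrank_ker.
  by move: rT; set k := \rank _; clearbody k r; clear; lia.
apply: (negi_subspace (T := T *m G)) => c /sub_kermxP.
rewrite mulmxA mulmxBr mulmx1 => /eqP; rewrite subr_eq0 => /eqP cT c0.
set y := lsubmx c *m LG; set b := rsubmx c *m LD.
have cTE : c *m T = y - b *m S.
  by rewrite -[in LHS](hsubmxK c) mul_row_col mulmxN mulmxA.
set w := c *m T in cT cTE *; set x := w *m G.
have -> : c *m (T *m G) = x by rewrite mulmxA.
have qHx : qf H x = qf G w.
  by rewrite /qf /bf /x -(mulmxA w) cT trmx_mul Gs mulmxA.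
have qGw : qf G w = qf G y - 2 * bf G y (b *m S) + qf G (b *m S).
  by rewrite cTE /qf !bflin (bfC _ (b *m S)) //; ring.
have xSb : bf 1%:M (x *m S) b = bf G y (b *m S) - qf G (b *m S).
  rewrite (_ : bf 1%:M _ _ = bf G w (b *m S)); first by rewrite cTE /qf !bflin.
  by rewrite /bf (trmx_mul b S) Ss mulmx1 /x !mulmxA.
have qD : qf D b = a * qf 1%:M b - qf G (b *m S).
  by rewrite /D {1}/qf !bflin -!/(qf _ _) -{2}Ss qf_pull.
have qHa : qf Ha x = qf H x - a^-1 * qf 1%:M (x *m S).
  by rewrite /Ha {1}/qf !bflin -!/(qf _ _) qfS.
have sq := square x b; rewrite xSb in sq.
apply: (@le_lt_trans _ _ (qf G y + qf D b)).
  by rewrite qHa qHx qGw qD; lra.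
have leG : qf G y <= 0.
  by have [l0|/HG/ltW//] := eqVneq (lsubmx c) 0; rewrite /y l0 mul0mx qf0.
have [r0|/HD bD] := eqVneq (rsubmx c) 0; last by rewrite -[ltRHS]addr0 ler_ltD.
rewrite /b r0 mul0mx qf0 addr0; apply: HG.
by apply: contra c0 => /eqP l0; rewrite -(hsubmxK c) l0 r0 row_mx0.
Qed.

(** With b = - a^-1 x S, completing the square gives
    qf D b = qf Ha x - qf G (x Ha), which is negative if x is a negative direction
    of Ha that Ha sends into a nonnegative subspace of G. *)
Lemma schur_ge : (negi Ha <= negi D + negi G + \rank (H *m G - 1%:M)%R)%N.
Proof.
set r := \rank (_ - _)%R.
have [U <- HU] := negi_space Ha.
have [W rW GW] := psd_space Gs.
have [K rK HK] := preim_mx Ha W.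
have := rank_capmx_ge (U :&: K)%MS (kermx (H *m G - 1%:M)%R); rewrite mxrank_ker -/r.
have := rank_capmx_ge U K.
have := rank_leq_row (H *m G - 1%:M); rewrite -/r.
have : (\rank (U :&: K :&: kermx (H *m G - 1%:M)%R) <= negi D)%N; last first.
  move: rW rK; set k1 := \rank (_ :&: _ :&: _); set k2 := \rank U; set k3 := \rank W.
  set k4 := \rank K; set k5 := \rank (_ :&: _).
  by clearbody k1 k2 k3 k4 k5 r; clear; lia.
apply: (negi_subspace (T := - a^-1 *: S)) => x; rewrite !sub_capmx => /andP[/andP[xU]].
rewrite HK => xK /sub_kermxP /eqP; rewrite mulmxBr mulmx1 mulmxA subr_eq0 => /eqP xHG x0.
set b := x *m _; have bE : b = - a^-1 *: (x *m S) by rewrite /b -scalemxAr.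
have qHx : bf G (x *m H) (x *m H) = qf H x.
  by rewrite /qf /bf xHG trmx_mul Hs mulmxA.
have y_ge0 := GW _ xK; set y := x *m Ha in y_ge0.
have yE : y = x *m H + b *m S.
  by rewrite /y /Ha mulmxBr bE -scalemxAl -scalemxAr mulmxA scaleNr.
have qD : qf D b = a * qf 1%:M b - qf G (b *m S).
  by rewrite /D {1}/qf !bflin -!/(qf _ _) -{2}Ss qf_pull.
have qb : qf 1%:M b = a^-1 ^+ 2 * qf 1%:M (x *m S).
  by rewrite bE /qf !bflin; ring.
have xSb : bf G (x *m H) (b *m S) = - a^-1 * qf 1%:M (x *m S).
  rewrite (_ : bf G _ _ = bf 1%:M (x *m S) b); first by rewrite bE /qf !bflin.
  by rewrite /bf xHG (trmx_mul b S) Ss mulmx1 !mulmxA.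
have qGy : qf G y = qf H x - 2 * (a^-1 * qf 1%:M (x *m S)) + qf G (b *m S).
  by rewrite yE {1}/qf !bflin (bfC (b *m S)) // qHx xSb -!/(qf _ _); ring.
have qHa : qf Ha x = qf H x - a^-1 * qf 1%:M (x *m S).
  by rewrite /Ha {1}/qf !bflin -!/(qf _ _) qfS.
have -> : qf D b = qf Ha x - qf G y.
  by rewrite qD qHa qGy qb; field; rewrite gt_eqF.
by rewrite -[ltRHS](subrr 0) ltr_leB// HU.
Qed.

End schur.

(** For an exact inverse G, both negi D + negi H and negi Ha are the index of the
    block matrix with rows (H, S) and (S, a). The defect r is paid twice: once to
    replace the index of G by that of H, once in the comparison. *)
Theorem schur_comparison n (H G S : 'M[R]_n) (a : R) r :
  H^T = H -> G^T = G -> S^T = S -> 0 < a -> (\rank (H *m G - 1%:M)%R <= r)%N ->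
  let D := a *: 1%:M - S *m G *m S in
  let Ha := H - a^-1 *: (S *m S) in
  (negi D + negi H <= negi Ha + r.*2)%N /\ (negi Ha <= negi D + negi H + r.*2)%N.
Proof.
move=> Hs Gs Ss a0 rr D Ha.
have := schur_le Hs Gs Ss a0; have := schur_ge Hs Gs Ss a0.
have := negi_inverse G Hs; have := negi_inverse H Gs.
rewrite -rank_mulmxC_sub1// -/D -/Ha; move: rr; set k := \rank _.
by clearbody k; lia.
Qed.

End negative_index.

(** * Crossings of a decreasing family of matrices *)

Section stability.
Context {R : realType}.

Lemma bf_le_qf1 n (A : 'M[R]_n) : exists2 C : R, 0 < C & forall x, `|qf A x| <= C * qf 1%:M x.
Proof.
exists (1 + \sum_i \sum_j `|A i j|).
  by rewrite ltr_pwDl// sumr_ge0// => i _; rewrite sumr_ge0.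
move=> x; have sq i : x 0 i ^+ 2 <= qf 1%:M x.
  by rewrite qf1E (bigD1 i)//= lerDl sumr_ge0// => k _; exact: sqr_ge0.
rewrite mulrDl mul1r {1}/qf bfE.
apply: (@le_trans _ _ ((\sum_i \sum_j `|A i j|) * qf 1%:M x)); last first.
  by rewrite lerDr qf1_ge0.
rewrite mulr_suml; apply: le_trans (ler_norm_sum _ _ _) _.
apply: ler_sum => i _; rewrite mulr_suml; apply: le_trans (ler_norm_sum _ _ _) _.
apply: ler_sum => j _; rewrite mulrAC normrM mulrC ler_wpM2l//.
have := sq i; have := sq j; have := sqr_ge0 (x 0 i - x 0 j); have := sqr_ge0 (x 0 i + x 0 j).
rewrite ler_norml; move: (x 0 i) (x 0 j) (qf _ _) => a b c.
by move=> ? ? ? ?; apply/andP; split; nra.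
Qed.

Lemma psd_cauchy_schwarz n (H : 'M[R]_n) x y : H^T = H ->
  (forall z, 0 <= qf H z) -> bf H x y ^+ 2 <= qf H x * qf H y.
Proof.
move=> Hs pos.
have p s t : 0 <= s ^+ 2 * qf H x + 2 * s * t * bf H x y + t ^+ 2 * qf H y.
  have := pos (s *: x + t *: y); rewrite {1}/qf !bflin (bfC y x)// -!/(qf _ _).
  by set a := qf H x; set b := qf H y; set c := bf _ _ _ => h; nra.
have := pos x; have := pos y; have := p (qf H y) (- bf H x y); have := p 1 (- bf H x y).
have := p (- bf H x y) (qf H x); have := p (- bf H x y) 1.
set a := qf H x; set b := qf H y; set c := bf _ _ _ => h1 h2 h3 h4 b0 a0.
have [a1|a1] := ltP 0 a.
  have : 0 <= a * (a * b - c ^+ 2) by nra.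
  by rewrite pmulr_rge0// subr_ge0.
have a00 : a = 0 by apply/le_anti; rewrite a0 a1.
have [b1|b1] := ltP 0 b.
  have : 0 <= b * (a * b - c ^+ 2) by nra.
  by rewrite pmulr_rge0// subr_ge0.
have b00 : b = 0 by apply/le_anti; rewrite b0 b1.
by move: h1; rewrite a00 b00; nra.
Qed.

(** Cauchy-Schwarz for the form H, applied to x H^-1 and x, bounds |x|^4 by
    qf H x times the value at x of the bounded form H^-1. *)
Lemma posdef_coercive n (H : 'M[R]_n) : H^T = H ->
  (forall x, x != 0 -> 0 < qf H x) -> exists2 c : R, 0 < c & forall x, c * qf 1%:M x <= qf H x.
Proof.
move=> Hs pos.
have pos0 x : 0 <= qf H x.
  by have [->|/pos/ltW//] := eqVneq x 0; rewrite qf0.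
have uH : H \in unitmx.
  rewrite -row_free_unit -kermx_eq0; apply/rowV0P => x /sub_kermxP xH.
  apply/eqP; apply: contraT => /pos; rewrite /qf /bf xH mul0mx mxE ltxx//.
have [C C0 HC] := bf_le_qf1 (invmx H).
have iHs : (invmx H)^T = invmx H by rewrite trmx_inv Hs.
exists C^-1; first by rewrite invr_gt0.
move=> x; rewrite mulrC ler_pdivrMr//.
have := psd_cauchy_schwarz (x *m invmx H) x Hs pos0.
have -> : bf H (x *m invmx H) x = qf 1%:M x by rewrite /qf bf_mull mulVmx.
have -> : qf H (x *m invmx H) = qf (invmx H) x.
  by rewrite -qf_pull mulVmx// mul1mx iHs.
have := HC x; have := qf1_ge0 x; have := pos0 x.
have [->|/qf1_gt0] := eqVneq x 0; first by move=> *; rewrite !qf0 mul0r.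
rewrite ler_norml => a0 c0 _ /andP[_ bC] ab.
have {}bC := ler_wpM2r c0 bC; rewrite -(ler_pM2l a0) -expr2.
apply: (le_trans ab); apply: (le_trans bC); rewrite le_eqVlt; apply/orP; left.
by apply/eqP; ring.
Qed.

(** On a maximal negative subspace the form stays below a negative multiple of
    the square norm, which leaves room for a perturbation. *)
Lemma negi_stable n (H : 'M[R]_n) : H^T = H ->
  exists2 c : R, 0 < c & forall K : 'M[R]_n,
    (forall x, qf K x <= qf H x + c * qf 1%:M x) -> (negi H <= negi K)%N.
Proof.
move=> Hs; have [L HL] := negi_ex H.
have [c c0 Hc] : exists2 c : R, 0 < c & forall x, c * qf 1%:M x <= qf (- (L *m H *m L^T)) x.
  apply: posdef_coercive => [|x x0]; first by rewrite linearN/= !trmx_mul trmxK Hs mulmxA.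
  by rewrite /qf bfNm oppr_gt0 -/(qf _ _) qf_pull; exact: HL.
have [C C0 HC] := bf_le_qf1 (L *m L^T).
exists (c / C / 2); first by rewrite !divr_gt0.
move=> K HK; apply: (negi_ge (L := L)) => x x0; apply: le_lt_trans (HK _) _.
have := Hc x; rewrite {2}/qf bfNm -/(qf _ _) qf_pull lerNr => qx.
have := HC x; rewrite -{1}[L in L *m _]mulmx1 qf_pull => /ler_normlW Cx.
have x1 := qf1_gt0 x0.
apply: (@le_lt_trans _ _ (- (c * qf 1%:M x) + c / C / 2 * (C * qf 1%:M x))).
  by rewrite lerD// ler_wpM2l// !divr_ge0// ltW.
have -> : c / C / 2 * (C * qf 1%:M x) = c * qf 1%:M x / 2 by field; rewrite gt_eqF.
have : 0 < c * qf 1%:M x by rewrite mulr_gt0.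
lra.
Qed.

End stability.

Section jump_sums.
Context {R : realType}.
Variables (a0 b : R) (nu k : R -> nat).
Hypothesis jump_le : forall s t, a0 < s -> s < t -> t <= b -> (nu s + k s <= nu t)%N.
Hypothesis left_stable : forall t, a0 < t -> t <= b ->
  exists2 e, 0 < e & forall s, a0 < s -> t - e < s -> s <= t -> (nu t <= nu s)%N.
Hypothesis right_stable : forall t, a0 < t -> t < b ->
  exists2 e, 0 < e & forall s, t < s -> s < t + e -> s <= b -> (nu s <= nu t + k t)%N.
Hypothesis start : exists2 a1, a0 < a1 & forall s, a0 < s -> s < a1 -> s <= b -> nu s = 0%N.

Lemma sum_jumps_le (s : seq R) c : uniq s -> a0 < c -> c <= b ->
  {in s, forall t, a0 < t < c} -> (\sum_(t <- s) k t <= nu c)%N.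
Proof.
elim: {s}(size s) {-2}s (leqnn (size s)) c => [|n IH] s.
  by case: s => // _ c *; rewrite big_nil.
move=> sn c us a0c cb sc; case: s => [|x0 s0] in sn us sc *; first by rewrite big_nil.
pose m := \big[Order.max/x0]_(t <- s0) t.
have ms : m \in x0 :: s0.
  by rewrite /m big_seq; elim/big_ind : _ => [|x y xs ys|t ts];
    rewrite ?mem_head ?in_cons ?ts ?orbT//; case: (leP x y).
have mm t : t \in x0 :: s0 -> t <= m.
  rewrite in_cons => /predU1P[->|ts]; first exact: bigmax_ge_id.
  exact: le_bigmax_seq.
rewrite [leqLHS](_ : _ = \sum_(t <- rem m (x0 :: s0)) k t + k m)%N; last first.
  by rewrite (perm_big _ (perm_to_rem ms)) big_cons; exact: addnC.
have /andP[am mc] := sc _ ms.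
apply: leq_trans (jump_le am mc cb); rewrite leq_add2r; apply: IH => //.
- by rewrite size_rem.
- exact: rem_uniq.
- exact: ltW (lt_le_trans mc cb).
move=> t; rewrite mem_rem_uniq// !inE => /andP[tm ts].
have /andP[-> _] := sc t ts; rewrite /= lt_neqAle tm/=; exact: mm.
Qed.

(** Induction on the value nu c. The infimum m of the points where nu has reached
    this value is not such a point, by left stability, so that nu m is smaller and
    the missing amount is at most the jump k m. *)
Lemma sum_jumps_ge c : a0 < c -> c <= b ->
  exists2 s : seq R, uniq s /\ {in s, forall t, a0 < t < c} &
    (nu c <= \sum_(t <- s) k t)%N.
Proof.
elim: {c}(nu c) {-2}c (leqnn (nu c)) => [|n IH] c nc a0c cb.
  by exists [::]; rewrite // big_nil.
have [c0|c0] := posnP (nu c); first by exists [::]; rewrite ?c0.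
pose E := [set t | a0 < t /\ t <= c /\ (nu c <= nu t)%N].
have Ec : E c by [].
have [a1 a01 start1] := start.
have lbE : lbound E a1.
  move=> t [at0 [tc nt]]; rewrite leNgt; apply/negP => ta1.
  by move: nt; rewrite (start1 t)// ?(le_trans tc)// leqNgt c0.
have hE : has_inf E by split; [exists c|exists a1].
pose m := inf E.
have am : a0 < m by apply: lt_le_trans a01 _; apply: lb_le_inf => //; exists c.
have mc : m <= c by apply: ge_inf => //; exists a1.
have mE : ~ E m.
  move=> [_ [_ ncm]]; have [e e0 he] := left_stable am (le_trans mc cb).
  pose s := Order.max (m - e / 2) ((a0 + m) / 2).
  have sm : s < m by rewrite /s gt_max; apply/andP; split; lra.
  have as_ : a0 < s by rewrite /s lt_max; apply/orP; right; lra.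
  have : m <= s.
    apply: ge_inf; [by exists a1|split=> //; split; first by rewrite (le_trans (ltW sm))].
    apply: leq_trans ncm _; apply: he => //; last exact: ltW.
    by rewrite /s lt_max; apply/orP; left; lra.
  by rewrite leNgt sm.
have mc' : m < c.
  by rewrite lt_neqAle mc andbT; apply/eqP => mE'; apply: mE; rewrite mE'.
have numc : (nu m < nu c)%N.
  by rewrite ltnNge; apply/negP => ncm; apply: mE.
have [e e0 he] := right_stable am (lt_le_trans mc' cb).
have [t Et tm] := inf_adherent e0 hE.
have mt : m <= t by apply: ge_inf => //; exists a1.
have mt' : m < t by rewrite lt_neqAle mt andbT; apply/eqP => mt'; apply: mE; rewrite mt'.
case: Et => [a0t [tc nct]].
have ntk := he t mt' tm (le_trans tc cb).
have [|s [us sm] nus] := IH m _ am (le_trans mc cb); first by rewrite -ltnS (leq_trans numc).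
exists (m :: s).
  split; first by rewrite /= us andbT; apply/negP => /sm; rewrite ltxx andbF.
  move=> x; rewrite in_cons => /predU1P[->|/sm /andP[-> xm]]; first by rewrite am.
  exact: lt_trans xm mc'.
by rewrite big_cons; lia.
Qed.

(** A left-continuous integer function starting at 0 is the sum of its jumps. *)
Lemma esum_jumps : a0 < b ->
  (\esum_(t in [set t | (a0 < t < b)%R]) ((k t)%:R)%:E = ((nu b)%:R)%:E :> \bar R)%E.
Proof.
move=> ab; apply/eqP; rewrite eq_le; apply/andP; split.
  apply: ge_ereal_sup => _ [X [finX XI]] <-.
  rewrite fsbig_finite//= sumEFin lee_fin -natr_sum ler_nat.
  apply: sum_jumps_le => //; first exact: finmap.fset_uniq.
  by move=> t; rewrite in_fset_set// inE => /XI.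
have [s [us sI] nus] := sum_jumps_ge ab (lexx b).
apply: esum_ge; exists [set` s]; first by split => //; exact: finite_seq.
by rewrite -fsbig_seq//= sumEFin lee_fin -natr_sum ler_nat.
Qed.

End jump_sums.

Section crossing.
Context {R : realType}.

(** The kernel of H and a negative subspace of H together become negative for K. *)
Lemma negi_strict n (H K : 'M[R]_n) : H^T = H ->
  (forall x, x != 0 -> qf K x < qf H x) ->
  (negi H + (n - \rank H) <= negi K)%N.
Proof.
move=> Hs KH; have [U rU HU] := negi_space H.
rewrite -rU -mxrank_ker.
have UK0 : (U :&: kermx H)%MS = 0.
  apply/eqP/rowV0P => x; rewrite sub_capmx => /andP[xU /sub_kermxP xK]; apply/eqP.
  by apply: contraT => /(HU _ xU); rewrite /qf /bf xK mul0mx mxE ltxx.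
rewrite -(mxrank_disjoint_sum UK0); apply: (negi_subspace (T := 1%:M)) => x xUK x0.
rewrite mulmx1; apply: lt_le_trans (KH _ x0) _.
move: xUK => /sub_addsmxP[[/= u v] ->].
set y := u *m U; set z := v *m kermx H.
have zH : z *m H = 0 by rewrite /z -mulmxA mulmx_ker mulmx0.
have z0 w : bf H z w = 0 by rewrite /bf zH mul0mx mxE.
rewrite /qf !bflin (bfC y z Hs) !z0 !addr0 -/(qf _ _).
have [->|y0] := eqVneq y 0; first by rewrite qf0.
by apply/ltW/HU => //; exact: submxMl.
Qed.

(** An eigenvalue that vanishes at t is negative just after t and remains so: the
    index jumps at t by the dimension of the kernel, and does not jump elsewhere. *)
Theorem crossing_number n (D : R -> 'M[R]_n) (a0 b : R) : a0 < b ->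
  (forall t, a0 < t -> t <= b -> (D t)^T = D t) ->
  (forall s t x, a0 < s -> s < t -> t <= b -> x != 0 -> qf (D t) x < qf (D s) x) ->
  (forall t e, a0 < t -> t <= b -> 0 < e -> exists2 d, 0 < d &
     forall s x, a0 < s -> s <= b -> `|s - t| < d ->
       `|qf (D s) x - qf (D t) x| <= e * qf 1%:M x) ->
  (exists2 a1, a0 < a1 & forall s x, a0 < s -> s < a1 -> s <= b -> 0 <= qf (D s) x) ->
  (\esum_(t in [set t | (a0 < t < b)%R]) ((n - \rank (D t))%:R)%:E
    = ((negi (D b))%:R)%:E :> \bar R)%E.
Proof.
move=> ab Dsym Dmono Dcont [a1 a01 Dpos].
apply: (@esum_jumps _ a0 b (fun t => negi (D t)) (fun t => n - \rank (D t))%N) => //.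
- move=> s t a0s st tb; apply: negi_strict => [|x x0]; last exact: Dmono.
  by apply: Dsym => //; exact: ltW (lt_le_trans st tb).
- move=> t a0t tb; have [c c0 Hc] := negi_stable (Dsym _ a0t tb).
  have [e e0 he] := Dcont _ _ a0t tb c0; exists e => // s a0s ts st.
  apply: Hc => x; have : `|s - t| < e by rewrite ltr_norml; apply/andP; split; lra.
  move=> /(he s x a0s (le_trans st tb)); rewrite ler_norml => /andP[_].
  by rewrite lerBlDl.
- move=> t a0t tb; have Dts := Dsym _ a0t (ltW tb).
  have Nts : (- D t)^T = - D t by rewrite linearN/= Dts.
  have [c c0 Hc] := negi_stable Nts.
  have [e e0 he] := Dcont _ _ a0t (ltW tb) c0; exists e => // s ts se sb.
  have : (negi (- D t) <= negi (- D s))%N.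
    apply: Hc => x; have : `|s - t| < e by rewrite ltr_norml; apply/andP; split; lra.
    have a0s := lt_trans a0t ts.
    move=> /(he s x a0s sb); rewrite ler_norml /qf !bfNm => /andP[+ _]; lra.
  have := sylvester Dts; have Dss := Dsym _ (lt_trans a0t ts) sb.
  have [W rW HW] := psd_space (H := - D s) ltac:(by rewrite linearN/= Dss).
  have [U rU HU] := negi_space (D s).
  have : (negi (- D s) + \rank U <= n)%N.
    apply: negi_le_psd => x xU; rewrite /qf bfNm oppr_ge0.
    have [->|x0] := eqVneq x 0; first by rewrite bf0l.
    exact/ltW/HU.
  rewrite rU; have := rank_leq_row (D t); clear; set r := \rank _; clearbody r; lia.
- exists a1 => // s a0s sa1 sb; apply/eqP; rewrite -leqn0.
  have : (negi (D s) + \rank (1%:M : 'M[R]_n) <= n)%N.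
    by apply: negi_le_psd => x _; exact: Dpos.
  by rewrite mxrank1; lia.
Qed.

End crossing.

(** * Dimensions over the complex numbers *)

Section dimension.
Context {R : realType} {d : nat}.
Local Notation C := R[i].
Local Notation Zd := 'rV[int]_d.

Definition toC n m (K : 'M[R]_(n, m)) : 'M[C]_(n, m) := map_mx (real_complex R) K.

Definition comb n (phi : 'I_n -> Zd -> C) (x : 'rV[C]_n) : Zd -> C :=
  fun z => \sum_i x 0 i * phi i z.

(** The eigenspaces are complex while the matrices are real; the rank of a real
    matrix is the same over the complex numbers. *)
Lemma dim_kernel n (K : 'M[R]_n) (E : set (Zd -> C)) (phi : 'I_n -> Zd -> C) :
  (forall x, x *m toC K = 0 -> (forall z, comb phi x z = 0) -> x = 0) ->
  (forall x, x *m toC K = 0 -> E (comb phi x)) ->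
  (forall u, E u -> exists2 x, x *m toC K = 0 & u = comb phi x) ->
  Defs.dim E = ((n - \rank K)%:R)%:E.
Proof.
move=> inj into onto.
have rk : (n - \rank K)%N = \rank (kermx (toC K)) by rewrite mxrank_ker mxrank_map.
have combM k (c : 'rV[C]_k) (X : 'M[C]_(k, n)) z :
    comb phi (c *m X) z = \sum_i c 0 i * comb phi (row i X) z.
  rewrite /comb; under eq_bigr do rewrite mxE mulr_suml.
  rewrite exchange_big/=; apply: eq_bigr => i _; rewrite mulr_sumr.
  by apply: eq_bigr => j _; rewrite mxE mulrA.
apply/eqP; rewrite eq_le; apply/andP; split.
  apply: ge_ereal_sup => _ [k [v [Ev iv]] <-].
  rewrite lee_fin ler_nat rk.
  have /boolp.choice[X HX] (i : 'I_k) :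
      exists x : 'rV[C]_n, x *m toC K = 0 /\ v i = comb phi x.
    by have [x ? ?] := onto _ (Ev i); exists x.
  pose M := \matrix_i X i.
  have MK : (M <= kermx (toC K))%MS.
    by apply/row_subP => i; rewrite rowK; apply/sub_kermxP; case: (HX i).
  suff /eqP <- : row_free M by exact: mxrankS.
  rewrite -kermx_eq0; apply/rowV0P => c /sub_kermxP cM; apply/rowP => i; rewrite mxE.
  apply: (iv (fun i => c 0 i)) => z.
  have := combM _ c M z; rewrite cM => E0; rewrite -[RHS](_ : comb phi 0 z = 0); last first.
    by rewrite /comb big1// => j _; rewrite mxE mul0r.
  by rewrite E0; apply: eq_bigr => j _; rewrite rowK; case: (HX j) => _ ->.
rewrite rk; apply: ereal_sup_ubound.
exists (\rank (kermx (toC K))) => //.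
pose N := row_base (kermx (toC K)).
have NK : N *m toC K = 0 by apply/sub_kermxP; rewrite eq_row_base.
exists (fun i => comb phi (row i N)); split.
  by move=> i; apply: into; rewrite -row_mul NK row0.
move=> c c0 i.
have : (\row_i c i) *m N = 0.
  apply: inj; first by rewrite -mulmxA NK mulmx0.
  by move=> z; rewrite combM -[RHS](c0 z); apply: eq_bigr => j _; rewrite mxE.
move=> cN; have : (\row_i c i) = 0 by apply: (row_free_inj (row_base_free _)); rewrite cN mul0mx.
by move=> /rowP /(_ i); rewrite !mxE.
Qed.

End dimension.

(** * Restrictions of the operator to finite sets of sites *)

Section lattice_operator.
Context {R : realType} {d : nat}.
Local Notation C := R[i].
Local Notation Zd := 'rV[int]_d.

Definition adj (m n : Zd) : bool := enorm (embed (m - n) : 'rV[R]_d) == 1.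

Lemma embedN (n : Zd) : embed (- n) = - embed n :> 'rV[R]_d.
Proof. by apply/rowP => i; rewrite !mxE rmorphN. Qed.

Lemma enormN (x : 'rV[R]_d) : enorm (- x) = enorm x.
Proof. by rewrite /enorm; congr Num.sqrt; apply: eq_bigr => i _; rewrite mxE sqrrN. Qed.

Lemma enorm0 : enorm (0 : 'rV[R]_d) = 0.
Proof. by rewrite /enorm big1 ?sqrtr0// => i _; rewrite mxE expr0n. Qed.

Lemma adj_sym m n : adj m n = adj n m.
Proof. by rewrite /adj -(opprB n m) embedN enormN. Qed.

(** The matrix entries of -Delta + W. *)
Definition kern (W : Zd -> R) (x y : Zd) : R :=
  (x == y)%:R * ((2 * d)%:R + W x) - (adj x y)%:R.

Lemma kern_sym W x y : kern W x y = kern W y x.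
Proof.
rewrite /kern adj_sym [y == x]eq_sym.
by case: eqVneq => [->//|_]; rewrite !mul0r.
Qed.

Definition pt (s : seq Zd) (i : 'I_(size s)) : Zd := tnth (in_tuple s) i.
Arguments pt : clear implicits.

Lemma pt_inj s : uniq s -> injective (pt s).
Proof. by move=> us; apply/tuple_uniqP. Qed.

Lemma mem_pt s i : pt s i \in s.
Proof. exact: (mem_tnth i (in_tuple s)). Qed.

Lemma ptP s z : z \in s -> exists i, z = pt s i.
Proof. by move=> /seq_tnthP[i ->]; exists i. Qed.

Definition opmx (s : seq Zd) (W : Zd -> R) : 'M[R]_(size s) :=
  \matrix_(i, j) kern W (pt s i) (pt s j).

Lemma opmx_tr s W : (opmx s W)^T = opmx s W.
Proof. by apply/matrixP => i j; rewrite !mxE kern_sym. Qed.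

(** A head constant for the embedding, on which rewriting can act. *)
Definition rc (x : R) : C := real_complex R x.

Lemma rcE x : x%:C%C = rc x. Proof. by []. Qed.

Lemma rcM x y : rc (x * y) = rc x * rc y.
Proof. exact: rmorphM. Qed.
Lemma rcD x y : rc (x + y) = rc x + rc y.
Proof. exact: rmorphD. Qed.
Lemma rcB x y : rc (x - y) = rc x - rc y.
Proof. exact: rmorphB. Qed.
Lemma rc_nat n : rc n%:R = n%:R.
Proof. exact: rmorph_nat. Qed.

Lemma schrodinger_seqE (s : seq Zd) (f : Zd -> R) (u : Zd -> C) n : uniq s -> n \in s ->
  schrodinger [set` s] f u n =
  - (\sum_(m <- s) (adj m n)%:R * u m) + (2 * d)%:R * u n + (f n)%:C%C * u n.
Proof.
move=> us ns; rewrite /schrodinger mem_set//; congr (- _ + _ + _).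
transitivity (\sum_(m <- [seq m <- s | adj m n]) u m).
  rewrite [RHS]fsbig_seq ?filter_uniq//; apply: eq_fsbigl.
  apply/seteqP; split=> m /=; rewrite mem_filter; first by move=> [-> /eqP e]; rewrite /adj e.
  by move=> /andP[/eqP].
by rewrite big_filter big_mkcond/=; apply: eq_bigr => m _; case: ifP; rewrite ?mul1r ?mul0r.
Qed.

Lemma kern_sum s (W : Zd -> R) (u : Zd -> C) n : uniq s -> n \in s ->
  \sum_(m <- s) rc (kern W m n) * u m =
  - (\sum_(m <- s) (adj m n)%:R * u m) + (2 * d)%:R * u n + (W n)%:C%C * u n.
Proof.
move=> us ns; rewrite /kern.
under eq_bigr do rewrite rcB rcM !rc_nat mulrBl.
rewrite sumrB addrC -addrA; congr (_ + _); rewrite (bigD1_seq n)//= eqxx mul1r.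
rewrite big1 ?addr0 ?rcE ?rcD ?rc_nat ?mulrDl// => m /negbTE ->.
by rewrite !mul0r.
Qed.

Lemma schrodinger_pt s f u j : uniq s ->
  schrodinger [set` s] f u (pt s j) = \sum_i rc (opmx s f i j) * u (pt s i).
Proof.
move=> us; rewrite schrodinger_seqE ?mem_pt// -kern_sum ?mem_pt// big_tnth.
by apply: eq_bigr => i _; rewrite mxE.
Qed.

Lemma finite_l2 s (S : set Zd) (u : Zd -> C) : uniq s ->
  (forall z, z \notin s -> u z = 0) -> (forall z, z \in s -> S z) -> l2 S u.
Proof.
move=> us u0 sS; split; first by move=> n nS; apply: u0; apply/negP => /sS.
rewrite /summable; rewrite (_ : \esum_(_ in _) _ =
    \esum_(n in [set` s]) (`|(ComplexField.Normc.normc (u n) ^+ 2)%:E|)%E); last first.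
  rewrite [RHS]esum_mkcond; apply: eq_esum => z _; case: ifPn => //.
  rewrite notin_setE/= => /negP /u0 ->.
  by rewrite ComplexField.Normc.normc0 expr0n/= normr0.
rewrite esum_fset//; last exact: finite_seq.
by rewrite fsbig_finite ?finite_seq//= sumEFin ltry.
Qed.

Definition delta (z : Zd) : Zd -> C := fun x => (x == z)%:R.

Lemma comb_delta s (x : 'rV[C]_(size s)) : uniq s ->
  (forall i, comb (fun i => delta (pt s i)) x (pt s i) = x 0 i) /\
  (forall z, z \notin s -> comb (fun i => delta (pt s i)) x z = 0).
Proof.
move=> us; rewrite /comb /delta; split.
  move=> i; rewrite (bigD1 i)//= eqxx mulr1 big1 ?addr0// => j ji.
  by rewrite (inj_eq (pt_inj us)) eq_sym (negbTE ji) mulr0.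
move=> z zs; rewrite big1// => i _; case: eqVneq => [zi|_]; last by rewrite mulr0.
by move: zs; rewrite zi mem_pt.
Qed.

Lemma toC_mulE n (A : 'M[R]_n) a (x : 'rV[C]_n) j :
  (x *m toC (A - a%:M)) 0 j = \sum_i rc (A i j) * x 0 i - rc a * x 0 j.
Proof.
rewrite mxE; transitivity (\sum_i (rc (A i j) * x 0 i - rc (a *+ (i == j)) * x 0 i)).
  by apply: eq_bigr => i _; rewrite !mxE -/(rc _) rcB mulrC mulrBl.
rewrite sumrB; congr (_ - _).
rewrite (bigD1 j)//= eqxx mulr1n big1 ?addr0// => i /negbTE ->.
by rewrite mulr0n (rc_nat 0) mul0r.
Qed.

Lemma dim_eigenfunctions s (f : Zd -> R) a : uniq s ->
  Defs.dim (eigenfunctions [set` s] (schrodinger [set` s] f) a%:C%C) =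
  ((size s - \rank (opmx s f - a%:M)%R)%:R)%:E.
Proof.
move=> us; apply: (dim_kernel (phi := fun i => delta (pt s i))) => [x _ x0|x xK|u [lu Tu]].
- by apply/rowP => i; rewrite -(comb_delta x us).1 x0 mxE.
- have [c1 c2] := comb_delta x us; split; first exact: (finite_l2 us).
  move=> n; have [ns|ns] := boolP (n \in s); last first.
    by rewrite c2// mulr0 /schrodinger memNset//=; apply/negP.
  have [j ->] := ptP ns; rewrite schrodinger_pt// c1.
  apply/eqP; rewrite -subr_eq0; apply/eqP.
  move: xK => /rowP /(_ j); rewrite toC_mulE mxE => E0; rewrite -[RHS]E0; congr (_ - _).
  by apply: eq_bigr => i _; rewrite c1.
have us0 z : z \notin s -> u z = 0 by move=> zs; apply: lu.1; apply/negP.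
exists (\row_i u (pt s i)).
  apply/rowP => j; have := Tu (pt s j); rewrite schrodinger_pt// toC_mulE !mxE => /eqP.
  rewrite -subr_eq0 => /eqP E0; rewrite -[RHS]E0; congr (_ - _).
  by apply: eq_bigr => i _; rewrite [in LHS]mxE.
apply/funext => z; have [c1 c2] := comb_delta (\row_i u (pt s i)) us.
have [/ptP[i ->]|zs] := boolP (z \in s); first by rewrite c1 mxE.
by rewrite c2// us0.
Qed.

(** The eigenvalues below mu are the crossings of the decreasing family
    opmx s f - a, a < mu; below some a0 the family is positive definite. *)
Lemma eig_countE s (Omega : set 'rV[R]_d) f mu : uniq s ->
  embed @^-1` Omega = [set` s] ->
  eig_count Omega f mu = ((negi (opmx s f - mu%:M))%:R)%:E.
Proof.
move=> us sO; rewrite /eig_count sO.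
have [T T0 HT] := bf_le_qf1 (opmx s f).
have qfa a (x : 'rV_(size s)) : qf (opmx s f - a%:M) x = qf (opmx s f) x - a * qf 1%:M x.
  by rewrite -(scalemx1 _ a) /qf !bflin.
pose a0 := Order.min mu (- T) - 1.
have a0mu : a0 < mu by rewrite /a0; case: (leP mu (- T)); lra.
have a0T : a0 < - T by rewrite /a0; case: (leP mu (- T)); lra.
rewrite -(@crossing_number _ _ (fun a => opmx s f - a%:M) a0 mu)//.
- rewrite esum_mkcond [RHS]esum_mkcond; apply: eq_esum => a _.
  rewrite dim_eigenfunctions//.
  have [amu|amu] := boolP (a < mu); last first.
    by rewrite !memNset//= ?(negbTE amu) ?andbF.
  rewrite mem_set//; case: ifPn => //; rewrite notin_setE/= amu andbT => /negP.
  rewrite -leNgt => aa0; rewrite (_ : (_ - _)%N = 0%N)//.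
  apply/eqP; rewrite subn_eq0; suff /eqP -> : row_free (opmx s f - a%:M) by [].
  rewrite -kermx_eq0; apply/rowV0P => x /sub_kermxP xK; apply/eqP.
  apply: contraT => /qf1_gt0 x1.
  have : qf (opmx s f - a%:M) x = 0 by rewrite /qf /bf xK mul0mx mxE.
  by rewrite qfa; have := HT x; rewrite ler_norml => /andP[h _]; nra.
- by move=> t _ _; rewrite linearB/= tr_scalar_mx opmx_tr.
- by move=> t t' x _ tt' _ /qf1_gt0 x0; rewrite !qfa; nra.
- move=> t e _ _ e0; exists e => // t' x _ _ tt'.
  rewrite !qfa (_ : _ - _ - _ = (t - t') * qf 1%:M x); last by ring.
  rewrite normrM.
  by rewrite (ger0_norm (qf1_ge0 _)) ler_wpM2r ?qf1_ge0// distrC ltW.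
exists (- T) => // t x _ tT _; rewrite qfa; have := HT x; have := qf1_ge0 x.
by rewrite ler_norml => ? /andP[? _]; nra.
Qed.

End lattice_operator.
Arguments pt {d} s i.

(** * Signed sums *)
Section signed_sums.
Context {R : realType} {T : choiceType}.
Implicit Types (F G H : T -> R).

Definition sumable F : Prop := summable [set: T] (EFin \o F).

Definition pos_sum F : R := fine (\esum_(n in [set: T]) (F n)%:E).

(** The sum of a real summable family of any sign. *)
Definition sumZ F : R :=
  pos_sum (fun n => Num.max (F n) 0) - pos_sum (fun n => Num.max (- F n) 0).

Lemma sumable_le F G : sumable G -> (forall n, `|F n| <= `|G n|) -> sumable F.
Proof.
move=> sG FG; rewrite /sumable /summable; apply: le_lt_trans sG.
by apply: le_esum => n _; rewrite /= lee_fin.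
Qed.

Lemma sumable_nneg F : (forall n, 0 <= F n) ->
  sumable F <-> (\esum_(n in [set: T]) (F n)%:E < +oo)%E.
Proof.
move=> F0; rewrite /sumable /summable.
by under eq_esum do rewrite /= ger0_norm//.
Qed.

Lemma sumableD F G : sumable F -> sumable G -> sumable (fun n => F n + G n).
Proof. exact: summableD. Qed.

Lemma sumableN F : sumable F -> sumable (fun n => - F n).
Proof. by move=> sF; apply: sumable_le sF _ => n; rewrite normrN. Qed.

Lemma sumableZ c F : sumable F -> sumable (fun n => c * F n).
Proof.
have pos k : sumable F -> sumable (fun n => k%:R * F n).
  elim: k => [|k IH] sF.
    by apply: sumable_le sF _ => n; rewrite mul0r normr0.
  apply: sumable_le (sumableD sF (IH sF)) _ => n.
  by rewrite -[k.+1]add1n natrD mulrDl mul1r.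
move=> sF; apply: sumable_le (pos (Num.truncn `|c|).+1 sF) _ => n.
rewrite !normrM ler_wpM2r// (ger0_norm (ler0n _ _)) ltW//.
exact: truncnS_gt.
Qed.

Lemma sumable_pos F : sumable F -> sumable (fun n => Num.max (F n) 0).
Proof.
move=> sF; apply: sumable_le sF _ => n.
by case: (leP (F n) 0) => [_|/ltW/ger0_norm->]; rewrite ?normr0.
Qed.

Lemma pos_sum_fin F : sumable F -> (forall n, 0 <= F n) ->
  \esum_(n in [set: T]) (F n)%:E = (pos_sum F)%:E.
Proof.
move=> sF F0; rewrite fineK// ge0_fin_numE; first exact/sumable_nneg.
by apply: esum_ge0 => n _; rewrite lee_fin.
Qed.

Lemma pos_sumD F G : sumable F -> sumable G -> (forall n, 0 <= F n) ->
  (forall n, 0 <= G n) -> pos_sum (fun n => F n + G n) = pos_sum F + pos_sum G.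
Proof.
move=> sF sG F0 G0; apply: EFin_inj; have sFG := sumableD sF sG.
have FG0 n : 0 <= F n + G n by rewrite addr_ge0.
rewrite EFinD -!pos_sum_fin//.
by rewrite -esumD// => n _; rewrite lee_fin.
Qed.

(** The sum may be computed from any splitting into nonnegative summable families;
    linearity follows. *)
Lemma sumZ_decomp F G H : sumable G -> sumable H ->
  (forall n, 0 <= G n) -> (forall n, 0 <= H n) -> (forall n, F n = G n - H n) ->
  sumZ F = pos_sum G - pos_sum H.
Proof.
move=> sG sH G0 H0 FE.
have sF : sumable F.
  by apply: sumable_le (sumableD sG (sumableN sH)) _ => n; rewrite FE.
have sp := sumable_pos sF; have sn := sumable_pos (sumableN sF).
have p0 x : 0 <= Num.max x (0 : R) by rewrite le_max lexx orbT.
rewrite /sumZ; suff : pos_sum (fun n => Num.max (F n) 0) + pos_sum H =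
    pos_sum G + pos_sum (fun n => Num.max (- F n) 0) by lra.
rewrite -!pos_sumD//; congr pos_sum; apply/funext => n; rewrite FE.
by case: (leP (G n - H n) 0); case: (leP (- (G n - H n)) 0); lra.
Qed.

Lemma sumZ_nneg F : sumable F -> (forall n, 0 <= F n) -> sumZ F = pos_sum F.
Proof.
move=> sF F0; rewrite (@sumZ_decomp F F (fun=> 0))//.
- by rewrite [X in _ - X](_ : _ = 0) ?subr0// /pos_sum esum1.
- by apply: sumable_le sF _ => n; rewrite normr0.
by move=> n; rewrite subr0.
Qed.

Lemma sumZD F G : sumable F -> sumable G -> sumZ (fun n => F n + G n) = sumZ F + sumZ G.
Proof.
move=> sF sG.
have sp := sumable_pos sF; have sn := sumable_pos (sumableN sF).
have tp := sumable_pos sG; have tn := sumable_pos (sumableN sG).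
have p0 x : 0 <= Num.max x (0 : R) by rewrite le_max lexx orbT.
rewrite (sumZ_decomp (sumableD sp tp) (sumableD sn tn)).
- by rewrite !pos_sumD// /sumZ; ring.
- by move=> n; rewrite addr_ge0.
- by move=> n; rewrite addr_ge0.
move=> n; case: (leP (F n) 0); case: (leP (- F n) 0); case: (leP (G n) 0);
  case: (leP (- G n) 0); lra.
Qed.

Lemma sumZN F : sumZ (fun n => - F n) = - sumZ F.
Proof.
by rewrite /sumZ opprB; congr (_ - pos_sum _); apply/funext => n; rewrite opprK.
Qed.

Lemma pos_sumZ c F : 0 <= c -> sumable F -> (forall n, 0 <= F n) ->
  pos_sum (fun n => c * F n) = c * pos_sum F.
Proof.
move=> c0 sF F0; have scF := sumableZ c sF.
have cF0 n : 0 <= c * F n by exact: mulr_ge0.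
apply/le_anti/andP; split.
  rewrite -lee_fin -pos_sum_fin//.
  apply: ge_ereal_sup => _ [X [finX _]] <-.
  rewrite fsbig_finite//= sumEFin lee_fin -mulr_sumr ler_wpM2l//.
  rewrite -lee_fin -pos_sum_fin//; apply: esum_ge; exists X => //.
  by rewrite fsbig_finite//= sumEFin.
have [->|c1] := eqVneq c 0.
  by rewrite mul0r; apply: fine_ge0; apply: esum_ge0 => n _; rewrite mul0r.
have cp : 0 < c by rewrite lt_neqAle eq_sym c1.
rewrite -ler_pdivlMl// -lee_fin -pos_sum_fin//.
apply: ge_ereal_sup => _ [X [finX _]] <-.
rewrite fsbig_finite//= sumEFin lee_fin ler_pdivlMl// mulr_sumr.
rewrite -lee_fin -pos_sum_fin//.
apply: esum_ge; exists X => //.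
by rewrite fsbig_finite//= sumEFin.
Qed.

Lemma sumZZ c F : sumable F -> sumZ (fun n => c * F n) = c * sumZ F.
Proof.
have pos e G : 0 <= e -> sumable G -> sumZ (fun n => e * G n) = e * sumZ G.
  move=> e0 sG; have sp := sumable_pos sG; have sn := sumable_pos (sumableN sG).
  have p0 x : 0 <= Num.max x (0 : R) by rewrite le_max lexx orbT.
  rewrite (sumZ_decomp (sumableZ e sp) (sumableZ e sn)).
  - by rewrite !pos_sumZ// /sumZ; ring.
  - by move=> n; rewrite mulr_ge0.
  - by move=> n; rewrite mulr_ge0.
  by move=> n; rewrite -mulrBr; congr (_ * _); case: (leP (G n) 0); case: (leP (- G n) 0); lra.
move=> sF; have [c0|c0] := leP 0 c; first exact: pos.
rewrite (_ : (fun n => _) = (fun n => (- c) * (- F n))); last by apply/funext => n; ring.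
by rewrite pos ?sumZN ?mulrNN//; [lra|exact: sumableN].
Qed.

Lemma pos_sum_ge0 F : (forall n, 0 <= F n) -> 0 <= pos_sum F.
Proof. by move=> F0; apply: fine_ge0; apply: esum_ge0 => n _; rewrite lee_fin. Qed.

Lemma sumZ_ge0 F : sumable F -> (forall n, 0 <= F n) -> 0 <= sumZ F.
Proof. by move=> sF F0; rewrite sumZ_nneg//; exact: pos_sum_ge0. Qed.

Lemma sumZ_le F G : sumable F -> sumable G -> (forall n, F n <= G n) -> sumZ F <= sumZ G.
Proof.
move=> sF sG FG; rewrite -subr_ge0 -sumZN -sumZD//; last exact: sumableN.
by apply: sumZ_ge0 => [|n]; [apply: sumableD => //; exact: sumableN|rewrite subr_ge0].
Qed.

Lemma sumable_reindex F (e e' : T -> T) : cancel e e' -> cancel e' e ->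
  sumable F -> sumable (F \o e).
Proof.
move=> ee' e'e; rewrite /sumable /summable (@reindex_esum _ _ _ [set: T] [set: T] e)//.
by split=> //; [move=> x y _ _ /(can_inj ee')|move=> y _; exists (e' y)].
Qed.

Lemma sumZ_reindex F (e e' : T -> T) : cancel e e' -> cancel e' e ->
  sumZ (F \o e) = sumZ F.
Proof.
move=> ee' e'e.
have be : set_bij [set: T] [set: T] e.
  by split=> //; [move=> x y _ _ /(can_inj ee')|move=> y _; exists (e' y)].
rewrite /sumZ /pos_sum; congr (fine _ - fine _).
  by rewrite [RHS](reindex_esum _ _ _ _ be).
by rewrite [RHS](reindex_esum _ _ _ _ be).
Qed.

Lemma sumable_fsupp F (s : seq T) : uniq s -> (forall z, z \notin s -> F z = 0) -> sumable F.
Proof.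
move=> us F0; rewrite /sumable /summable.
rewrite (_ : \esum_(_ in _) _ = \esum_(n in [set` s]) (`|(F n)%:E|)%E); last first.
  rewrite [RHS]esum_mkcond; apply: eq_esum => z _; case: ifPn => //.
  by rewrite notin_setE/= => /negP /F0 ->; rewrite normr0.
by rewrite esum_fset// -fsbig_seq//= sumEFin ltry.
Qed.

Lemma pos_sum_fsupp F (s : seq T) : uniq s -> (forall z, 0 <= F z) ->
  (forall z, z \notin s -> F z = 0) -> pos_sum F = \sum_(z <- s) F z.
Proof.
move=> us Fp F0; rewrite /pos_sum.
rewrite (_ : \esum_(_ in _) _ = \esum_(n in [set` s]) (F n)%:E); last first.
  rewrite [RHS]esum_mkcond; apply: eq_esum => z _; case: ifPn => //.
  by rewrite notin_setE/= => /negP /F0 ->.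
rewrite esum_fset//; last by move=> z _; rewrite lee_fin.
by rewrite -fsbig_seq//= sumEFin.
Qed.

Lemma sumZ_fsupp F (s : seq T) : uniq s -> (forall z, z \notin s -> F z = 0) ->
  sumZ F = \sum_(z <- s) F z.
Proof.
move=> us F0; have p0 x : 0 <= Num.max x (0 : R) by rewrite le_max lexx orbT.
rewrite /sumZ !(pos_sum_fsupp us)//.
- rewrite -sumrB; apply: eq_bigr => z _.
  by case: (leP (F z) 0); case: (leP (- F z) 0); lra.
- by move=> z /F0 ->; rewrite oppr0 maxxx.
by move=> z /F0 ->; rewrite maxxx.
Qed.

Lemma le_pos_sum F (s : seq T) : uniq s -> sumable F -> (forall n, 0 <= F n) ->
  \sum_(z <- s) F z <= pos_sum F.
Proof.
move=> us sF F0; rewrite -lee_fin -pos_sum_fin//; apply: esum_ge; exists [set` s].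
  by split=> //; exact: finite_seq.
by rewrite -fsbig_seq// sumEFin.
Qed.

Lemma sumable_bounded F c : (forall n, 0 <= F n) ->
  (forall s : seq T, uniq s -> \sum_(z <- s) F z <= c) -> sumable F /\ pos_sum F <= c.
Proof.
move=> F0 Fc.
have Ec : (\esum_(n in [set: T]) (F n)%:E <= c%:E)%E.
  apply: ge_ereal_sup => _ [X [finX _]] <-.
  by rewrite fsbig_finite//= sumEFin lee_fin; apply: Fc; exact: finmap.fset_uniq.
have sF : sumable F by apply/sumable_nneg => //; apply: le_lt_trans Ec _; rewrite ltry.
by split=> //; rewrite -lee_fin -pos_sum_fin.
Qed.

End signed_sums.

(** * Neighbours in the lattice *)

Section neighbours.
Context {R : realType} {d : nat}.
Local Notation C := R[i].
Local Notation Zd := 'rV[int]_d.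
Local Notation adj := (@adj R d).

Definition box (K : nat) : seq Zd :=
  [seq \row_i ((g i : nat)%:Z - K%:Z) | g : {ffun 'I_d -> 'I_(K.*2.+1)}].

Lemma box_uniq K : uniq (box K).
Proof.
rewrite map_inj_uniq ?enum_uniq// => g h /rowP gh; apply/ffunP => i.
by apply: val_inj; have := gh i; rewrite !mxE => /addIr[].
Qed.

Lemma mem_box K (z : Zd) : reflect (forall i, `|z 0 i| <= K%:Z) (z \in box K).
Proof.
apply: (iffP mapP) => [[g _ ->] i|zK].
  rewrite mxE; have := ltn_ord (g i); move: (nat_of_ord (g i)) => m; lia.
exists [ffun i => inord (absz (z 0 i + K%:Z))]; first by rewrite mem_enum.
apply/rowP => i; have := zK i; rewrite mxE ffunE; move: (z 0 i) => m mK.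
by rewrite inordK; lia.
Qed.

Lemma enorm_coord (x : 'rV[R]_d) i : `|x 0 i| <= enorm x.
Proof.
rewrite -(ler_sqr (normr_ge0 _)) ?nnegrE ?sqrtr_ge0// sqr_sqrtr.
  by rewrite real_normK ?num_real// (bigD1 i)//= lerDl sumr_ge0// => k _; exact: sqr_ge0.
by apply: sumr_ge0 => k _; exact: sqr_ge0.
Qed.

Lemma adj_coord m n i : adj m n -> `|m 0 i - n 0 i| <= 1.
Proof.
move=> /eqP mn; have := enorm_coord (embed (m - n)) i; rewrite mn !mxE.
by rewrite -intr_norm -[1 in X in _ -> _ <= X]/(1%:Z) (ler_int R _ 1).
Qed.

(** The neighbours of the origin, in a list that does not depend on the site. *)
Definition nbr : seq Zd := [seq m <- box 1 | adj m 0].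

Lemma nbr_uniq : uniq nbr.
Proof. by rewrite filter_uniq// box_uniq. Qed.

Lemma adjE m n : adj m n = (m - n \in nbr).
Proof.
have adj0 : adj m n = adj (m - n) 0 by rewrite /adj subr0.
rewrite mem_filter adj0; case: (boolP (adj (m - n) 0)) => //= a.
by apply/esym/mem_box => i; have := adj_coord i a; rewrite [(0 : Zd) 0 i]mxE subr0.
Qed.

Lemma nbrN k : (- k \in nbr) = (k \in nbr).
Proof. by rewrite -[k]subr0 opprB -!adjE adj_sym. Qed.

Lemma nbr_sum (V : nmodType) (F : Zd -> V) : \sum_(k <- nbr) F (- k) = \sum_(k <- nbr) F k.
Proof.
rewrite -(big_map -%R xpredT F); apply: perm_big; apply: uniq_perm.
- by rewrite map_inj_uniq ?nbr_uniq//; exact: oppr_inj.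
- exact: nbr_uniq.
move=> k; apply/mapP/idP => [[j jn ->]|kn]; first by rewrite nbrN.
by exists (- k); rewrite ?nbrN ?opprK.
Qed.

Lemma schrodinger_setTE (f : Zd -> R) (u : Zd -> C) n :
  schrodinger [set: Zd] f u n =
  - (\sum_(k <- nbr) u (n + k)) + (2 * d)%:R * u n + (f n)%:C%C * u n.
Proof.
rewrite /schrodinger mem_set//; congr (- _ + _ + _).
transitivity (\sum_(m <- [seq n + k | k <- nbr]) u m); last by rewrite big_map.
rewrite [RHS]fsbig_seq; last first.
  by rewrite map_inj_uniq ?nbr_uniq//; exact: addrI.
apply: eq_fsbigl; apply/seteqP; split=> m /=.
  move=> [_ /eqP mn]; apply/mapP; exists (m - n); last by rewrite addrC subrK.
  by rewrite -adjE.
by move=> /mapP[k kn ->]; split=> //; apply/eqP; rewrite -/(adj _ _) adjE addrC addKr.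
Qed.

(** The operator -Delta + W on real functions. *)
Definition op (W : Zd -> R) (u : Zd -> R) : Zd -> R :=
  fun n => - (\sum_(k <- nbr) u (n + k)) + ((2 * d)%:R + W n) * u n.

Lemma opE W u s n : uniq s -> (forall z, z \notin s -> u z = 0) ->
  op W u n = \sum_(m <- s) kern W m n * u m.
Proof.
move=> us u0; rewrite /op /kern; under [RHS]eq_bigr do rewrite mulrBl.
rewrite sumrB addrC; congr (_ - _).
  have [ns|ns] := boolP (n \in s).
    rewrite (bigD1_seq n)//= eqxx mul1r big1 ?addr0// => m /negbTE ->.
    by rewrite !mul0r.
  rewrite (u0 _ ns) mulr0 big_seq big1// => m ms; case: eqVneq => [mn|_]; last by rewrite !mul0r.
  by move: ns; rewrite -mn ms.
rewrite -(big_map (+%R n) xpredT u) (bigID (mem s))/= [X in _ + X]big1 ?addr0; last first.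
  by move=> m /u0.
transitivity (\sum_(m <- s | adj m n) u m); last first.
  by rewrite big_mkcond; apply: eq_bigr => m _; case: ifP; rewrite ?mul1r ?mul0r.
rewrite -big_filter -[RHS]big_filter; apply: perm_big; apply: uniq_perm.
- by rewrite filter_uniq// map_inj_uniq ?nbr_uniq//; exact: addrI.
- exact: filter_uniq.
move=> m; rewrite !mem_filter andbC; congr (_ && _); rewrite adjE.
apply/mapP/idP => [[k kn ->]|mn]; first by rewrite addrC addKr.
by exists (m - n); rewrite // addrC subrK.
Qed.

End neighbours.

(** * Square-summable functions *)

Section square_summable.
Context {R : realType} {d : nat}.
Local Notation Zd := 'rV[int]_d.
Implicit Types (u v w W q : Zd -> R).
Local Notation nbr := (@nbr R d).

Definition sq2 u : Prop := sumable (fun n => u n ^+ 2).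
Definition n2 u : R := pos_sum (fun n => u n ^+ 2).
Definition ip u v : R := sumZ (fun n => u n * v n).

Let sqr_norm (x : R) : x ^+ 2 = `|x| ^+ 2.
Proof. by rewrite real_normK ?num_real. Qed.

Lemma sq2_prod u v : sq2 u -> sq2 v -> sumable (fun n => u n * v n).
Proof.
move=> su sv; apply: sumable_le (sumableD su sv) _ => n.
rewrite normrM [leRHS]ger0_norm ?addr_ge0 ?sqr_ge0//.
rewrite (sqr_norm (u n)) (sqr_norm (v n)).
have := sqr_ge0 (`|u n| - `|v n|); have := normr_ge0 (u n); have := normr_ge0 (v n); nra.
Qed.

Lemma sq2_bound u v c : sq2 u -> (forall n, `|v n| <= c * `|u n|) -> sq2 v.
Proof.
move=> su vu; apply: sumable_le (sumableZ (c ^+ 2) su) _ => n.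
rewrite (ger0_norm (sqr_ge0 (v n))) ger0_norm; last by rewrite mulr_ge0 ?sqr_ge0.
rewrite (sqr_norm (u n)) (sqr_norm (v n)) -exprMn.
by rewrite lerXn2r ?nnegrE ?normr_ge0//; exact: le_trans (vu n).
Qed.

Lemma sq2Z c u : sq2 u -> sq2 (fun n => c * u n).
Proof. by move=> su; apply: (sq2_bound (c := `|c|) su) => n; rewrite normrM. Qed.

Lemma sq2N u : sq2 u -> sq2 (fun n => - u n).
Proof. by move=> su; apply: (sq2_bound (c := 1) su) => n; rewrite normrN mul1r. Qed.

Lemma sq2D u v : sq2 u -> sq2 v -> sq2 (fun n => u n + v n).
Proof.
move=> su sv; have s2 := sumableZ 2 (sumableD su sv).
apply: sumable_le s2 _ => n; have su2 := sqr_ge0 (u n); have sv2 := sqr_ge0 (v n).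
rewrite (ger0_norm (sqr_ge0 _)) ger0_norm; last by rewrite mulr_ge0 ?addr_ge0.
by have := sqr_ge0 (u n - v n); nra.
Qed.

Lemma sq2B u v : sq2 u -> sq2 v -> sq2 (fun n => u n - v n).
Proof. by move=> su sv; apply: sq2D su (sq2N sv). Qed.

Lemma sq2_sum (I : Type) (r : seq I) (F : I -> Zd -> R) :
  (forall i, sq2 (F i)) -> sq2 (fun n => \sum_(i <- r) F i n).
Proof.
move=> sF; elim: r => [|i r IH].
  rewrite (_ : (fun _ => _) = (fun=> 0)); last by apply/funext => n; rewrite big_nil.
  by apply: (sumable_fsupp (s := [::])) => // z _; rewrite expr0n.
rewrite (_ : (fun _ => _) = (fun n => F i n + \sum_(j <- r) F j n)).
  exact: sq2D.
by apply/funext => n; rewrite big_cons.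
Qed.

Lemma sq2_fsupp u s : uniq s -> (forall z, z \notin s -> u z = 0) -> sq2 u.
Proof. by move=> us u0; apply: (sumable_fsupp us) => z /u0 ->; rewrite expr0n. Qed.

Lemma n2E u : sq2 u -> n2 u = ip u u.
Proof.
by move=> su; rewrite /n2 -sumZ_nneg// => n; exact: sqr_ge0.
Qed.

Lemma n2_sumZ u : sq2 u -> n2 u = sumZ (fun n => u n ^+ 2).
Proof. by move=> su; rewrite n2E. Qed.

Lemma n2_ge0 u : 0 <= n2 u.
Proof. by apply: pos_sum_ge0 => n; exact: sqr_ge0. Qed.

Lemma ipC u v : ip u v = ip v u.
Proof. by congr sumZ; apply/funext => n; rewrite mulrC. Qed.

Lemma ipDl u u' v : sq2 u -> sq2 u' -> sq2 v ->
  ip (fun n => u n + u' n) v = ip u v + ip u' v.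
Proof.
move=> su su' sv; rewrite -sumZD; [|exact: sq2_prod|exact: sq2_prod].
by congr sumZ; apply/funext => n; rewrite mulrDl.
Qed.

Lemma ipDr u v v' : sq2 u -> sq2 v -> sq2 v' ->
  ip u (fun n => v n + v' n) = ip u v + ip u v'.
Proof. by move=> su sv sv'; rewrite ipC ipDl// ![ip _ u]ipC. Qed.

Lemma ipZl c u v : sq2 u -> sq2 v -> ip (fun n => c * u n) v = c * ip u v.
Proof.
move=> su sv; rewrite -sumZZ; last exact: sq2_prod.
by congr sumZ; apply/funext => n; rewrite mulrA.
Qed.

Lemma ipZr c u v : sq2 u -> sq2 v -> ip u (fun n => c * v n) = c * ip u v.
Proof. by move=> su sv; rewrite ipC ipZl// ipC. Qed.

Lemma ip_sumr (I : Type) (r : seq I) u (F : I -> Zd -> R) : sq2 u ->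
  (forall i, sq2 (F i)) -> ip u (fun n => \sum_(i <- r) F i n) = \sum_(i <- r) ip u (F i).
Proof.
move=> su sF; elim: r => [|i r IH].
  rewrite big_nil /ip (sumZ_fsupp (s := [::])) ?big_nil// => z _.
  by rewrite big_nil mulr0.
rewrite big_cons -IH -ipDr//; last exact: sq2_sum.
by congr ip; apply/funext => n; rewrite big_cons.
Qed.

Lemma n2Z c u : sq2 u -> n2 (fun n => c * u n) = c ^+ 2 * n2 u.
Proof.
by move=> su; have sc := sq2Z c su; rewrite !n2E// ipZl// ipZr// mulrA expr2.
Qed.

Lemma n2D_le u v : sq2 u -> sq2 v -> n2 (fun n => u n + v n) <= 2 * n2 u + 2 * n2 v.
Proof.
move=> su sv; rewrite !n2_sumZ//; last exact: sq2D.
rewrite -!sumZZ// -sumZD; [|exact: sumableZ|exact: sumableZ].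
apply: sumZ_le; [exact: sq2D| |].
  by apply: sumableD; exact: sumableZ.
by move=> n; have := sqr_ge0 (u n - v n); nra.
Qed.

Lemma n2_le u v c : sq2 u -> (forall n, `|v n| <= c * `|u n|) -> n2 v <= c ^+ 2 * n2 u.
Proof.
move=> su vu; have sv := sq2_bound su vu.
rewrite -n2Z// !n2_sumZ//; last exact: sq2Z.
apply: sumZ_le => //; first exact: sq2Z.
move=> n; rewrite (sqr_norm (v n)) exprMn (sqr_norm (u n)) -exprMn.
by rewrite lerXn2r ?nnegrE ?normr_ge0//; exact: le_trans (vu n).
Qed.

Lemma n2_ge_coord u n : sq2 u -> u n ^+ 2 <= n2 u.
Proof.
move=> su; have := le_pos_sum (s := [:: n]) isT su (fun n => sqr_ge0 _).
by rewrite big_seq1.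
Qed.

Lemma n2D u v : sq2 u -> sq2 v ->
  n2 (fun n => u n + v n) = n2 u + 2 * ip u v + n2 v.
Proof.
move=> su sv; rewrite (n2E (sq2D su sv)) (ipDl su sv (sq2D su sv)) !ipDr//.
by rewrite (ipC v u) !n2E//; ring.
Qed.

Lemma ip_le u v : sq2 u -> sq2 v -> `|ip u v| <= (n2 u + n2 v) / 2.
Proof.
move=> su sv; have := n2_ge0 (fun n => u n + v n); have := n2_ge0 (fun n => u n + (-1) * v n).
rewrite (n2D su sv) (n2D su (sq2Z _ sv)) n2Z// ipZr// ler_norml => ? ?.
by apply/andP; split; lra.
Qed.

Lemma sq2_shift u k : sq2 u -> sq2 (fun n => u (n + k)).
Proof.
move=> su; apply: (sumable_reindex (e := fun n => n + k) (e' := fun n => n - k) _ _ su).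
  exact: addrK.
exact: subrK.
Qed.

Lemma sq2_op W u : (exists c, forall n, `|W n| <= c) -> sq2 u -> sq2 (op W u).
Proof.
move=> [c Wc] su; apply: sq2D; first by apply/sq2N/sq2_sum => k; exact: sq2_shift.
apply: (sq2_bound (c := (2 * d)%:R + c) su) => n; rewrite normrM ler_wpM2r//.
by apply: le_trans (ler_normD _ _) _; rewrite normr_nat lerD2l.
Qed.

(** Translations are moved to the other factor by reindexing, and the set of
    neighbours of the origin is symmetric. *)
Lemma op_sym W u v : (exists c, forall n, `|W n| <= c) -> sq2 u -> sq2 v ->
  ip (op W u) v = ip u (op W v).
Proof.
move=> Wb su sv; have [c Wc] := Wb.
have sW w : sq2 w -> sq2 (fun n => ((2 * d)%:R + W n) * w n).
  move=> sw; apply: (sq2_bound (c := (2 * d)%:R + c) sw) => n; rewrite normrM ler_wpM2r//.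
  by apply: le_trans (ler_normD _ _) _; rewrite normr_nat lerD2l.
have ss w : sq2 w -> sq2 (fun n => \sum_(k <- nbr) w (n + k)).
  by move=> sw; apply: sq2_sum => k; exact: sq2_shift.
have split w w' : sq2 w -> sq2 w' -> ip w (op W w') =
    - \sum_(k <- nbr) ip w (fun n => w' (n + k)) + ip w (fun n => ((2 * d)%:R + W n) * w' n).
  move=> sw sw'; rewrite -ip_sumr//; last by move=> k; exact: sq2_shift.
  rewrite /op ipDr//; [|by apply/sq2N/ss|exact: sW].
  rewrite (_ : (fun n => - _) = fun n => (-1) * \sum_(k <- nbr) w' (n + k)).
    by rewrite ipZr ?mulN1r//; exact: ss.
  by apply/funext => n; rewrite mulN1r.
rewrite ipC !split//; congr (- _ + _); last first.
  by congr sumZ; apply/funext => n; ring.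
rewrite -nbr_sum; apply: eq_bigr => k _.
rewrite /ip -(@sumZ_reindex _ _ (fun n => u n * v (n + k)) (fun n => n - k) (fun n => n + k)).
- by congr sumZ; apply/funext => n /=; rewrite subrK mulrC.
- exact: subrK.
exact: addrK.
Qed.

Lemma op_comb W (I : Type) (r : seq I) (c : I -> R) (F : I -> Zd -> R) n :
  op W (fun z => \sum_(i <- r) c i * F i z) n = \sum_(i <- r) c i * op W (F i) n.
Proof.
rewrite /op exchange_big/= -sumrN mulr_sumr -big_split/=.
under [LHS]eq_bigr do rewrite -mulr_sumr.
by apply: eq_bigr => i _; ring.
Qed.

Lemma op_sub W q u n : op (fun n => W n - q n) u n = op W u n - q n * u n.
Proof. by rewrite /op; ring. Qed.

Lemma opB W u v n : op W (fun n => u n - v n) n = op W u n - op W v n.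
Proof. by rewrite /op sumrB; ring. Qed.

End square_summable.

(** * Bounded inverses *)

Section resolvent.
Context {R : realType} {d : nat}.
Local Notation Zd := 'rV[int]_d.
Implicit Types (u v w W q : Zd -> R).
Local Notation nbr := (@nbr R d).

Definition bounded_fct W : Prop := exists c, forall n, `|W n| <= c.

(** The operator -Delta + W has an inverse on the square-summable functions, and
    K bounds the square of its norm. *)
Definition bounded_inverse W (K : R) : Prop :=
  [/\ bounded_fct W, 0 < K,
      (forall w, sq2 w -> exists u, sq2 u /\ forall n, op W u n = w n) &
      (forall u, sq2 u -> n2 u <= K * n2 (op W u))].

Lemma sq2_mul q u e : (forall n, `|q n| <= e) -> sq2 u -> sq2 (fun n => q n * u n).
Proof. by move=> qe su; apply: (sq2_bound (c := e) su) => n; rewrite normrM ler_wpM2r. Qed.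

Lemma n2_mul q u e : (forall n, `|q n| <= e) -> sq2 u -> n2 (fun n => q n * u n) <= e ^+ 2 * n2 u.
Proof. by move=> qe su; apply: n2_le => // n; rewrite normrM ler_wpM2r. Qed.

Lemma op_cvg W (U : nat -> Zd -> R) u n :
  (forall z, U ^~ z @ \oo --> u z) -> (fun k => op W (U k) n) @ \oo --> op W u n.
Proof.
move=> Uu; apply: cvgD; last exact: cvgM (cvg_cst _) (Uu n).
apply: cvgN; elim: nbr => [|k r IH].
  by under eq_cvg do rewrite big_nil; rewrite big_nil; exact: cvg_cst.
by under eq_cvg do rewrite big_cons; rewrite big_cons; exact: cvgD.
Qed.

(** Neumann series. The map that sends u to the solution v of
    (-Delta + W) v = w + q u contracts square norms by 1/4, because K e^2 <= 1/4.
    Its iterates from 0 converge at each site and have bounded square norms, so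
    that the pointwise limit is square summable; it solves the perturbed equation
    since the operator involves finitely many sites at a time. *)
Lemma bounded_inverse_perturb W K q e : bounded_inverse W K -> (forall n, `|q n| <= e) -> 4 * K * e ^+ 2 <= 1 ->
  bounded_inverse (fun n => W n - q n) (4 * K).
Proof.
move=> [bW K0 ex est] qe Ke.
have bWq : bounded_fct (fun n => W n - q n).
  have [c Wc] := bW; exists (c + e) => n; apply: le_trans (ler_normB _ _) _; exact: lerD.
split=> //; first by rewrite mulr_gt0.
  move=> w sw.
  have /boolp.choice[S HS] (w' : Zd -> R) :
      exists u, sq2 w' -> sq2 u /\ forall n, op W u n = w' n.
    by have [/ex[u ?]|?] := pselect (sq2 w'); [exists u|exists (fun=> 0)].
  pose U := fix U k := if k is k'.+1 then S (fun n => w n + q n * U k' n) else (fun=> 0).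
  have sU k : sq2 (U k).
    elim: k => [|k IH] /=; first by apply: (sq2_fsupp (s := [::])).
    by apply: (HS _ _).1; apply: sq2D => //; exact: sq2_mul qe IH.
  have oU k n : op W (U k.+1) n = w n + q n * U k n.
    by apply: (HS _ _).2; apply: sq2D => //; exact: sq2_mul qe (sU k).
  pose D k n := U k.+1 n - U k n.
  have sD k : sq2 (D k) by exact: sq2B.
  have nD k : n2 (D k) <= 4^-1 ^+ k * n2 (D 0%N).
    elim: k => [|k IH]; first by rewrite expr0 mul1r.
    have : n2 (D k.+1) <= K * n2 (fun n => q n * D k n).
      apply: le_trans (est _ (sD _)) _; rewrite (_ : op W (D k.+1) = fun n => q n * D k n)//.
      by apply/funext => n; rewrite opB !oU /D; ring.
    have := n2_mul qe (sD k); have := n2_ge0 (D k); rewrite [4^-1 ^+ k.+1]exprS -(mulrA _ (4^-1 ^+ k)).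
    move: IH; move: (n2 (fun n => _)) (n2 (D k)) (n2 (D k.+1)) (_ * n2 (D 0%N)).
    move=> b a c g ag a0 ba cb; have K1 := ler_wpM2l (ltW K0) ba.
    by have := ler_wpM2r a0 Ke; lra.
  pose c := Num.sqrt (n2 (D 0%N)).
  have Dc n k : `|D k n| <= c * 2^-1 ^+ k.
    rewrite -(ler_pXn2r (n := 2))// ?nnegrE ?mulr_ge0 ?sqrtr_ge0 ?exprn_ge0//.
    rewrite real_normK ?num_real// exprMn sqr_sqrtr ?n2_ge0//.
    apply: le_trans (n2_ge_coord n (sD k)) _; apply: le_trans (nD k) _.
    by rewrite mulrC -exprM mulnC exprM (_ : 2^-1 ^+ 2 = 4^-1)//; field.
  have cU n : cvgn (U ^~ n).
    have -> : U ^~ n = series (D ^~ n).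
      apply/funext => k; rewrite /series/= telescope_sumr//= subr0//.
    apply: normed_cvg; apply: (@series_le_cvg _ _ (geometric c 2^-1)) => //.
    - by move=> k /=; exact: normr_ge0.
    - by move=> k; rewrite /geometric/= mulr_ge0 ?sqrtr_ge0 ?exprn_ge0.
    - by move=> k; exact: Dc.
    by apply: is_cvg_geometric_series; rewrite ger0_norm; lra.
  pose u n := limn (U ^~ n).
  have Uu n : U ^~ n @ \oo --> u n by exact: cU.
  have nU k : n2 (U k) <= 4 * K * n2 w.
    elim: k => [|k IH].
      have -> : n2 (U 0%N) = 0.
        by rewrite /n2 (pos_sum_fsupp (s := [::])) ?big_nil// => z *; rewrite expr0n.
      by rewrite mulr_ge0 ?n2_ge0// mulr_ge0// ltW.
    have : n2 (U k.+1) <= K * n2 (fun n => w n + q n * U k n).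
      by apply: le_trans (est _ (sU _)) _; rewrite (_ : op W (U k.+1) = fun n => w n + q n * U k n)//; apply/funext => n; exact: oU.
    have h1 := ler_wpM2l (ltW K0) (n2D_le sw (sq2_mul qe (sU k))).
    have h2 := ler_wpM2l (ltW K0) (n2_mul qe (sU k)).
    by have := ler_wpM2r (n2_ge0 (U k)) Ke; lra.
  have su : sq2 u.
    suff [] : sumable (fun n => u n ^+ 2) /\ pos_sum (fun n => u n ^+ 2) <= 4 * K * n2 w by [].
    apply: sumable_bounded => [n|s us]; first exact: sqr_ge0.
    have : (fun k => \sum_(z <- s) U k z ^+ 2) @ \oo --> \sum_(z <- s) u z ^+ 2.
      elim: (s) => [|z r IH].
        by under eq_cvg do rewrite big_nil; rewrite big_nil; exact: cvg_cst.
      under eq_cvg do rewrite big_cons; rewrite big_cons; apply: cvgD IH.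
      by rewrite expr2; under eq_cvg do rewrite expr2; exact: cvgM.
    move=> /cvgr_to_le; apply; near=> k; apply: le_trans (nU k); apply: le_pos_sum => //; first exact: sU.
    by move=> z; exact: sqr_ge0.
  exists u; split=> // n.
  have h1 := @op_cvg W U u n Uu.
  have h2 : (fun k => w n + q n * U k n) @ \oo --> w n + q n * u n.
    by apply: cvgD; [exact: cvg_cst|apply: cvgM; [exact: cvg_cst|exact: Uu]].
  have h3 : (fun k => op W (U k.+1) n) @ \oo --> op W u n.
    by have := h1; rewrite -(cvg_shiftS (fun k => op W (U k) n)).
  have : op W u n = w n + q n * u n.
    move: h3; rewrite (_ : (fun k => _) = fun k => w n + q n * U k n); last first.
      by apply/funext => k; exact: oU.
    by move=> h3; rewrite -(cvg_lim (@Rhausdorff R) h3) (cvg_lim (@Rhausdorff R) h2).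
  by rewrite op_sub => ->; ring.
move=> u su; set g := op _ u.
have sg : sq2 g by exact: sq2_op.
have := est _ su; rewrite (_ : op W u = fun n => g n + q n * u n); last first.
  by apply/funext => n; rewrite /g op_sub; ring.
have h1 := ler_wpM2l (ltW K0) (n2D_le sg (sq2_mul qe su)).
have h2 := ler_wpM2l (ltW K0) (n2_mul qe su).
by have := ler_wpM2r (n2_ge0 u) Ke; lra.
Unshelve. all: by end_near. Qed.

End resolvent.

(** * Green functions *)

Section green_functions.
Context {R : realType} {d : nat}.
Local Notation Zd := 'rV[int]_d.
Implicit Types (u v w W q : Zd -> R) (s : seq Zd).

(** The columns of the inverse of -Delta + W. *)
Definition green W (y : Zd) : Zd -> R :=
  xget (fun=> 0) [set u | sq2 u /\ forall n, op W u n = (n == y)%:R].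

Lemma greenP W K y : bounded_inverse W K ->
  sq2 (green W y) /\ forall n, op W (green W y) n = (n == y)%:R.
Proof.
move=> [_ _ ex _]; suff : [set u | sq2 u /\ forall n, op W u n = (n == y)%:R] (green W y) by [].
apply: xgetPex; apply: ex.
by apply: (sq2_fsupp (s := [:: y])) => // z; rewrite inE => /negbTE ->.
Qed.

(** The compression to s of the inverse of -Delta + W. *)
Definition gmx s W : 'M[R]_(size s) := \matrix_(i, j) green W (pt s i) (pt s j).

Definition src s (x : 'rV[R]_(size s)) : Zd -> R :=
  fun z => \sum_i x 0 i * (z == pt s i)%:R.

Definition response s W (x : 'rV[R]_(size s)) : Zd -> R :=
  fun z => \sum_i x 0 i * green W (pt s i) z.

Lemma sq2_delta (y : Zd) : sq2 (fun z : Zd => (z == y)%:R : R).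
Proof. by apply: (sq2_fsupp (s := [:: y])) => // z; rewrite inE => /negbTE ->. Qed.

Lemma sq2_src s x : sq2 (src (s := s) x).
Proof. by apply: sq2_sum => i; apply: sq2Z; exact: sq2_delta. Qed.

Lemma ip_delta u y : sq2 u -> ip u (fun z => (z == y)%:R) = u y.
Proof.
move=> su; rewrite /ip (sumZ_fsupp (s := [:: y])) ?big_seq1 ?eqxx ?mulr1// => z.
by rewrite inE => /negbTE ->; rewrite mulr0.
Qed.

Lemma ip_src s x u : sq2 u -> ip u (src x) = \sum_i x 0 i * u (pt s i).
Proof.
move=> su; rewrite ip_sumr//; last by move=> i; apply: sq2Z; exact: sq2_delta.
by apply: eq_bigr => i _; rewrite ipZr ?ip_delta//; exact: sq2_delta.
Qed.

Lemma n2_src s (x : 'rV_(size s)) : uniq s -> n2 (src x) = qf 1%:M x.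
Proof.
move=> us; rewrite n2E ?ip_src; [|exact: sq2_src..].
rewrite qf1E; apply: eq_bigr => i _; rewrite /src (bigD1 i)//= eqxx mulr1 big1 ?addr0//.
by move=> j ji; rewrite (inj_eq (pt_inj us)) eq_sym (negbTE ji) mulr0.
Qed.

Section one.
Variables (W : Zd -> R) (K : R).
Hypothesis HW : bounded_inverse W K.

Lemma sq2_response s (x : 'rV_(size s)) : sq2 (response W x).
Proof. by apply: sq2_sum => i; apply: sq2Z; case: (greenP (pt s i) HW). Qed.

Lemma op_response s (x : 'rV_(size s)) n : op W (response W x) n = src x n.
Proof.
by rewrite op_comb; apply: eq_bigr => i _; case: (greenP (pt s i) HW) => _ ->.
Qed.

Lemma green_sym x y : green W x y = green W y x.
Proof.
have [bW _ _ _] := HW; have [sx ox] := greenP x HW; have [sy oy] := greenP y HW.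
rewrite -(ip_delta y sx) -(ip_delta x sy) (_ : (fun z => (z == y)%:R) = op W (green W y)); last first.
  by apply/funext => z; rewrite oy.
rewrite -op_sym// ipC; congr ip.
by apply/funext => z; rewrite ox.
Qed.

Lemma gmx_tr s : (gmx s W)^T = gmx s W.
Proof. by apply/matrixP => i j; rewrite !mxE green_sym. Qed.

Lemma qf_gmx s (x : 'rV_(size s)) : qf (gmx s W) x = ip (response W x) (src x).
Proof.
rewrite ip_src; last exact: sq2_response.
rewrite /qf bfE exchange_big/=; apply: eq_bigr => j _.
by rewrite /response mulr_sumr; apply: eq_bigr => i _; rewrite mxE; ring.
Qed.

Lemma n2_response s (x : 'rV_(size s)) : uniq s -> n2 (response W x) <= K * qf 1%:M x.
Proof.
move=> us; have [_ _ _ est] := HW; rewrite -n2_src//.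
apply: le_trans (est _ (sq2_response x)) _.
by rewrite (_ : op W _ = src x)//; apply/funext => n; rewrite op_response.
Qed.

Lemma qf_gmx_le s (x : 'rV_(size s)) : uniq s -> `|qf (gmx s W) x| <= (K + 1) / 2 * qf 1%:M x.
Proof.
move=> us; rewrite qf_gmx; apply: le_trans (ip_le (sq2_response x) (sq2_src x)) _.
by rewrite n2_src//; have := n2_response x us; lra.
Qed.

End one.

(** Let u and v be the responses of the two operators to the source x. By the
    resolvent identity the difference of the forms is tau <q u, v>. The leading
    part <q u, u> is nonnegative, and v - u, which is the response to tau q u, is
    small enough by K tau^2 m^2 <= 1 for <q u, v> to be nonnegative too. *)
Lemma gmx_increasing s W q (K tau m : R) (x : 'rV_(size s)) : uniq s ->
  bounded_inverse W K -> bounded_inverse (fun n => W n - tau * q n) K ->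
  0 <= tau -> (forall n, 0 <= q n <= m) -> K * tau ^+ 2 * m ^+ 2 <= 1 ->
  0 <= qf (gmx s (fun n => W n - tau * q n)%R) x - qf (gmx s W) x <=
    tau * ((m ^+ 2 + 1) * K / 2 * qf 1%:M x).
Proof.
move=> us HW HW' tau0 qm Km.
rewrite (qf_gmx HW) (qf_gmx HW'); set W' := fun n => _ in HW' *.
set u := response W x; set v := response W' x.
have su : sq2 u := sq2_response HW x; have sv : sq2 v := sq2_response HW' x.
have [bW K0 _ est] := HW; have [bW' _ _ est'] := HW'.
have qm' n : `|q n| <= m by have /andP[q0 ?] := qm n; rewrite ger0_norm.
have m0 : 0 <= m by have /andP[q0 qm0] := qm 0; exact: le_trans qm0.
have sqv := sq2_mul qm' sv; have squ := sq2_mul qm' su.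
have oW' w n : op W' w n = op W w n - tau * (q n * w n).
  by rewrite (op_sub W (fun n => tau * q n)); ring.
have opu n : op W u n = src x n by exact: (op_response HW x n).
have opv n : op W' v n = src x n by exact: (op_response HW' x n).
have E : ip v (src x) - ip u (src x) = tau * ip (fun n => q n * u n) v.
  have -> : src x = op W u by apply/funext => n; rewrite opu.
  have -> : ip u (op W u) = ip u (op W v) - tau * ip (fun n => q n * u n) v.
    have -> : ip (fun n => q n * u n) v = ip u (fun n => q n * v n).
      by congr sumZ; apply/funext => n; ring.
    rewrite [X in ip u X](_ : _ = fun n => op W v n + (- tau) * (q n * v n)); last first.
      by apply/funext => n; rewrite opu -opv oW'; ring.
    by rewrite ipDr ?ipZr ?mulNr//; [exact: sq2_op|exact: sq2Z].
  by rewrite -(op_sym bW su sv) ipC; ring.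
pose z n := v n - u n.
have sz : sq2 z := sq2B sv su.
have nz : n2 z <= K * tau ^+ 2 * n2 (fun n => q n * u n).
  apply: le_trans (est' _ sz) _; rewrite -mulrA -n2Z//.
  rewrite (_ : op W' z = fun n => tau * (q n * u n))//.
  by apply/funext => n; rewrite opB opv oW' opu; ring.
have sqz := sq2_mul qm' sz.
have Ev : ip (fun n => q n * u n) v = sumZ (fun n => q n * u n ^+ 2) + sumZ (fun n => q n * (u n * z n)).
  rewrite -sumZD.
  - by congr sumZ; apply/funext => n; rewrite /z; ring.
  - by have := sq2_prod squ su; congr sumable; apply/funext => n; ring.
  - by have := sq2_prod squ sz; congr sumable; apply/funext => n; ring.
have s1 : sumable (fun n => q n * u n ^+ 2).
  by have := sq2_prod squ su; congr sumable; apply/funext => n; ring.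
have s2 : sumable (fun n => q n * (u n * z n)).
  by have := sq2_prod squ sz; congr sumable; apply/funext => n; ring.
have s3 : sumable (fun n => q n * z n ^+ 2).
  by have := sq2_prod sqz sz; congr sumable; apply/funext => n; ring.
set A := sumZ (fun n => q n * u n ^+ 2) in Ev.
have h1 : - (A + sumZ (fun n => q n * z n ^+ 2)) / 2 <= sumZ (fun n => q n * (u n * z n)).
  have s22 := sumableZ 2 s2; have s12 := sumableD s1 s22.
  have : 0 <= A + 2 * sumZ (fun n => q n * (u n * z n)) + sumZ (fun n => q n * z n ^+ 2).
    rewrite -sumZZ// -sumZD// -sumZD//; apply: sumZ_ge0; first exact: sumableD.
    by move=> n; have /andP[q0 _] := qm n; have := sqr_ge0 (u n + z n); nra.
  lra.
have h2 : sumZ (fun n => q n * z n ^+ 2) <= m * n2 z.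
  rewrite n2_sumZ// -sumZZ//; apply: sumZ_le => //; first exact: sumableZ.
  by move=> n; rewrite ler_wpM2r ?sqr_ge0//; case/andP: (qm n).
have h3 : n2 (fun n => q n * u n) <= m * A.
  rewrite n2_sumZ// -sumZZ//; apply: sumZ_le => //; first exact: sumableZ.
  move=> n; have /andP[q0 q1] := qm n; rewrite exprMn mulrA ler_wpM2r ?sqr_ge0//.
  by rewrite expr2 ler_wpM2r.
have A0 : 0 <= A.
  apply: sumZ_ge0 => // n; have /andP[q0 _] := qm n.
  by rewrite mulr_ge0 ?sqr_ge0.
rewrite E; apply/andP; split.
  apply: mulr_ge0 => //; rewrite Ev.
  suff : m * n2 z <= A by lra.
  apply: le_trans (ler_wpM2l m0 nz) _.
  have Kt : 0 <= K * tau ^+ 2 by rewrite mulr_ge0 ?sqr_ge0// ltW.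
  have := ler_wpM2l m0 (ler_wpM2l Kt h3); have := ler_wpM2r A0 Km.
  lra.
apply: ler_wpM2l => //; have := ip_le squ sv; rewrite ler_norml => /andP[_].
move=> /le_trans; apply.
have := n2_mul qm' su; have := ler_wpM2l (sqr_ge0 m) (n2_response HW x us).
by have := n2_response HW' x us; rewrite -/u -/v; lra.
Qed.

End green_functions.

(** * Complex functions and the resolvent set *)

Section complex_functions.
Context {R : realType} {d : nat}.
Local Notation C := R[i].
Local Notation Zd := 'rV[int]_d.
Implicit Types (f V W q : Zd -> R) (u : Zd -> C) (s : seq Zd).
Local Notation nbr := (@nbr R d).
Local Notation reC := (@complex.Re R).
Local Notation imC := (@complex.Im R).
Local Notation normc := (@ComplexField.Normc.normc R).

Lemma reD (x y : C) : reC (x + y) = reC x + reC y. Proof. by case: x; case: y. Qed.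
Lemma imD (x y : C) : imC (x + y) = imC x + imC y. Proof. by case: x; case: y. Qed.
Lemma reN (x : C) : reC (- x) = - reC x. Proof. by case: x. Qed.
Lemma imN (x : C) : imC (- x) = - imC x. Proof. by case: x. Qed.
Lemma reZ (c : R) (x : C) : reC (rc c * x) = c * reC x.
Proof. by case: x => a b /=; rewrite mul0r subr0. Qed.
Lemma imZ (c : R) (x : C) : imC (rc c * x) = c * imC x.
Proof. by case: x => a b /=; rewrite mul0r addr0. Qed.
Lemma re_sum (I : Type) (r : seq I) (F : I -> C) : reC (\sum_(i <- r) F i) = \sum_(i <- r) reC (F i).
Proof. by elim/big_rec2 : _ => // i x y _ <-; rewrite reD. Qed.
Lemma im_sum (I : Type) (r : seq I) (F : I -> C) : imC (\sum_(i <- r) F i) = \sum_(i <- r) imC (F i).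
Proof. by elim/big_rec2 : _ => // i x y _ <-; rewrite imD. Qed.
Lemma eq_reim (x y : C) : reC x = reC y -> imC x = imC y -> x = y.
Proof. by case: x => a b; case: y => a' b' /= -> ->. Qed.

Lemma normc_sqr (x : C) : normc x ^+ 2 = reC x ^+ 2 + imC x ^+ 2.
Proof. by case: x => a b /=; rewrite sqr_sqrtr// addr_ge0 ?sqr_ge0. Qed.

Lemma l2_reim u : l2 [set: Zd] u <-> sq2 (reC \o u) /\ sq2 (imC \o u).
Proof.
split=> [[_ su]|[sr si]].
  split; apply: (sumable_le (G := fun n => normc (u n) ^+ 2)) => // n /=;
  by rewrite !ger0_norm ?sqr_ge0// normc_sqr ?lerDl ?lerDr ?sqr_ge0.
split=> [n /(_ I)//|]; rewrite /summable; apply: le_lt_trans (sumableD sr si); apply: le_esum => n _.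
by rewrite /= normc_sqr.
Qed.

Lemma l2norm_real (u : Zd -> R) : l2norm (rc \o u) = Num.sqrt (n2 u).
Proof.
rewrite /l2norm /n2 /pos_sum; congr (Num.sqrt (fine _)); apply: eq_esum => n _.
by rewrite normc_sqr /= expr0n addr0.
Qed.

Definition opC W u : Zd -> C :=
  fun n => - (\sum_(k <- nbr) u (n + k)) + rc ((2 * d)%:R + W n) * u n.

Lemma re_opC W u n : reC (opC W u n) = op W (reC \o u) n.
Proof. by rewrite /opC reD reN reZ re_sum. Qed.

Lemma im_opC W u n : imC (opC W u n) = op W (imC \o u) n.
Proof. by rewrite /opC imD imN imZ im_sum. Qed.

Lemma opC_real W (g : Zd -> R) n : opC W (rc \o g) n = rc (op W g n).
Proof.
apply: eq_reim; first by rewrite re_opC.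
rewrite im_opC /= /op big1 ?oppr0 ?mulr0 ?addr0// => k _.
Qed.

Lemma opC_comb W n (phi : 'I_n -> Zd -> C) x z :
  opC W (comb phi x) z = \sum_i x 0 i * opC W (phi i) z.
Proof.
rewrite /opC /comb exchange_big/= -sumrN mulr_sumr -big_split/=.
by apply: eq_bigr => i _; rewrite -mulr_sumr; ring.
Qed.

Lemma opCB W u u' n : opC W (fun n => u n - u' n) n = opC W u n - opC W u' n.
Proof. by rewrite /opC sumrB; ring. Qed.

Lemma schrodinger_opC f lam u n :
  schrodinger [set: Zd] f u n - rc lam * u n = opC (fun n => f n - lam) u n.
Proof. by rewrite schrodinger_setTE rcE /opC !(rcD, rcB) rc_nat; ring. Qed.

Lemma perturbed_opC f V t lam u n :
  perturbed f V t u n - rc lam * u n = opC (fun n => f n - lam - t * V n) u n.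
Proof.
rewrite /perturbed rcE addrAC schrodinger_opC /opC !(rcD, rcB) rc_nat; ring.
Qed.

(** The operator has real coefficients, so that the real part of a solution solves
    the equation for a real right-hand side. The constant 1 + M^2 is positive
    whatever the sign of M. *)
Lemma resolvent_bounded_inverse f lam : bounded_fct f ->
  resolvent_set (schrodinger [set: Zd] f) lam%:C%C ->
  exists K, bounded_inverse (fun n => f n - lam) K.
Proof.
move=> bf [ex [M est]]; exists (1 + M ^+ 2).
have bW : bounded_fct (fun n => f n - lam).
  by have [c fc] := bf; exists (c + `|lam|) => n; apply: le_trans (ler_normB _ _) _; rewrite lerD2r.
have l2rc (w : Zd -> R) : sq2 w -> l2 setT (rc \o w).
  move=> sw; apply/l2_reim; split=> //.
  by apply: (sq2_fsupp (s := [::])).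
split=> //; first by rewrite ltr_pwDl// sqr_ge0.
  move=> w /l2rc /ex[u [[/l2_reim[su _] uw] _]]; exists (reC \o u); split=> // n.
  by rewrite -re_opC -schrodinger_opC -rcE uw.
move=> u su; have sou : sq2 (op (fun n => f n - lam) u) by exact: sq2_op.
have := est _ (l2rc _ su); rewrite l2norm_real.
rewrite (_ : (fun n => _) = rc \o op (fun n => f n - lam) u); last first.
  by apply/funext => n; rewrite rcE schrodinger_opC opC_real.
rewrite l2norm_real; set a := n2 u; set b := n2 _ => ab.
have a0 : 0 <= a by exact: n2_ge0.
have b0 : 0 <= b by exact: n2_ge0.
have := lerXn2r 2 (_ : Num.sqrt a \is Num.nneg) (_ : M * Num.sqrt b \is Num.nneg) ab.
rewrite exprMn !sqr_sqrtr// !nnegrE => h; apply: le_trans (h _ _) _.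
- exact: sqrtr_ge0.
- exact: le_trans (sqrtr_ge0 _) ab.
by rewrite mulrDl mul1r lerDr.
Qed.

End complex_functions.

(** * The Birman-Schwinger principle on a finite set of sites *)

Section crossing_count_finite.
Context {R : realType} {d : nat}.
Local Notation C := R[i].
Local Notation Zd := 'rV[int]_d.
Local Notation nbr := (@nbr R d).
Local Notation reC := (@complex.Re R).
Local Notation imC := (@complex.Im R).

Variables (f V : Zd -> R) (lam alpha K e : R) (s : seq Zd).
Hypotheses (us : uniq s) (alpha0 : 0 < alpha) (V0 : forall n, 0 <= V n).
Let W n := f n - lam.
Hypothesis HW : bounded_inverse W K.
Hypothesis Vout : forall n, n \notin s -> alpha * V n <= e.
Hypotheses (e0 : 0 <= e) (Ke : 4 * K * e ^+ 2 <= 1).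

(* Outside s the perturbation is small and joins the operator, which gives Wt;
   inside s it is factored as Sd^2. *)
Let q n := if n \in s then 0 else V n.
Let Wt t n := W n - t * q n.
Let Sd : 'M[R]_(size s) := diag_mx (\row_i Num.sqrt (V (pt s i))).
Let D t := t^-1 *: 1%:M - Sd *m gmx s (Wt t) *m Sd.

Let q_bound n : 0 <= q n <= e / alpha.
Proof.
rewrite /q; case: ifPn => [_|ns]; first by rewrite lexx divr_ge0// ltW.
by rewrite V0/= ler_pdivlMr// mulrC Vout.
Qed.

Lemma bounded_inverse_Wt t : 0 <= t -> t <= alpha -> bounded_inverse (Wt t) (4 * K).
Proof.
move=> t0 ta; apply: (bounded_inverse_perturb HW _ Ke) => n; have /andP[q0 q1] := q_bound n.
rewrite ger0_norm ?mulr_ge0//; apply: le_trans (ler_wpM2l t0 q1) _.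
by rewrite mulrCA ler_piMr// ler_pdivrMr// mul1r.
Qed.

(* The functions on the lattice that the coordinates of a kernel vector of D t combine. *)
Let mode t (i : 'I_(size s)) : Zd -> C :=
  fun z => rc (Num.sqrt (V (pt s i)) * green (Wt t) (pt s i) z).

Lemma Sd_tr : Sd^T = Sd. Proof. exact: tr_diag_mx. Qed.

Lemma D_entry t i j : D t i j = t^-1 *+ (i == j) -
  Num.sqrt (V (pt s i)) * green (Wt t) (pt s i) (pt s j) * Num.sqrt (V (pt s j)).
Proof. by rewrite /D /Sd mul_mx_diag mul_diag_mx !mxE mulrnAr mulr1. Qed.

Lemma toC_DE t (x : 'rV[C]_(size s)) j : 0 < t -> t <= alpha ->
  (x *m toC (D t)) 0 j =
  rc t^-1 * x 0 j - rc (Num.sqrt (V (pt s j))) * comb (mode t) x (pt s j).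
Proof.
move=> t0 ta; rewrite /comb mulr_sumr mxE.
transitivity (\sum_i (x 0 i * rc (t^-1 *+ (i == j)) - rc (Num.sqrt (V (pt s j))) *
    (x 0 i * mode t i (pt s j)))).
  by apply: eq_bigr => i _; rewrite mxE D_entry -/(rc _) /mode !(rcB, rcM); ring.
rewrite sumrB; congr (_ - _); rewrite (bigD1 j)//= eqxx mulr1n big1 ?addr0 1?mulrC//.
by move=> i /negbTE ->; rewrite mulr0n (rc_nat 0) mulr0.
Qed.

Lemma opC_modes t (x : 'rV[C]_(size s)) z : 0 < t -> t <= alpha ->
  opC (Wt t) (comb (mode t) x) z =
  \sum_i x 0 i * rc (Num.sqrt (V (pt s i)) * (z == pt s i)%:R).
Proof.
move=> t0 ta; rewrite opC_comb; apply: eq_bigr => i _; congr (_ * _).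
rewrite opC_real; congr rc.
have [_ <-] := greenP (pt s i) (bounded_inverse_Wt (ltW t0) ta).
rewrite -[LHS](_ : \sum_(j < 1) Num.sqrt (V (pt s i)) * op (Wt t) (green (Wt t) (pt s i)) z = _).
  by rewrite big_ord1.
rewrite -op_comb; congr (op _ _ _).
by apply/funext => y; rewrite big_ord1.
Qed.

Lemma l2_modes t (x : 'rV[C]_(size s)) : 0 < t -> t <= alpha ->
  l2 setT (comb (mode t) x).
Proof.
move=> t0 ta; apply/l2_reim.
have sg i : sq2 (fun z => Num.sqrt (V (pt s i)) * green (Wt t) (pt s i) z).
  by apply: sq2Z; have [] := greenP (pt s i) (bounded_inverse_Wt (ltW t0) ta).
split.
  have := sq2_sum (index_enum 'I_(size s)) (fun i => sq2Z (reC (x 0 i)) (sg i)).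
  congr sq2; apply/funext => z /=; rewrite /comb re_sum; apply: eq_bigr => i _.
  by rewrite [x 0 i * _]mulrC reZ mulrC.
have := sq2_sum (index_enum 'I_(size s)) (fun i => sq2Z (imC (x 0 i)) (sg i)).
congr sq2; apply/funext => z /=; rewrite /comb im_sum; apply: eq_bigr => i _.
by rewrite [x 0 i * _]mulrC imZ mulrC.
Qed.

Lemma opC_perturbed t u n : perturbed f V t u n - rc lam * u n =
  opC (Wt t) u n - rc (t * (if n \in s then V n else 0)) * u n.
Proof.
have rc0 : rc 0 = 0 :> C by exact: (rc_nat 0).
by rewrite perturbed_opC /opC /Wt /q /W; case: (n \in s); rewrite /= !(rcD, rcB, rcM) ?rc0; ring.
Qed.

Lemma opC_inj t u : 0 < t -> t <= alpha -> l2 setT u ->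
  (forall n, opC (Wt t) u n = 0) -> forall n, u n = 0.
Proof.
move=> t0 ta /l2_reim[sr si] u0 n; have [_ _ _ est] := bounded_inverse_Wt (ltW t0) ta.
have zero v : sq2 v -> (forall n, op (Wt t) v n = 0) -> v n = 0.
  move=> sv v0; have := est _ sv; rewrite (_ : op _ v = fun=> 0); last exact/funext.
  have -> : n2 (fun _ : Zd => 0 : R) = 0.
    by rewrite /n2 (@pos_sum_fsupp _ _ _ [::]) ?big_nil// => *; rewrite expr0n.
  rewrite mulr0.
  move=> nv; apply/eqP; rewrite -sqrf_eq0 eq_le sqr_ge0 andbT.
  exact: le_trans (n2_ge_coord n sv) nv.
apply: eq_reim; [apply: (zero (reC \o u)) => // m|apply: (zero (imC \o u)) => // m].
  by rewrite -re_opC u0.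
by rewrite -im_opC u0.
Qed.

(** Birman-Schwinger: (A - t V - lam) u = 0 means that u is the response of
    -Delta + Wt t to the source t V u on s. Then x = t sqrt(V) u, restricted to s,
    is in the kernel of D t, and u is the combination of the modes given by x. *)
Lemma dim_crossing t : 0 < t -> t < alpha ->
  Defs.dim (eigenfunctions [set: Zd] (perturbed f V t) lam%:C%C) =
  ((size s - \rank (D t))%:R)%:E.
Proof.
move=> t0 /ltW ta; have tn0 : t != 0 by rewrite gt_eqF.
have rct : rc t * rc t^-1 = 1 by rewrite -rcM divff// (rc_nat 1).
have sqV i : Num.sqrt (V (pt s i)) * Num.sqrt (V (pt s i)) = V (pt s i).
  by rewrite -expr2 sqr_sqrtr.
have rcV i : rc (V (pt s i)) = rc (Num.sqrt (V (pt s i))) * rc (Num.sqrt (V (pt s i))).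
  by rewrite -rcM sqV.
have sum_at (x : 'rV[C]_(size s)) j :
    \sum_i x 0 i * rc (Num.sqrt (V (pt s i)) * (pt s j == pt s i)%:R) =
    x 0 j * rc (Num.sqrt (V (pt s j))).
  rewrite (bigD1 j)//= eqxx mulr1 big1 ?addr0// => i ij.
  by rewrite (inj_eq (pt_inj us)) eq_sym (negbTE ij) mulr0 (rc_nat 0) mulr0.
have sum_off (x : 'rV[C]_(size s)) z : z \notin s ->
    \sum_i x 0 i * rc (Num.sqrt (V (pt s i)) * (z == pt s i)%:R) = 0.
  move=> zs; rewrite big1// => i _; case: eqVneq => [zi|_]; last by rewrite mulr0 (rc_nat 0) mulr0.
  by move: zs; rewrite zi mem_pt.
apply: (dim_kernel (phi := mode t)) => [x xK x0|x xK|u [lu Tu]].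
- apply/rowP => j; have := toC_DE x j t0 ta; rewrite xK x0 !mxE mulr0 subr0 => E.
  by rewrite -[LHS]mul1r -rct -mulrA -E mulr0.
- split; first exact: l2_modes.
  move=> n; apply/eqP; rewrite -subr_eq0 rcE opC_perturbed opC_modes//; apply/eqP.
  have [/ptP[j ->]|ns] := boolP (n \in s); last first.
    by rewrite sum_off// mulr0 (rc_nat 0) mul0r subr0.
  rewrite sum_at; have := toC_DE x j t0 ta; rewrite xK mxE => E.
  have xj : x 0 j = rc t * (rc (Num.sqrt (V (pt s j))) * comb (mode t) x (pt s j)).
    by rewrite -[LHS]mul1r -rct -mulrA; congr (_ * _); apply/eqP; rewrite -subr_eq0 -E.
  by rewrite xj !rcM rcV; ring.
pose x : 'rV[C]_(size s) := \row_j (rc (t * Num.sqrt (V (pt s j))) * u (pt s j)).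
have uE : u = comb (mode t) x.
  apply/funext => z; apply/eqP; rewrite -subr_eq0; apply/eqP.
  apply: (@opC_inj t (fun z => u z - comb (mode t) x z)) => // [|n].
    have /l2_reim[ru iu] := lu; have /l2_reim[rm im] := l2_modes x t0 ta.
    apply/l2_reim; split.
      by have := sq2B ru rm; congr sq2; apply/funext => n /=; rewrite reD reN.
    by have := sq2B iu im; congr sq2; apply/funext => n /=; rewrite imD imN.
  rewrite opCB opC_modes//.
  have := opC_perturbed t u n; rewrite Tu rcE subrr => /esym/eqP; rewrite subr_eq0 => /eqP ->.
  have [/ptP[j ->]|ns] := boolP (n \in s); last first.
    by rewrite sum_off// mulr0 (rc_nat 0) mul0r subr0.
  by rewrite sum_at mxE !rcM rcV; ring.
exists x => //; apply/rowP => j; rewrite toC_DE// -uE !mxE rcM.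
by rewrite -[rc t * _ * _]mulrA mulrA [rc _^-1 * _]mulrC rct mul1r subrr.
Qed.

Lemma D_qf t x : qf (D t) x = t^-1 * qf 1%:M x - qf (gmx s (Wt t)) (x *m Sd).
Proof. by rewrite /D {1}/qf !bflin -!/(qf _ _) -{2}Sd_tr qf_pull. Qed.

Lemma D_tr t : 0 < t -> t <= alpha -> (D t)^T = D t.
Proof.
move=> t0 ta; rewrite /D linearB/= linearZ/= trmx1 !trmx_mul Sd_tr.
by rewrite (gmx_tr (bounded_inverse_Wt (ltW t0) ta)) mulmxA.
Qed.

Lemma gmx_lipschitz r t x : 0 < r -> r <= t -> t <= alpha ->
  0 <= qf (gmx s (Wt t)) x - qf (gmx s (Wt r)) x <=
  (t - r) * (((e / alpha) ^+ 2 + 1) * (4 * K) / 2 * qf 1%:M x).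
Proof.
move=> r0 rt ta; have t0 := lt_le_trans r0 rt.
have -> : Wt t = fun n => Wt r n - (t - r) * q n by apply/funext => n; rewrite /Wt; ring.
have K0 : 0 < K by case: HW.
apply: gmx_increasing => //.
- exact: bounded_inverse_Wt (ltW r0) (le_trans rt ta).
- have -> : (fun n => Wt r n - (t - r) * q n) = Wt t by apply/funext => n; rewrite /Wt; ring.
  exact: bounded_inverse_Wt (ltW t0) ta.
- by rewrite subr_ge0.
- apply: le_trans Ke; rewrite -mulrA ler_wpM2l//; first by rewrite mulr_ge0// ltW.
  rewrite -exprMn ler_sqr ?nnegrE// ?mulr_ge0 ?subr_ge0 ?divr_ge0 ?invr_ge0 ?(ltW alpha0)//.
  by rewrite mulrCA ler_piMr// ler_pdivrMr// mul1r; lra.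
Qed.

(** D is strictly decreasing, because 1/t is and the Green matrix increases with t;
    it is positive for small t, where 1/t dominates the bounded Green matrix. *)
Theorem crossing_countE : crossing_count f V lam alpha = ((negi (D alpha))%:R)%:E.
Proof.
have K0 : 0 < K by case: HW.
have [C C0 HC] := bf_le_qf1 (Sd *m Sd^T).
have qS x : qf 1%:M (x *m Sd) <= C * qf 1%:M x.
  by have := HC x; rewrite -{1}[Sd in Sd *m _]mulmx1 qf_pull => /ler_normlW.
rewrite /crossing_count.
rewrite (eq_esum (b := fun t => ((size s - \rank (D t))%:R)%:E)); last first.
  by move=> t /andP[t0 ta]; exact: dim_crossing.
apply: crossing_number => //; first exact: D_tr.
- move=> r t x r0 rt ta x0; rewrite !D_qf.
  have /andP[+ _] := gmx_lipschitz (x *m Sd) r0 (ltW rt) ta.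
  have : t^-1 < r^-1 by rewrite ltf_pV2// posrE (lt_trans r0).
  by have := qf1_gt0 x0; nra.
- move=> t eps t0 ta eps0.
  pose L := ((e / alpha) ^+ 2 + 1) * (4 * K) / 2 * C.
  have L0 : 0 <= L by rewrite !mulr_ge0 ?addr_ge0 ?sqr_ge0 ?invr_ge0 ?ltW.
  pose B := 2 / (t * t) + L.
  have tt0 : 0 < t * t by rewrite mulr_gt0.
  have B0 : 0 < B by rewrite ltr_wpDr// divr_gt0.
  exists (Num.min (t / 2) (eps / B)); first by rewrite lt_min !divr_gt0.
  move=> r x r0 ra; rewrite lt_min => /andP[rt1 rt2].
  have rt : t / 2 < r by move: rt1; rewrite ltr_norml => /andP[+ _]; lra.
  rewrite !D_qf; have q0 := qf1_ge0 x.
  apply: (@le_trans _ _ (`|r - t| * B * qf 1%:M x)); last first.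
    rewrite ler_wpM2r//; apply: ltW.
    by rewrite -ltr_pdivlMr.
  have inv : `|r^-1 - t^-1| <= `|r - t| * (2 / (t * t)).
    rewrite (_ : r^-1 - t^-1 = (t - r) * (r^-1 * t^-1)); last first.
      by field; rewrite !gt_eqF.
    rewrite normrM [`|t - r|]distrC ler_wpM2l// ger0_norm; last first.
      by rewrite mulr_ge0 ?invr_ge0 ?ltW.
    have t'0 : 0 <= t^-1 by rewrite invr_ge0 ltW.
    rewrite invfM mulrA; apply: ler_wpM2r => //.
    by rewrite -[leLHS]mul1r ler_pdivrMr// mulrAC ler_pdivlMr// mul1r; lra.
  have gm : `|qf (gmx s (Wt r)) (x *m Sd) - qf (gmx s (Wt t)) (x *m Sd)|
      <= `|r - t| * (L * qf 1%:M x).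
    have c0 : 0 <= ((e / alpha) ^+ 2 + 1) * (4 * K) / 2.
      by rewrite !mulr_ge0 ?addr_ge0 ?sqr_ge0 ?invr_ge0 ?ltW.
    have lip : ((e / alpha) ^+ 2 + 1) * (4 * K) / 2 * qf 1%:M (x *m Sd) <= L * qf 1%:M x.
      by rewrite /L -[leRHS]mulrA; exact: ler_wpM2l.
    have [rlet|/ltW tler] := leP r t.
      have /andP[g0 g1] := gmx_lipschitz (x *m Sd) r0 rlet ta.
      have tr0 : 0 <= t - r by rewrite subr_ge0.
      rewrite distrC (ger0_norm g0) distrC (ger0_norm tr0).
      exact: le_trans g1 (ler_wpM2l tr0 lip).
    have /andP[g0 g1] := gmx_lipschitz (x *m Sd) t0 tler ra.
    have tr0 : 0 <= r - t by rewrite subr_ge0.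
    rewrite (ger0_norm g0) (ger0_norm tr0).
    exact: le_trans g1 (ler_wpM2l tr0 lip).
  set g1 := qf (gmx s (Wt r)) _ in gm *; set g2 := qf (gmx s (Wt t)) _ in gm *.
  rewrite (_ : _ - _ = (r^-1 - t^-1) * qf 1%:M x - (g1 - g2)); last by ring.
  apply: le_trans (ler_normB _ _) _; rewrite normrM (ger0_norm q0).
  by have := ler_wpM2r q0 inv; rewrite /B; lra.
exists (Num.min alpha ((4 * K + 1) / 2 * C)^-1).
  by rewrite lt_min alpha0 invr_gt0 !mulr_gt0 ?invr_gt0 ?addr_gt0 ?mulr_gt0.
move=> r x r0; rewrite lt_min => /andP[_ rB] ra; rewrite D_qf subr_ge0.
have := qf_gmx_le (bounded_inverse_Wt (ltW r0) ra) (x *m Sd) us => /ler_normlW/le_trans; apply.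
have B0 : 0 < (4 * K + 1) / 2 by rewrite divr_gt0// addr_gt0// mulr_gt0.
apply: le_trans (ler_wpM2l (ltW B0) (qS x)) _; rewrite mulrA ler_wpM2r ?qf1_ge0//.
have BC0 : 0 < (4 * K + 1) / 2 * C by exact: mulr_gt0.
set B := _ * C in BC0 rB *; rewrite -[B]invrK lef_pV2 ?posrE ?invr_gt0//.
exact: ltW.
Qed.

Definition bdry (s' : seq Zd) : nat := count (fun z => ~~ all (fun k => z + k \in s') nbr) s'.

Lemma card_pt (P : pred Zd) : #|[pred i | P (pt s i)]| = count P s.
Proof.
rewrite -sum1_card -sum1_count [RHS]big_tnth; apply: eq_bigl => i.
by rewrite inE.
Qed.

(** At a site with all its neighbours in s, the matrix on s and the operator on the
    lattice give the same value on a Green function. So only the rows of boundary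
    sites differ from those of the identity. *)
Lemma opmx_gmx_rank :
  (\rank (opmx s W *m gmx s (Wt alpha) - 1%:M)%R <= bdry s)%N.
Proof.
set M := _ - _; pose P := [pred i | ~~ all (fun k => pt s i + k \in s) nbr].
have -> : M = coordmx P *m M.
  apply/matrixP => i j; rewrite mul_diag_mx !mxE.
  case: (boolP (P i)) => [_|]; first by rewrite mul1r.
  rewrite /= negbK => /allP int; rewrite mul0r.
  have HWa := bounded_inverse_Wt (ltW alpha0) (lexx alpha).
  have [sg og] := greenP (pt s j) HWa.
  set g := green (Wt alpha) (pt s j) in sg og.
  pose g' z := if z \in s then g z else 0.
  apply/eqP; rewrite subr_eq0; apply/eqP.
  transitivity (op W g' (pt s i)).
    rewrite (opE _ _ us); last by move=> z /negbTE zs; rewrite /g' zs.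
    rewrite [RHS]big_tnth; apply: eq_bigr => k _; rewrite !mxE kern_sym.
    by rewrite (green_sym HWa) /g' mem_pt.
  have -> : op W g' (pt s i) = op (Wt alpha) g (pt s i).
    rewrite /op /Wt /q /g' mem_pt mulr0 subr0; congr (- _ + _).
    by rewrite !big_seq; apply: eq_bigr => k /int ->.
  by rewrite og (inj_eq (pt_inj us)).
apply: leq_trans (mxrankM_maxl _ _) _; apply: leq_trans (rank_coordmx _) _.
by rewrite /bdry -card_pt; apply: eq_leq; apply: eq_card => i; rewrite !inE.
Qed.

Lemma crossing_comparison :
  (negi (D alpha) + negi (opmx s W) <=
     negi (opmx s (fun n => W n - alpha * V n)%R) + (bdry s).*2)%N /\
  (negi (opmx s (fun n => W n - alpha * V n)%R) <=
     negi (D alpha) + negi (opmx s W) + (bdry s).*2)%N.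
Proof.
have := schur_comparison (opmx_tr s W) (gmx_tr (bounded_inverse_Wt (ltW alpha0) (lexx alpha)) s)
  Sd_tr (_ : 0 < alpha^-1) opmx_gmx_rank.
rewrite invr_gt0 invrK => /(_ alpha0) /=.
suff -> : opmx s W - alpha *: (Sd *m Sd) = opmx s (fun n => W n - alpha * V n) by [].
apply/matrixP => i j; rewrite /Sd mulmx_diag !mxE /kern -expr2 sqr_sqrtr//.
rewrite (inj_eq (pt_inj us)); case: eqVneq => [->|_]; rewrite ?mulr1n ?mulr0n; ring.
Qed.

End crossing_count_finite.

Arguments bdry {R d} s'.

Section crossing_bounds.
Context {R : realType} {d : nat}.
Local Notation Zd := 'rV[int]_d.

(** The number of crossings is the number of eigenvalues of the restriction to s
    that alpha V pushes below lam, up to the size of the boundary of s. *)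
Theorem crossing_count_bounds (f V : Zd -> R) (lam alpha K e : R) (s : seq Zd) :
  uniq s -> 0 < alpha -> (forall n, 0 <= V n) -> bounded_inverse (fun n => f n - lam) K ->
  (forall n, n \notin s -> alpha * V n <= e) -> 0 <= e -> 4 * K * e ^+ 2 <= 1 ->
  exists N : nat, [/\ crossing_count f V lam alpha = (N%:R)%:E,
    (N + negi (opmx s (fun n => f n - lam)%R) <=
       negi (opmx s (fun n => f n - lam - alpha * V n)%R) + (bdry (R := R) s).*2)%N &
    (negi (opmx s (fun n => f n - lam - alpha * V n)%R) <=
       N + negi (opmx s (fun n => f n - lam)%R) + (bdry (R := R) s).*2)%N].
Proof.
move=> us a0 V0 HW Vout e0 Ke.
have [? ?] := crossing_comparison us a0 V0 HW Vout e0 Ke.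
by eexists; split; [exact: (crossing_countE us a0 V0 HW Vout e0 Ke)|eassumption|eassumption].
Qed.

End crossing_bounds.

(** * Decoupling of cells *)

Section decoupling.
Context {R : realType} {d : nat}.
Local Notation Zd := 'rV[int]_d.
Local Notation nbr := (@nbr R d).
Implicit Types (s : seq Zd) (W : Zd -> R).

Lemma negi_le_size n (H : 'M[R]_n) : (negi H <= n)%N.
Proof. by have [U <- _] := negi_space H; exact: rank_leq_row. Qed.

Definition select s0 s : 'M[R]_(size s0, size s) := \matrix_(i, k) (pt s0 i == pt s k)%:R.

Lemma sum_select s i0 (F : 'I_(size s) -> R) z : uniq s -> pt s i0 = z ->
  \sum_k (z == pt s k)%:R * F k = F i0.
Proof.
move=> us <-; rewrite (bigD1 i0)//= eqxx mul1r big1 ?addr0// => k ki.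
by rewrite (inj_eq (pt_inj us)) eq_sym (negbTE ki) mul0r.
Qed.

Lemma opmx_select s0 s W : uniq s -> {subset s0 <= s} ->
  select s0 s *m opmx s W *m (select s0 s)^T = opmx s0 W.
Proof.
move=> us s0s; apply/matrixP => i j; rewrite !mxE.
have [i' ei] := ptP (s0s _ (mem_pt i)); have [j' ej] := ptP (s0s _ (mem_pt j)).
under eq_bigr do rewrite mulrC [_^T _ _]mxE [select _ _ j _]mxE.
rewrite (sum_select (i0 := j'))// mxE.
under eq_bigr do rewrite [select _ _ i _]mxE.
by rewrite (sum_select (i0 := i'))// mxE ei ej.
Qed.

Lemma select_tr s0 s W : uniq s0 -> uniq s -> {subset s0 <= s} ->
  (select s0 s)^T *m opmx s0 W *m select s0 s =
  coordmx (fun i => pt s i \in s0) *m opmx s W *m coordmx (fun i => pt s i \in s0).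
Proof.
move=> us0 us s0s; apply/matrixP => i j; rewrite coordmx_mulE !mxE.
under eq_bigr do rewrite mulrC [select _ _ _ j]mxE eq_sym.
have [js0|js0] := boolP (pt s j \in s0); last first.
  rewrite mulr0 big1// => k _; case: eqVneq => [jk|_]; last by rewrite mul0r.
  by move: js0; rewrite jk mem_pt.
have [j0 ej] := ptP js0; rewrite (sum_select (i0 := j0))// mxE mulr1.
under eq_bigr do rewrite [_^T _ _]mxE [select _ _ _ i]mxE eq_sym.
have [is0|is0] := boolP (pt s i \in s0); last first.
  rewrite mul0r big1// => k _; case: eqVneq => [ik|_]; last by rewrite mul0r.
  by move: is0; rewrite ik mem_pt.
have [i0 ei] := ptP is0; rewrite (sum_select (i0 := i0))// mxE mul1r.
by rewrite ei ej.
Qed.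

Lemma negi_sub s0 s W : uniq s0 -> uniq s -> {subset s0 <= s} ->
  negi (opmx s0 W) =
  negi (coordmx (fun i => pt s i \in s0) *m opmx s W *m coordmx (fun i => pt s i \in s0)).
Proof.
move=> us0 us s0s; apply/eqP; rewrite eqn_leq -select_tr//; apply/andP; split; last first.
  by have := negi_pull (opmx s0 W) (select s0 s)^T; rewrite trmxK.
rewrite select_tr// -{1}(opmx_select W us s0s).
set E := coordmx _; have -> : select s0 s = select s0 s *m E.
  apply/matrixP => i j; rewrite mul_mx_diag !mxE.
  case: eqVneq => [<-|_]; last by rewrite mul0r.
  by rewrite mem_pt mulr1.
rewrite trmx_mul /E coordmx_tr -/E (_ : _ *m _ *m _ = select s0 s *m (E *m opmx s W *m E) *m (select s0 s)^T).
  exact: negi_pull.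
by rewrite !mulmxA.
Qed.

Definition good (J : finType) (P : J -> pred Zd) (z : Zd) : bool :=
  [exists j, P j z && all (fun k => P j (z + k)) nbr].

(** The matrix on s and the block matrix of the cells have the same entries in the
    rows of good sites, whose neighbours are all in the same cell. *)
Lemma decouple (J : finType) (P : J -> pred Zd) s (sJ : J -> seq Zd) W : uniq s ->
  (forall j, uniq (sJ j)) -> (forall j, {subset sJ j <= s}) ->
  (forall j z, (z \in sJ j) = P j z) ->
  (forall j k z, P j z -> P k z -> j = k) ->
  let b := count (fun z => ~~ good P z) s in
  (negi (opmx s W) <= (\sum_j negi (opmx (sJ j) W)) + b)%N /\
  ((\sum_j negi (opmx (sJ j) W)) <= negi (opmx s W) + b)%N.
Proof.
move=> us usJ sJs sJP Pdisj b.
pose PP j : pred 'I_(size s) := fun i => pt s i \in sJ j.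
pose Hd := \sum_(j <- index_enum J) coordmx (PP j) *m opmx s W *m coordmx (PP j).
have -> : (\sum_j negi (opmx (sJ j) W) = negi Hd)%N.
  rewrite /Hd negi_direct_sum ?opmx_tr ?index_enum_uniq//.
    by apply: eq_bigr => j _; exact: negi_sub.
  by move=> i j k; rewrite /PP !sJP; exact: Pdisj.
pose G := [pred i | good P (pt s i)].
have agree i j : G i -> G j -> opmx s W i j = Hd i j.
  move=> /existsP[l /andP[Pl /allP Pln]] _.
  rewrite summxE (bigD1 l)//= big1 ?addr0; last first.
    move=> m ml; rewrite coordmx_mulE /PP !sJP.
    case: (boolP (P m (pt s i))) => [Pm|]; last by rewrite !mul0r.
    by move: ml; rewrite (Pdisj _ _ _ Pm Pl) eqxx.
  rewrite coordmx_mulE /PP !sJP Pl mul1r.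
  have [Pj|Pj] := boolP (P l (pt s j)); first by rewrite mulr1.
  rewrite mulr0 mxE /kern.
  case: eqVneq => [ij|_]; first by move: Pj; rewrite -ij Pl.
  rewrite mul0r adj_sym adjE; case: (boolP (_ \in _)) => [/Pln|_]; last by rewrite subr0.
  by rewrite addrC subrK (negbTE Pj).
have cb : #|predC G| = b by rewrite /b -card_pt; apply: eq_card => i; rewrite !inE.
split; rewrite -cb; apply: (negi_agree (P := G)) => // i j Gi Gj.
by rewrite agree.
Qed.

Lemma bdry_le_bad (J : finType) (P : J -> pred Zd) s : (forall j z, P j z -> z \in s) ->
  (bdry (R := R) s <= count (fun z => ~~ good P z) s)%N.
Proof.
move=> Ps; apply: sub_count => z; apply: contra => /existsP[j /andP[_ /allP Pj]].
by apply/allP => k kn; apply/Ps/Pj.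
Qed.

Theorem crossing_count_cells (f V : Zd -> R) (lam alpha K e : R) s
    (J : finType) (P : J -> pred Zd) (sJ : J -> seq Zd) :
  uniq s -> 0 < alpha -> (forall n, 0 <= V n) -> bounded_inverse (fun n => f n - lam) K ->
  (forall n, n \notin s -> alpha * V n <= e) -> 0 <= e -> 4 * K * e ^+ 2 <= 1 ->
  (forall j, uniq (sJ j)) -> (forall j, {subset sJ j <= s}) ->
  (forall j z, (z \in sJ j) = P j z) ->
  (forall j k z, P j z -> P k z -> j = k) ->
  let b := count (fun z => ~~ good P z) s in
  exists N : nat, [/\ crossing_count f V lam alpha = (N%:R)%:E,
    (N + \sum_j negi (opmx (sJ j) (fun n => f n - lam)%R) <=
       \sum_j negi (opmx (sJ j) (fun n => f n - lam - alpha * V n)%R) + 4 * b)%N &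
    (\sum_j negi (opmx (sJ j) (fun n => f n - lam - alpha * V n)%R) <=
       N + \sum_j negi (opmx (sJ j) (fun n => f n - lam)%R) + 4 * b)%N].
Proof.
move=> us a0 V0 HW Vout e0 Ke usJ sJs sJP Pd b.
have [N [NE N1 N2]] := crossing_count_bounds us a0 V0 HW Vout e0 Ke.
have bb : (bdry (R := R) s <= b)%N.
  by apply: bdry_le_bad => j z; rewrite -sJP => /sJs.
have [A1 A2] := decouple (fun n => f n - lam) us usJ sJs sJP Pd.
have [B1 B2] := decouple (fun n => f n - lam - alpha * V n) us usJ sJs sJP Pd.
by exists N; split=> //; move: N1 N2 A1 A2 B1 B2 bb; rewrite -/b; clear; lia.
Qed.

End decoupling.

(** * Boxes, cells and walls *)

Section lattice_boxes.
Context {R : realType} {d : nat}.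
Local Notation Zd := 'rV[int]_d.
Local Notation nbr := (@nbr R d).
Implicit Types (s : seq Zd) (a b : 'rV[R]_d).

Definition obox a b : set 'rV[R]_d := [set x | forall i, a 0 i < x 0 i < b 0 i].

(** The ambient cube only serves to have a list to filter. *)
Definition lat a b : seq Zd :=
  [seq z : Zd <- box (Num.truncn (\sum_i (`|a 0 i| + `|b 0 i|))).+1 |
    [forall i, a 0 i < (z 0 i)%:~R < b 0 i]].

Lemma lat_uniq a b : uniq (lat a b).
Proof. by rewrite filter_uniq// box_uniq. Qed.

Lemma mem_lat a b (z : Zd) : reflect (forall i, a 0 i < (z 0 i)%:~R < b 0 i) (z \in lat a b).
Proof.
apply: (iffP idP) => [|zab]; first by rewrite mem_filter => /andP[/forallP].
rewrite mem_filter; apply/andP; split; first exact/forallP.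
apply/mem_box => i; rewrite -(ler_int R) intr_norm -pmulrn.
apply: le_trans (ltW (truncnS_gt _)); rewrite (bigD1 i)//= -addrA.
have /andP[z1 z2] := zab i.
have ra := ler_norm (- a 0 i); have rb := ler_norm (b 0 i); rewrite normrN in ra.
have a0 := normr_ge0 (a 0 i); have b0 := normr_ge0 (b 0 i).
have r0 : 0 <= \sum_(j < d | j != i) (`|a 0 j| + `|b 0 j|).
  by apply: sumr_ge0 => j _; rewrite addr_ge0.
by rewrite ler_norml; apply/andP; split; lra.
Qed.

Lemma embed_obox a b : embed @^-1` obox a b = [set` lat a b].
Proof.
apply/seteqP; split=> z /=.
  by move=> zab; apply/mem_lat => i; have := zab i; rewrite mxE.
by move=> /mem_lat zab i; rewrite mxE.
Qed.

Lemma scale_obox a b (c : R) : 0 < c ->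
  [set c *: y | y in obox a b] = obox (c *: a) (c *: b).
Proof.
move=> c0; apply/seteqP; split=> [_ [y yab <-] i|x xab].
  by rewrite !mxE !ltr_pM2l.
exists (c^-1 *: x); last by rewrite scalerA mulfV ?gt_eqF// scale1r.
by move=> i; have := xab i; rewrite !mxE ltr_pdivlMl// ltr_pdivrMl.
Qed.

Lemma inj_widen_ord n m (nm : (n <= m)%N) : injective (widen_ord nm).
Proof. by move=> x y /(congr1 val) /= /val_inj. Qed.

Lemma prod_count s (lo : 'I_d -> int) (m : 'I_d -> nat) : uniq s ->
  (forall (z : Zd) i, z \in s -> lo i <= z 0 i < lo i + (m i)%:Z) ->
  (size s <= \prod_i m i)%N.
Proof.
move=> us sm; pose M := (\sum_i m i)%N.
have mM i : (m i <= M)%N by rewrite /M (bigD1 i)//= leq_addr.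
pose g (z : Zd) : {ffun 'I_d -> 'I_M.+1} := [ffun i => inord (absz (z 0 i - lo i)%R)].
have ginj : {in s &, injective g}.
  move=> z z' zs zs' /ffunP gz; apply/rowP => i; have := gz i; rewrite !ffunE.
  move=> /(congr1 val) /=; have := mM i; have := sm _ i zs; have := sm _ i zs'.
  move: (z 0 i) (z' 0 i) (lo i) (m i) => x y l n h1 h2 nM.
  by rewrite !inordK; lia.
pose F i := [pred k : 'I_M.+1 | (k < m i)%N].
rewrite -(size_map g s); apply: (@leq_trans #|family F|).
  rewrite cardE; apply: uniq_leq_size; first by rewrite map_inj_in_uniq.
  move=> _ /mapP[z zs ->]; rewrite mem_enum; apply/familyP => i; rewrite inE ffunE.
  have := sm _ i zs; have := mM i; move: (z 0 i) (lo i) (m i) => x l n nM h.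
  by rewrite inordK; lia.
rewrite card_family foldrE big_map enumT; apply: leq_prod => i _.
rewrite -[leqRHS](card_ord (m i)).
rewrite -(fintype.card_image (@inj_widen_ord _ _ (leq_trans (mM i) (leqnSn M)))).
apply: subset_leq_card; apply/fintype.subsetP => k; rewrite inE => km.
apply/fintype.imageP; exists (Ordinal km) => //; exact: val_inj.
Qed.

Lemma lat_size a b : (forall i, a 0 i <= b 0 i) ->
  (size (lat a b))%:R <= \prod_i (b 0 i - a 0 i + 1).
Proof.
move=> ab; pose m i := (Num.truncn (b 0 i - a 0 i)).+1.
apply: (@le_trans _ _ (\prod_i m i)%N%:R).
  rewrite ler_nat; apply: (prod_count (lo := fun i => Num.floor (a 0 i) + 1)) => [|z i].
    exact: lat_uniq.
  move=> /mem_lat/(_ i)/andP[z1 z2].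
  have f1 := floor_le (a 0 i); have f2 := floorD1_gt (a 0 i).
  apply/andP; split.
    by rewrite lezD1 -(ltr_int R); exact: le_lt_trans z1.
  rewrite -(ltr_int R) !intrD -pmulrn; have := truncnS_gt (b 0 i - a 0 i).
  by move: f2; rewrite intrD /m; lra.
rewrite natr_prod; apply: ler_prod => i _; rewrite ler0n/= /m -natr1 lerD2r.
by rewrite truncn_le subr_ge0.
Qed.

Lemma slab_size (c w : R) (i0 : 'I_d) s : 0 <= c -> uniq s ->
  (forall (z : Zd) i, z \in s -> - c < (z 0 i)%:~R < c) ->
  (forall z : Zd, z \in s -> `|(z 0 i0)%:~R - w| <= 1) ->
  (size s)%:R <= 3 * (2 * c + 1) ^+ d.-1.
Proof.
move=> c0 us sc sw.
pose m i := if i == i0 then 3%N else (Num.truncn (2 * c)).+1.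
pose lo i := if i == i0 then Num.ceil (w - 1) else Num.floor (- c) + 1.
apply: (@le_trans _ _ (\prod_i m i)%N%:R).
  rewrite ler_nat; apply: (prod_count (lo := lo)) => // z i zs.
  have /andP[z1 z2] := sc z i zs.
  rewrite /lo /m; case: eqVneq => [->|_].
    have := sw _ zs; rewrite ler_norml => /andP[w1 w2].
    have c1 := ceil_ge (w - 1); have c2 := ceilB1_lt (w - 1).
    apply/andP; split.
      by rewrite ceil_le_int; lra.
    by move: c2; rewrite -(ltr_int R) !intrD mulrNz; lra.
  have f1 := floor_le (- c); have f2 := floorD1_gt (- c).
  apply/andP; split.
    by rewrite lezD1 -(ltr_int R); exact: le_lt_trans z1.
  rewrite -(ltr_int R) !intrD -pmulrn; have := truncnS_gt (2 * c).
  by move: f2; rewrite intrD; lra.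
rewrite natr_prod (bigD1 i0)//= /m eqxx ler_wpM2l//.
rewrite (eq_bigr (fun=> (Num.truncn (2 * c)).+1%:R)); last by move=> i /negbTE ->.
rewrite prodr_const (_ : #|_| = d.-1); last first.
  by rewrite cardC1 card_ord.
rewrite lerXn2r ?nnegrE// ?addr_ge0 ?mulr_ge0//.
by rewrite -natr1 lerD2r truncn_le mulr_ge0.
Qed.

(** The cube of half side k tau is cut into (2k)^d open cells by the hyperplanes
    on which a coordinate equals wall k tau m, with 0 <= m <= 2k. *)
Definition wall (k : nat) (tau : R) (m : nat) : R := tau * (m%:R - k%:R).

Definition cell_lo k (tau : R) (j : {ffun 'I_d -> 'I_k.*2}) : 'rV[R]_d := \row_i wall k tau (j i).
Definition cell_hi k (tau : R) (j : {ffun 'I_d -> 'I_k.*2}) : 'rV[R]_d := \row_i wall k tau (j i).+1.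
Definition cell k (tau : R) (j : {ffun 'I_d -> 'I_k.*2}) : set 'rV[R]_d :=
  obox (cell_lo tau j) (cell_hi tau j).
Definition cell_lat k (tau : R) (j : {ffun 'I_d -> 'I_k.*2}) : seq Zd :=
  lat (cell_lo tau j) (cell_hi tau j).
Definition cube_lat (k : nat) (tau : R) : seq Zd :=
  lat (const_mx (- (k%:R * tau))) (const_mx (k%:R * tau)).

Lemma mem_cell_lat k tau (j : {ffun 'I_d -> 'I_k.*2}) (z : Zd) :
  reflect (forall i, wall k tau (j i) < (z 0 i)%:~R < wall k tau (j i).+1) (z \in cell_lat tau j).
Proof. by apply: (iffP (mem_lat _ _ _)) => h i; have := h i; rewrite !mxE. Qed.

Lemma mem_cube_lat k tau (z : Zd) :
  reflect (forall i, - (k%:R * tau) < (z 0 i)%:~R < k%:R * tau) (z \in cube_lat k tau).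
Proof. by apply: (iffP (mem_lat _ _ _)) => h i; have := h i; rewrite !mxE. Qed.

Lemma wall_mono k tau m n : 0 < tau -> (m <= n)%N -> wall k tau m <= wall k tau n.
Proof. by move=> t0 mn; rewrite /wall ler_pM2l// lerD2r ler_nat. Qed.

Lemma cell_lat_sub k tau (j : {ffun 'I_d -> 'I_k.*2}) : 0 < tau ->
  {subset cell_lat tau j <= cube_lat k tau}.
Proof.
move=> t0 z /mem_cell_lat zj; apply/mem_cube_lat => i; have /andP[z1 z2] := zj i.
have w0 : - (k%:R * tau) = wall k tau 0 by rewrite /wall; ring.
have w1 : k%:R * tau = wall k tau k.*2 by rewrite /wall -mul2n natrM; ring.
rewrite w0 {1}w1; apply/andP; split.
  by apply: le_lt_trans z1; exact: wall_mono.
by apply: lt_le_trans z2 _; apply: wall_mono.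
Qed.

Lemma wall_uniq k tau (x : R) m n : 0 < tau -> wall k tau m < x < wall k tau m.+1 ->
  wall k tau n < x < wall k tau n.+1 -> m = n.
Proof.
move=> t0 /andP[m1 m2] /andP[n1 n2]; apply/eqP; rewrite eqn_leq; apply/andP; split; rewrite leqNgt; apply/negP => mn.
  by have := wall_mono k t0 mn; lra.
by have := wall_mono k t0 mn; lra.
Qed.

Lemma cell_disj k tau (j j' : {ffun 'I_d -> 'I_k.*2}) (x : 'I_d -> R) : 0 < tau ->
  (forall i, wall k tau (j i) < x i < wall k tau (j i).+1) ->
  (forall i, wall k tau (j' i) < x i < wall k tau (j' i).+1) -> j = j'.
Proof.
move=> t0 jx jx'; apply/ffunP => i; apply: val_inj.
exact: (wall_uniq t0 (jx i) (jx' i)).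
Qed.

(** A site at distance more than 1 from all walls lies, with its neighbours, in the
    cell given by the integer parts of its coordinates in units of tau. *)
Lemma not_good_wall k tau (z : Zd) : 0 < tau -> z \in cube_lat k tau ->
  ~~ good (R := R) (fun (j : {ffun 'I_d -> 'I_k.*2}) z => z \in cell_lat tau j) z ->
  exists i : 'I_d, exists m : 'I_k.*2.+1, `|(z 0 i)%:~R - wall k tau m| <= 1.
Proof.
move=> t0 /mem_cube_lat zc; apply: contraNP => /forallNP far.
have far' i (m : 'I_k.*2.+1) : 1 < `|(z 0 i)%:~R - wall k tau m|.
  by rewrite ltNge; apply/negP => h; apply: (far i); exists m.
pose jn i := Num.truncn ((z 0 i)%:~R / tau + k%:R : R).
have jnP i : (jn i < k.*2)%N /\
    wall k tau (jn i) + 1 < (z 0 i)%:~R < wall k tau (jn i).+1 - 1.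
  have /andP[z1 z2] := zc i.
  have t1 : 0 <= (z 0 i)%:~R / tau + k%:R :> R.
    by rewrite -lerBlDr sub0r ler_pdivlMr// mulNr ltW.
  have jlt : (jn i < k.*2)%N.
    rewrite /jn truncn_lt_nat// -mul2n natrM mulr_natl mulr2n ltrD2r.
    by rewrite ltr_pdivrMr.
  split=> //.
  have /andP[j1 j2] := truncn_itv t1.
  have w1 : wall k tau (jn i) <= (z 0 i)%:~R.
    by rewrite /wall mulrC -ler_pdivlMr// lerBlDr.
  have w2 : (z 0 i)%:~R < wall k tau (jn i).+1.
    by rewrite /wall mulrC -ltr_pdivrMr// ltrBrDr.
  have := far' i (Ordinal (leqW jlt)); have := far' i (Ordinal (jlt : (jn i).+1 < k.*2.+1)%N).
  rewrite /= ler0_norm ?subr_le0 1?ltW// => f2; rewrite ger0_norm ?subr_ge0// => f1.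
  by apply/andP; split; lra.
apply/existsP; exists [ffun i => Ordinal (jnP i).1]; apply/andP; split.
  apply/mem_cell_lat => i; rewrite ffunE /=.
  by have [_ /andP[h1 h2]] := jnP i; apply/andP; split; lra.
apply/allP => n nn; apply/mem_cell_lat => i; rewrite ffunE /= mxE intrD.
have : `|n 0 i| <= 1.
  by have := nn; rewrite -[n]subr0 -adjE => /(adj_coord i); rewrite [(0 : Zd) 0 i]mxE !subr0.
rewrite -(ler_int R) intr_norm ler_norml => /andP[n1 n2].
by have [_ /andP[h1 h2]] := jnP i; apply/andP; split; lra.
Qed.

(** There are d (2k+1) walls, and the slab within distance 1 of a wall is at most
    3 sites thick. *)
Lemma bad_count k tau : 0 < tau ->
  (count (fun z => ~~ good (R := R) (fun (j : {ffun 'I_d -> 'I_k.*2}) z => z \in cell_lat tau j) z) (cube_lat k tau))%:R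
  <= (d * k.*2.+1)%:R * (3 * (2 * (k%:R * tau) + 1) ^+ d.-1).
Proof.
move=> t0; set s := cube_lat k tau.
pose near i (m : 'I_k.*2.+1) (z : Zd) : bool := `|(z 0 i)%:~R - wall k tau m| <= 1.
have h1 : (count (fun z => ~~ good (R := R) (fun (j : {ffun 'I_d -> 'I_k.*2}) z => z \in cell_lat tau j) z) s <=
    \sum_(i < d) \sum_m count (near i m) s)%N.
  rewrite -sum1_count big_mkcond/= [leqRHS](_ : _ =
    \sum_(z <- s) \sum_(i < d) \sum_m near i m z)%N; last first.
    rewrite [RHS]exchange_big/=; apply: eq_bigr => i _.
    by rewrite [RHS]exchange_big/=; apply: eq_bigr => m _; rewrite -sum1_count big_mkcond/=; apply: eq_bigr => z _; case: (near _ _ _).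
  rewrite big_seq [leqRHS]big_seq; apply: leq_sum => z zs; case: ifP => // ng.
  have [i [m im]] := not_good_wall t0 zs ng.
  by rewrite (bigD1 i)//= (bigD1 m)//= (_ : near i m z = true) ?add1n.
apply: (@le_trans _ _ (\sum_(i < d) \sum_m count (near i m) s)%N%:R).
  by rewrite ler_nat.
set S := 3 * _; have -> : (d * k.*2.+1)%:R * S = \sum_(i < d) \sum_(m < k.*2.+1) S.
  by rewrite !sumr_const !card_ord -mulrnA mulr_natl mulnC.
rewrite natr_sum; apply: ler_sum => i _; rewrite natr_sum; apply: ler_sum => m _.
rewrite -size_filter.
apply: (slab_size (i0 := i) (w := wall k tau m)).
- by rewrite mulr_ge0// ltW.
- by rewrite filter_uniq// lat_uniq.
- by move=> z l; rewrite mem_filter => /andP[_ /mem_cube_lat].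
- by move=> z; rewrite mem_filter => /andP[].
Qed.

End lattice_boxes.

(** * Lebesgue measure of boxes *)

Section measure_of_boxes.
Context {R : realType}.

Lemma coord_measurable d (i : 'I_d) :
  measurable_fun [set: borel_rV R d] (fun x : borel_rV R d => (x : 'rV[R]_d) 0 i : measurableTypeR R).
Proof.
apply: (measurability _ (measurable_realfun.RGenOpens.measurableE R)).
move=> _ [_ [a [b ->] <-]]; rewrite setTI; apply: sub_sigma_algebra.
have /continuousP := @coord_continuous R 1 d 0 i.
by apply; exact: interval_open.
Qed.

Definition prod_set d (A : 'I_d -> set R) : set (borel_rV R d) :=
  [set x | forall i, A i ((x : 'rV[R]_d) 0 i)].

Lemma prod_set_measurable d (A : 'I_d -> set R) :
  (forall i, measurable (A i)) -> measurable (prod_set A).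
Proof.
move=> mA; have -> : prod_set A = \bigcap_(i in [set: 'I_d])
    ((fun x : borel_rV R d => (x : 'rV[R]_d) 0 i) @^-1` A i).
  by apply/seteqP; split=> x h i; [move=> _; exact: h|exact: h].
apply: fin_bigcap_measurable => [|i _]; first exact: finite_finset.
rewrite -[X in measurable X]setTI.
by apply: (@coord_measurable d i) => //; exact: mA.
Qed.

(** Induction on the dimension, along the construction of the measure. *)
Lemma lebesgue_prod_set d (A : 'I_d -> set R) : (forall i, measurable (A i)) ->
  lebesgue_rV d (prod_set A) = (\prod_(i < d) lebesgue_measure (A i))%E.
Proof.
elim: d A => [|d IH] A mA.
  by rewrite big_ord0 /= diracE mem_set// => -[].
rewrite big_ord_recl -IH; last by move=> i; exact: mA.
have mt : measurable (prod_set (fun i => A (lift ord0 i))).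
  by apply: prod_set_measurable => i; exact: mA.
rewrite -product_measure1E//; last exact: mA.
rewrite /= /lebesgue_rV_step /pushforward; congr (_ _).
apply/seteqP; split=> -[x v] /=.
  move=> h; split=> [|i].
    have := h ord0; rewrite /rV_cons mxE; case: splitP => // k _.
    by rewrite mxE.
  have := h (lift ord0 i); rewrite /rV_cons mxE; case: splitP => [k|k /=].
    by case: k => -[].
  by rewrite /bump/= add1n => -[ik]; congr (A _ (v _ _)); exact/val_inj.
move=> [h0 h] i; rewrite /rV_cons mxE; case: splitP => [k ik|k ik].
  rewrite mxE; rewrite (_ : i = ord0)//; apply: val_inj => /=; rewrite ik.
  by case: k {ik} => -[].
by have := h k; rewrite (_ : lift ord0 k = i)//; apply: val_inj.
Qed.

Lemma lebesgue_obox d (a b : 'rV[R]_d) : (forall i, a 0 i < b 0 i) ->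
  lebesgue_rV d (obox a b) = (\prod_(i < d) (b 0 i - a 0 i))%:E.
Proof.
move=> ab; have -> : obox a b = prod_set (fun i => [set` `]a 0 i, b 0 i[]).
  by apply/seteqP; split=> x h i; have := h i; rewrite /= in_itv.
rewrite lebesgue_prod_set; last by move=> i; exact: measurable_itv.
rewrite -prodEFin; apply: eq_bigr => i _.
by rewrite lebesgue_measure_itv/= lte_fin ab.
Qed.

Lemma lebesgue_cbox d (a b : 'rV[R]_d) : (forall i, a 0 i < b 0 i) ->
  lebesgue_rV d (prod_set (fun i => [set` `[a 0 i, b 0 i]])) =
  (\prod_(i < d) (b 0 i - a 0 i))%:E.
Proof.
move=> ab; rewrite lebesgue_prod_set; last by move=> i; exact: measurable_itv.
rewrite -prodEFin; apply: eq_bigr => i _.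
by rewrite lebesgue_measure_itv/= lte_fin ab.
Qed.

Lemma obox_open d (a b : 'rV[R]_d) : open (obox a b).
Proof.
rewrite openE => x xab.
apply: (@filter_forall _ 'I_d (fun i (y : 'rV[R]_d) => a 0 i < y 0 i < b 0 i) _ (nbhs_filter x)) => i.
have /andP[x1 x2] := xab i; have cx : (fun y : 'rV[R]_d => y 0 i) @ x --> x 0 i := @coord_continuous R 1 d 0 i x.
have n1 := cvgr_gt _ cx _ x1; have n2 := cvgr_lt _ cx _ x2.
by near=> y; apply/andP; split; near: y; [exact: n1|exact: n2].
Unshelve. all: by end_near. Qed.

Lemma closure_obox d (a b : 'rV[R]_d) :
  closure (obox a b) `<=` (prod_set (fun i => [set` `[a 0 i, b 0 i]]) : set 'rV[R]_d).
Proof.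
move=> x xab i /=; rewrite in_itv/=; have cx : (fun y : 'rV[R]_d => y 0 i) @ x --> x 0 i := @coord_continuous R 1 d 0 i x.
apply/andP; split; rewrite leNgt; apply/negP => h.
  have [y [yab /= yi]] := xab _ (cvgr_lt _ cx _ h).
  by have /andP[] := yab i; lra.
have [y [yab /= yi]] := xab _ (cvgr_gt _ cx _ h).
by have /andP[] := yab i; lra.
Qed.

Lemma obox_measurable d (a b : 'rV[R]_d) : measurable (obox a b : set (borel_rV R d)).
Proof. by apply: sub_sigma_algebra; exact: obox_open. Qed.

(** The boundary lies between the open and the closed box, which have the same volume. *)
Lemma density_domain_obox d (a b : 'rV[R]_d) : (forall i, a 0 i < b 0 i) ->
  density_domain (obox a b).
Proof.
move=> ab; split.
- by exists (\row_i ((a 0 i + b 0 i) / 2)) => i; rewrite mxE; have := ab i; lra.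
- exact: obox_open.
- exists (Num.sqrt (\sum_(i < d) (`|a 0 i| + `|b 0 i|) ^+ 2)) => x xab.
  rewrite /enorm ler_sqrt; last by apply: sumr_ge0 => i _; exact: sqr_ge0.
  apply: ler_sum => i _; rewrite -real_normK ?num_real//.
  rewrite lerXn2r ?nnegrE ?addr_ge0//.
  have /andP[h1 h2] := xab i; rewrite ler_norml.
  have := ler_norm (- a 0 i); have := ler_norm (b 0 i); rewrite normrN => b1 a1.
  by have := normr_ge0 (a 0 i); have := normr_ge0 (b 0 i); lra.
have /interior_id -> := @obox_open d a b.
have mc : measurable (prod_set (fun i => [set` `[a 0 i, b 0 i]])).
  by apply: prod_set_measurable => i; exact: measurable_itv.
have ocb : obox a b `<=` prod_set (fun i => [set` `[a 0 i, b 0 i]]).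
  by move=> x h i; rewrite /= in_itv/=; have /andP[h1 h2] := h i; rewrite !ltW.
apply/eqP; rewrite eq_le measure_ge0 andbT.
apply: (@le_trans _ _ (lebesgue_rV d (prod_set (fun i => [set` `[a 0 i, b 0 i]]) `\` obox a b))).
  apply: le_measure; rewrite ?inE.
  - apply: measurableD; last exact: obox_measurable.
    rewrite -[closure _]setCK; apply: measurableC; apply: sub_sigma_algebra.
    apply: closed_openC; exact: closed_closure.
  - by apply: measurableD => //; exact: obox_measurable.
  by apply: setSD; exact: closure_obox.
pose cb : set (borel_rV R d) := prod_set (fun i => [set` `[a 0 i, b 0 i]]).
have fin : (lebesgue_rV d cb < +oo)%E.
  by rewrite lebesgue_cbox// ltry.
have mo := @obox_measurable d a b.
have E : (lebesgue_rV d cb - lebesgue_rV d (obox a b) = 0)%E.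
  by rewrite lebesgue_cbox// lebesgue_obox// -EFinB subrr.
have := measureD mc mo fin; rewrite (setIidr ocb) => D0.
by have -> : lebesgue_rV d (cb `\` obox a b) = 0%E by exact: (etrans D0 E).
Qed.

End measure_of_boxes.

(** * Consequences of the density of states *)

Section density_limits.
Context {R : realType} {d : nat}.
Local Notation Zd := 'rV[int]_d.
Variables (f : Zd -> R) (rho : R -> R).
Hypothesis rho_dos : density_of_states f rho.
Implicit Types (a b : 'rV[R]_d) (W : Zd -> R).

Lemma opmxD s W q : uniq s ->
  opmx s (fun n => W n + q n) = opmx s W + diag_mx (\row_i q (pt s i)).
Proof.
move=> us; apply/matrixP => i j; rewrite !mxE /kern (inj_eq (pt_inj us)).
by case: eqVneq => [->|_]; rewrite ?mulr1n ?mulr0n; ring.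
Qed.

Lemma opmx_shift s W mu : uniq s -> opmx s (fun n => W n - mu) = opmx s W - mu%:M.
Proof.
move=> us; rewrite (opmxD W (fun=> - mu))//; congr (_ + _).
by apply/matrixP => i j; rewrite !mxE mulNrn.
Qed.

Lemma negi_opmx_mono s W W' : uniq s -> (forall z, z \in s -> W z <= W' z) ->
  (negi (opmx s W') <= negi (opmx s W))%N.
Proof.
move=> us WW'; apply: negi_mono => x.
have -> : W' = fun n => W n + (W' n - W n) by apply/funext => n; ring.
rewrite (opmxD W (fun n => W' n - W n))// /qf bfDm lerDl bfE.
apply: sumr_ge0 => i _; rewrite (bigD1 i)//= big1 ?addr0; last first.
  by move=> j ji; rewrite mxE eq_sym (negbTE ji) mulr0n mulr0 mul0r.
rewrite !mxE eqxx mulr1n mulrAC -expr2 mulr_ge0 ?sqr_ge0// subr_ge0.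
by apply: WW'; exact: mem_pt.
Qed.

Definition count_in a b (beta : R) W : nat := negi (opmx (lat (beta *: a) (beta *: b)) W).

Lemma cell_limit a b mu : (forall i, a 0 i < b 0 i) ->
  (fun beta : R => (beta ^+ d)^-1 * (count_in a b beta (fun n => f n - mu))%:R) @ +oo -->
  (\prod_(i < d) (b 0 i - a 0 i)) * rho mu.
Proof.
move=> ab; set v := \prod_(i < d) _.
have v0 : 0 < v by apply: prodr_gt0 => i _; rewrite subr_gt0.
have := @rho_dos mu _ (density_domain_obox ab); rewrite lebesgue_obox//= -/v.
move=> /fine_cvg lim; have FF : Filter (pinfty_nbhs R) by exact: _.
have L := cvgMl_tmp (FF := FF) (a := v) lim.
suff E : \forall beta \near +oo, v * (fine \o (fun beta : R =>
      (eig_count [set beta *: y | y in obox a b] f mu * ((beta ^+ d * v)^-1)%:E)%E)) beta =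
      (beta ^+ d)^-1 * (count_in a b beta (fun n => f n - mu))%:R.
  exact: cvg_trans (near_eq_cvg (FF := FF) E) L.
near=> beta.
have b0 : 0 < beta by near: beta; exact: nbhs_pinfty_gt.
rewrite /= (@scale_obox _ _ a b _ b0).
rewrite (eig_countE f mu (lat_uniq _ _) (@embed_obox _ _ _ _)) /=.
rewrite /count_in opmx_shift ?lat_uniq//; field.
by rewrite !gt_eqF ?exprn_gt0.
Unshelve. all: by end_near. Qed.

Lemma count_in_le_size a b beta W : (forall i, a 0 i <= b 0 i) -> 0 <= beta ->
  (count_in a b beta W)%:R <= \prod_(i < d) (beta * (b 0 i - a 0 i) + 1).
Proof.
move=> ab b0; apply: (@le_trans _ _ (size (lat (beta *: a) (beta *: b)))%:R).
  by rewrite ler_nat negi_le_size.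
apply: le_trans (lat_size _) _; first by move=> i; rewrite !mxE ler_wpM2l.
by rewrite le_eqVlt; apply/orP; left; apply/eqP; apply: eq_bigr => i _; rewrite !mxE mulrBr.
Qed.

Let unit_lt (i : 'I_d) : (0 : 'rV[R]_d) 0 i < (const_mx 1 : 'rV[R]_d) 0 i.
Proof. by rewrite !mxE. Qed.

Let unit_vol : \prod_(i < d) ((const_mx 1 : 'rV[R]_d) 0 i - (0 : 'rV[R]_d) 0 i) = 1.
Proof. by rewrite big1// => i _; rewrite !mxE subr0. Qed.

Lemma rho_mono mu mu' : mu <= mu' -> rho mu <= rho mu'.
Proof.
move=> mm; have := @cell_limit _ _ mu' unit_lt; have := @cell_limit _ _ mu unit_lt.
rewrite unit_vol !mul1r => l1 l2; apply: ler_cvg_to l1 l2 _.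
near=> beta; have b0 : 0 < beta by near: beta; exact: nbhs_pinfty_gt.
apply: ler_wpM2l; first by rewrite invr_ge0 exprn_ge0// ltW.
rewrite ler_nat.
apply: negi_opmx_mono; first exact: lat_uniq.
by move=> z _; rewrite lerD2l lerN2.
Unshelve. all: by end_near. Qed.

Lemma rho_ge0 mu : 0 <= rho mu.
Proof.
have := @cell_limit _ _ mu unit_lt; rewrite unit_vol mul1r => l.
apply: (cvgr_to_ge l); near=> beta.
have b0 : 0 < beta by near: beta; exact: nbhs_pinfty_gt.
by rewrite mulr_ge0// invr_ge0 exprn_ge0// ltW.
Unshelve. all: by end_near. Qed.

Lemma rho_le mu : rho mu <= 2 ^+ d.
Proof.
have := @cell_limit _ _ mu unit_lt; rewrite unit_vol mul1r => l.
apply: (cvgr_to_le l); near=> beta.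
have b1 : 1 <= beta by near: beta; exact: nbhs_pinfty_ge.
have b0 : 0 < beta by lra.
rewrite mulrC ler_pdivrMr ?exprn_gt0// -exprMn.
apply: le_trans (count_in_le_size _ _ (ltW b0)) _; first by move=> i; rewrite ltW.
rewrite -[d in leRHS]card_ord -prodr_const; apply: ler_prod => i _; rewrite !mxE.
by apply/andP; split; lra.
Unshelve. all: by end_near. Qed.

Definition bad_points k (tau : R) : nat :=
  count (fun z => ~~ good (R := R) (fun (j : {ffun 'I_d -> 'I_k.*2}) z => z \in cell_lat tau j) z)
    (cube_lat k tau).

(** The walls have dimension d - 1. *)
Lemma bad_small k (eta eps : R) : (0 < d)%N -> 0 < eta -> 0 < eps ->
  \forall beta \near +oo, (bad_points k (beta * eta))%:R <= eps * beta ^+ d.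
Proof.
move=> d0 eta0 eps0.
pose C := (d * k.*2.+1)%:R * (3 * (2 * (k%:R * eta) + 1) ^+ d.-1) : R.
near=> beta.
have b1 : 1 <= beta by near: beta; exact: nbhs_pinfty_ge.
have b0 : 0 < beta by lra.
have bC : C / eps <= beta by near: beta; apply: nbhs_pinfty_ge; exact: num_real.
apply: le_trans (bad_count _ (mulr_gt0 b0 eta0)) _.
have ke : 0 <= k%:R * eta by rewrite mulr_ge0 // ltW.
have C0 : 0 <= 2 * (k%:R * eta) + 1 by rewrite addr_ge0// mulr_ge0.
have Cb : 0 <= 2 * (k%:R * (beta * eta)) + 1.
  by rewrite addr_ge0// !mulr_ge0// ltW.
apply: (@le_trans _ _ (C * beta ^+ d.-1)).
  rewrite /C -!mulrA -exprMn; do 2 (apply: ler_wpM2l => //).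
  rewrite lerXn2r ?nnegrE//; first by rewrite mulr_ge0// ltW.
  by nra.
have -> : beta ^+ d = beta * beta ^+ d.-1 by rewrite -exprS prednK.
rewrite mulrA; apply: ler_wpM2r; first by rewrite exprn_ge0// ltW.
by rewrite mulrC -ler_pdivrMr.
Unshelve. all: by end_near. Qed.

(** Perturb by the function c on a box and 0 outside. Being at most c everywhere,
    this perturbation produces no crossing at lam: the comparison with the empty
    set of sites bounds the number of crossings by 0. The comparison with the box
    then says that the box has at most as many states between lam and lam + c as
    its boundary allows. *)
Lemma rho_const lam K c : (0 < d)%N -> bounded_inverse (fun n => f n - lam) K ->
  0 <= c -> 4 * K * c ^+ 2 <= 1 -> rho (lam + c) = rho lam.
Proof.
move=> d0 HW c0 Kc; apply/le_anti/andP; split; last by apply: rho_mono; rewrite lerDl.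
pose a : 'rV[R]_d := const_mx (-1); pose b : 'rV[R]_d := const_mx 1.
have ab i : a 0 i < b 0 i by rewrite !mxE; lra.
have v0 : 0 < \prod_(i < d) (b 0 i - a 0 i) by apply: prodr_gt0 => i _; rewrite subr_gt0.
rewrite -(ler_pM2l v0).
have l1 := @cell_limit a b (lam + c) ab.
have l2 := @cell_limit a b lam ab.
apply/ler_addgt0Pr => eps eps0.
have FF : Filter (pinfty_nbhs R) by exact: _.
have l3 := cvgD (FF := FF) l2 (@cvg_cst _ eps _ _ FF).
apply: ler_cvg_to l1 l3 _.
near=> beta.
have b0 : 0 < beta by near: beta; exact: nbhs_pinfty_gt.
have bad : (bad_points 1 (beta * 1))%:R <= eps / 2 * beta ^+ d.
  by near: beta; apply: bad_small => //; lra.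
pose s := lat (beta *: a) (beta *: b); have us : uniq s by exact: lat_uniq.
pose V (n : Zd) : R := if n \in s then c else 0.
have V0 n : 0 <= V n by rewrite /V; case: ifP.
have VS n : n \notin s -> 1 * V n <= c by rewrite /V => /negbTE ->; rewrite mulr0.
have VN n : n \notin [::] -> 1 * V n <= c by rewrite /V mul1r; case: ifP.
have [N [NE _ N2]] := crossing_count_bounds us ltr01 V0 HW VS c0 Kc.
have [N' [NE' N1' _]] := crossing_count_bounds (s := [::]) isT ltr01 V0 HW VN c0 Kc.
have NN : N = N' by move: NE; rewrite NE' => -[/eqP]; rewrite eqr_nat => /eqP.
have N0 : N' = 0%N.
  have := negi_le_size (opmx [::] (fun n => f n - lam - 1 * V n)) => h.
  apply/eqP; rewrite -leqn0; apply: leq_trans (leq_addr _ _) (leq_trans N1' _).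
  by rewrite /bdry /= addn0; exact: h.
have bb : (bdry (R := R) s <= bad_points 1 (beta * 1))%N.
  have -> : s = cube_lat 1 (beta * 1).
    by rewrite /s /cube_lat; congr lat; apply/rowP => i; rewrite !mxE; ring.
  by apply: bdry_le_bad => j z; apply: cell_lat_sub; rewrite mulr1.
have main : (count_in a b beta (fun n => f n - (lam + c))%R <=
    count_in a b beta (fun n => f n - lam)%R + (bad_points 1 (beta * 1)).*2)%N.
  rewrite /count_in -/s; move: N2; rewrite NN N0 add0n => N2.
  apply: leq_trans (_ : negi (opmx s (fun n => f n - lam - 1 * V n)%R) <= _)%N.
    by apply: negi_opmx_mono => // z zs; rewrite /V zs; lra.
  by apply: leq_trans N2 _; rewrite leq_add2l leq_double.
rewrite -[leRHS]/(_ * _ + _) -lerBlDl -mulrBr mulrC ler_pdivrMr ?exprn_gt0//.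
rewrite lerBlDl; move: main; rewrite -(ler_nat R) natrD -mul2n natrM; lra.
Unshelve. all: by end_near. Qed.

End density_limits.

(** * The potential at infinity *)

Section profile.
Context {R : realType} {d : nat}.
Local Notation Zd := 'rV[int]_d.
Local Notation rV := ('rV[R]_d).
Variables (Psi : rV -> R) (p : R).
Hypotheses (p0 : 0 < p) (Psi_cont : {within unit_sphere, continuous Psi}).

(** The extension of Psi that is homogeneous of degree -p. *)
Definition profile (x : rV) : R := Psi ((enorm x)^-1 *: x) * enorm x `^ (- p).

Lemma enorm_ge0 (x : rV) : 0 <= enorm x. Proof. exact: sqrtr_ge0. Qed.

Lemma mx_norm_le_enorm (x : rV) : `|x| <= enorm x.
Proof.
rewrite -[`|x|]/(mx_norm x) mx_normrE; apply: bigmax_le; first exact: enorm_ge0.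
by move=> [i j] _ /=; rewrite ord1 enorm_coord.
Qed.

Lemma enorm_gt0 (x : rV) : x != 0 -> 0 < enorm x.
Proof.
move=> x0; rewrite lt_neqAle enorm_ge0 andbT eq_sym; apply: contra x0 => /eqP x0.
apply/eqP/rowP => i; rewrite mxE; apply/eqP; rewrite -normr_eq0 eq_le normr_ge0 andbT.
by rewrite -x0 enorm_coord.
Qed.

Lemma enormZ (c : R) (x : rV) : 0 <= c -> enorm (c *: x) = c * enorm x.
Proof.
move=> c0; rewrite /enorm; have -> : c = Num.sqrt (c ^+ 2) by rewrite sqrtr_sqr ger0_norm.
rewrite -sqrtrM ?sqr_ge0// sqrtr_sqr ger0_norm//.
congr Num.sqrt; rewrite mulr_sumr; apply: eq_bigr => i _; by rewrite mxE exprMn.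
Qed.

Lemma enorm_normalize (x : rV) : x != 0 -> unit_sphere ((enorm x)^-1 *: x).
Proof.
move=> x0; have e0 := enorm_gt0 x0.
by rewrite /unit_sphere /= enormZ ?mulVf ?gt_eqF// invr_ge0 ltW.
Qed.

Lemma enorm_continuous : continuous (@enorm R d).
Proof.
move=> x; apply: (@continuous_comp _ _ _ (fun x : rV => \sum_(i < d) x 0 i ^+ 2) Num.sqrt); last first.
  exact: sqrt_continuous.
have FF : Filter (nbhs x) := nbhs_filter x.
suff S r : (fun y : rV => \sum_(i <- r) y 0 i ^+ 2) @ nbhs x --> \sum_(i <- r) x 0 i ^+ 2.
  exact: (S (index_enum 'I_d)).
elim: r => [|i r IH].
  by under eq_cvg do rewrite big_nil; rewrite big_nil; exact: cvg_cst.
under eq_cvg do rewrite big_cons; rewrite big_cons; apply: (cvgD (FF := FF)) IH.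
have c := @coord_continuous R 1 d 0 i x.
by rewrite expr2; under eq_cvg do rewrite expr2; exact: (cvgM (FF := FF) c c).
Qed.

Lemma powR_continuous (q x : R) : 0 < x -> {for x, continuous (fun y : R => y `^ q)}.
Proof.
move=> x0; apply: differentiable_continuous; apply/derivable1_diffP.
by apply: derivable_powR; rewrite in_itv/= x0.
Qed.

Lemma near_neq0 (x : rV) : x != 0 -> \forall y \near x, y != 0.
Proof.
move=> /enorm_gt0 e0; have := @enorm_continuous x => /cvgr_gt /(_ _ e0).
by apply: filterS => y; apply: contraTneq => ->; rewrite enorm0 ltxx.
Qed.

Lemma direction_continuous (x : rV) : x != 0 ->
  (fun y : rV => Psi ((enorm y)^-1 *: y)) @ nbhs x --> Psi ((enorm x)^-1 *: x).
Proof.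
move=> x0; have e0 := enorm_gt0 x0.
have ec := @enorm_continuous x.
have FF : Filter (nbhs x) := nbhs_filter x.
have nc : (fun y : rV => (enorm y)^-1 *: y) @ x --> (enorm x)^-1 *: x.
  apply: (cvgZ (FF := FF)); last exact: cvg_id.
  by apply: (cvgV (FF := FF)) => //; rewrite gt_eqF.
have /subspace_continuousP/(_ _ (enorm_normalize x0)) Pc := Psi_cont.
move=> U /Pc; rewrite /within /= => /nc.
apply: filterS2 (near_neq0 x0) => y y0; apply.
exact: enorm_normalize.
Qed.

Lemma profile_continuous (x : rV) : x != 0 -> {for x, continuous profile}.
Proof.
move=> x0; have e0 := enorm_gt0 x0.
have ec := @enorm_continuous x.
have FF : Filter (nbhs x) := nbhs_filter x.
have pc := @continuous_comp _ _ _ (@enorm R d) (fun y => y `^ (- p)) x ec (@powR_continuous _ _ e0).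
by apply: (cvgM (FF := FF)); [exact: direction_continuous|exact: pc].
Qed.

Lemma profile0 : profile 0 = 0.
Proof. by rewrite /profile enorm0 powR0 ?mulr0// oppr_eq0 gt_eqF. Qed.

Lemma Psi_bounded : exists2 M, 0 < M & forall x, unit_sphere x -> `|Psi x| <= M.
Proof.
have cs : compact (unit_sphere : set rV).
  apply: bounded_closed_compact.
    exists 1; split; first exact: num_real.
    move=> r r1 x xs /=; apply: le_trans (mx_norm_le_enorm _) _.
    by rewrite xs ltW.
  have -> : (unit_sphere : set rV) = (@enorm R d) @^-1` [set 1] by [].
  apply: preimage_closed; last exact: closed_eq.
  by move=> x _; exact: enorm_continuous.
have [M [_ HM]] := compact_bounded (continuous_compact Psi_cont cs).
exists (Num.max M 0 + 1); first by rewrite ltr_wpDl// le_max lexx orbT.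
move=> x xs; apply: (HM (Num.max M 0 + 1)).
  by rewrite ltr_pwDr// le_max lexx.
by exists x.
Qed.

Lemma profile_decay : exists2 M, 0 < M & forall c x, 0 < c -> c <= enorm x ->
  `|profile x| <= M * c `^ (- p).
Proof.
have [M M0 HM] := Psi_bounded; exists M => // c x c0 cx.
have x0 : x != 0 by apply: contraTneq cx => ->; rewrite enorm0 -ltNge.
rewrite normrM ler_pM//; first exact/HM/enorm_normalize.
rewrite ger0_norm ?powR_ge0// !powRN lef_pV2 ?posrE ?powR_gt0//; last exact: enorm_gt0.
by apply: ge0_ler_powR; rewrite ?nnegrE ?enorm_ge0// ltW.
Qed.

(** Uniform continuity near the compact shell that contains x; the point y may be
    slightly outside of it. *)
Lemma profile_oscillation (r0 r1 del : R) : 0 < r0 -> 0 < del ->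
  exists2 eta, 0 < eta & forall x y : rV, r0 <= enorm x -> enorm x <= r1 ->
    (forall i, `|x 0 i - y 0 i| < eta) -> `|profile x - profile y| < del.
Proof.
move=> r00 del0.
pose K : set rV := [set x | r0 <= enorm x /\ enorm x <= r1].
have cK : compact K.
  apply: bounded_closed_compact.
    exists `|r1|; split; first exact: num_real.
    move=> r r1r x [_ xr1] /=; apply: le_trans (mx_norm_le_enorm _) _.
    by apply: le_trans xr1 (le_trans (ler_norm _) (ltW r1r)).
  have -> : K = (@enorm R d) @^-1` `[r0, r1].
    by apply/seteqP; split=> x /=; rewrite in_itv/=; [move=> [-> ->]|move=> /andP[]].
  apply: preimage_closed; last exact: itv_closed.
  by move=> x _; exact: enorm_continuous.
have /compact_near_coveringP/(_ R 0^'+ (fun eta x => forall y : rV,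
    (forall i, `|x 0 i - y 0 i| < eta) -> `|profile x - profile y| < del)) := cK.
case.
  move=> x [xr0 _]; have x0 : x != 0 by apply: contraTneq xr0 => ->; rewrite enorm0 -ltNge.
  have /cvgr_dist_lt/(_ (del / 2)) := profile_continuous x0.
  have del2 : 0 < del / 2 by lra.
  move=> /(_ del2) /nbhs_ballP[e /= e0 He].
  have e2 : 0 < e / 2 by lra.
  exists (ball x (e / 2), [set eta | 0 < eta < e / 2]) => /=.
    split; first exact: nbhsx_ballx.
    near=> eta; apply/andP; split; near: eta; first exact: nbhs_right_gt.
    exact: nbhs_right_lt.
  move=> [x' eta] /= [[_ xx'] /andP[eta0 etae]] y x'y.
  have b1 : ball x e x'.
    split=> // i j; have := xx' i j; rewrite /ball/=; lra.
  have b2 : ball x e y.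
    split=> // i j; have := xx' i j; rewrite /ball/= (ord1 i) => h.
    have := x'y j; have := ler_distD (x' 0 j) (x 0 j) (y 0 j); lra.
  have := He _ b1; have := He _ b2.
  have := ler_distD (profile x) (profile x') (profile y); rewrite (distrC (profile x') (profile x)).
  lra.
move=> eta0 /= eta00 Heta; exists (eta0 / 2); first by lra.
move=> x y xr0 xr1; apply: (Heta (eta0 / 2)) => //=.
- by rewrite sub0r normrN gtr0_norm; lra.
- by lra.
Unshelve. all: by end_near. Qed.

End profile.

(** * The rescaled potential and integrals over cells *)

Section potential_profile.
Context {R : realType} {d : nat}.
Local Notation Zd := 'rV[int]_d.
Local Notation rV := ('rV[R]_d).
Variables (V : Zd -> R) (Psi : rV -> R) (p : R).
Hypotheses (p0 : 0 < p) (Psi_cont : {within unit_sphere, continuous Psi}).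
Hypotheses (V_ge0 : forall n, 0 <= V n) (V_asymp : asymptotic_potential V Psi p).

Lemma normalizeZ (c : R) (x : rV) : 0 < c -> (enorm (c *: x))^-1 *: (c *: x) = (enorm x)^-1 *: x.
Proof.
move=> c0; rewrite enormZ ?ltW// scalerA invfM mulrAC mulVf ?mul1r// gt_eqF//.
Qed.

(** The directions of lattice points are dense in the sphere, and V is nonnegative. *)
Lemma Psi_ge0 (x : rV) : unit_sphere x -> 0 <= Psi x.
Proof.
move=> xs; have x0 : x != 0.
  by apply/eqP => x0; move: xs; rewrite /unit_sphere/= x0 enorm0 => /eqP; rewrite eq_sym oner_eq0.
rewrite leNgt; apply/negP => Px.
have dc := direction_continuous Psi_cont x0; rewrite xs invr1 scale1r in dc.
have n1 : \forall y \near x, Psi ((enorm y)^-1 *: y) < Psi x / 2.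
  by apply: (cvgr_lt _ dc); lra.
have n2 : \forall y \near x, 2^-1 < enorm y.
  by apply: (cvgr_gt _ (@enorm_continuous _ _ x)); rewrite xs; lra.
have [e /= e0 He] := (nbhs_ballP x _).1 (filterI n1 n2).
have [r Hr] := V_asymp (eps := - Psi x / 2) ltac:(lra).
pose k : R := (Num.truncn (Num.max (e^-1) (2 * `|r|))).+1%:R.
have kmax : Num.max (e^-1) (2 * `|r|) < k by exact: truncnS_gt.
have ke : e^-1 < k by apply: le_lt_trans kmax; rewrite le_max lexx.
have kr : 2 * `|r| < k by apply: le_lt_trans kmax; rewrite le_max lexx orbT.
have k0 : 0 < k by rewrite ltr0n.
pose n : Zd := \row_i Num.floor (k * x 0 i).
have [|b1 b2] := He (k^-1 *: embed n).
  split=> // i j; rewrite /ball/= (ord1 i) !mxE.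
  have := floor_le (k * x 0 j); have := floorD1_gt (k * x 0 j); rewrite intrD => f1 f2.
  rewrite -(ltr_pM2l k0) -{1}(gtr0_norm k0) -normrM mulrBr mulrA mulfV ?gt_eqF// mul1r.
  have k1 : 1 < k * e by rewrite -ltr_pdivrMr// div1r.
  by rewrite ger0_norm; lra.
have ki : 0 < k^-1 by rewrite invr_gt0.
rewrite normalizeZ// in b1; rewrite enormZ ?ltW// ltr_pdivlMl// in b2.
have rn : r < enorm (embed n).
  by apply: le_lt_trans b2; have := ler_norm r; lra.
have := Hr _ rn; rewrite ltr_norml => /andP[_].
have : 0 <= enorm (embed n) `^ p * V n by rewrite mulr_ge0 ?powR_ge0.
lra.
Qed.

Lemma profile_ge0 (x : rV) : 0 <= profile Psi p x.
Proof.
have [->|x0] := eqVneq x 0; first by rewrite profile0.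
by rewrite mulr_ge0 ?powR_ge0//; apply/Psi_ge0/enorm_normalize.
Qed.

(** The asymptotics at n = beta x, divided by |x|^p, which is at least r0^p. *)
Lemma potential_scaling (r0 del : R) : 0 < r0 -> 0 < del ->
  \forall beta \near +oo, forall n : Zd, r0 <= enorm (beta^-1 *: embed n) ->
    `|beta `^ p * V n - profile Psi p (beta^-1 *: embed n)| <= del.
Proof.
move=> r00 del0; have r0p : 0 < r0 `^ p by exact: powR_gt0.
have [r Hr] := V_asymp (eps := del * r0 `^ p) (mulr_gt0 del0 r0p).
near=> beta => n rn.
have b0 : 0 < beta by near: beta; exact: nbhs_pinfty_gt.
have br : r / r0 < beta by near: beta; apply: nbhs_pinfty_gt; exact: num_real.
set x := beta^-1 *: embed n in rn *.
have bi : 0 < beta^-1 by rewrite invr_gt0.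
have nx : embed n = beta *: x by rewrite /x scalerA mulfV ?gt_eqF// scale1r.
have en : enorm (embed n) = beta * enorm x by rewrite nx enormZ// ltW.
have ex : 0 < enorm x by exact: lt_le_trans rn.
have rb : r < enorm (embed n).
  rewrite en; apply: lt_le_trans (_ : beta * r0 <= _); last by rewrite ler_wpM2l// ltW.
  by rewrite -ltr_pdivrMr.
have := Hr _ rb; rewrite nx normalizeZ// -nx en powRM ?(ltW b0) ?(ltW ex)// => h.
rewrite /profile powRN.
have xp : 0 < enorm x `^ p by exact: powR_gt0.
have -> : beta `^ p * V n - Psi ((enorm x)^-1 *: x) * (enorm x `^ p)^-1 =
    (beta `^ p * enorm x `^ p * V n - Psi ((enorm x)^-1 *: x)) / enorm x `^ p.
  by field; rewrite gt_eqF.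
rewrite normrM [`|_^-1|]gtr0_norm ?invr_gt0// ler_pdivrMr//.
apply: le_trans (ltW h) _; apply: ler_wpM2l; first exact: ltW.
by apply: ge0_ler_powR => //; rewrite ?nnegrE ltW.
Unshelve. all: by end_near. Qed.

(** The profile is continuous off the origin, and a point is a Borel set. *)
Lemma profile_measurable :
  measurable_fun [set: borel_rV R d] (profile Psi p : borel_rV R d -> measurableTypeR R).
Proof.
apply: (measurability _ (measurable_realfun.RGenOpens.measurableE R)).
move=> _ [_ [a [b ->] <-]]; rewrite setTI.
have m0 : measurable ([set 0] : set (borel_rV R d)).
  rewrite -[[set 0]]setCK; apply: measurableC; apply: sub_sigma_algebra.
  by apply: closed_openC; apply: accessible_closed_set1; apply: hausdorff_accessible; exact: norm_hausdorff.
rewrite -[X in measurable X](setUIDK _ [set 0]).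
apply: measurableU.
  have [h|h] := pselect (`]a, b[%classic (profile Psi p 0)).
    rewrite (_ : _ `&` _ = [set 0])//; apply/seteqP; split=> x; first by case.
    by move=> -> ; split.
  rewrite (_ : _ `&` _ = set0)//; apply/seteqP; split=> x // -[h1 /= x0].
  by apply: h; rewrite -x0.
suff : open (profile Psi p @^-1` `]a, b[%classic `\` [set 0] : set rV).
  exact: sub_sigma_algebra.
rewrite openE => x [h /= /eqP x0].
have pc := profile_continuous Psi_cont x0.
have o : nbhs (profile Psi p x) `]a, b[%classic by apply: open_nbhs_nbhs; split=> //; exact: interval_open.
have h1 : \forall y \near x, `]a, b[%classic (profile Psi p y) := pc p _ o.
have FF : Filter (nbhs x) := nbhs_filter x.
have h2 := near_neq0 x0.
suff : \forall y \near x, (profile Psi p @^-1` `]a, b[%classic `\` [set 0]) y by [].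
by near=> y; split; [near: y; exact: h1|apply/eqP; near: y; exact: h2].
Unshelve. all: by end_near.
Qed.

End potential_profile.

Section integral_over_cells.
Context {R : realType} {d : nat}.
Local Notation mu := (lebesgue_rV d : {sigma_finite_measure set (borel_rV R d) -> \bar R}).
Variables (k : nat) (eta : R) (g : borel_rV R d -> R).
Hypotheses (eta0 : 0 < eta) (k0 : (0 < k)%N).
Hypothesis g_meas : measurable_fun [set: borel_rV R d] (g : borel_rV R d -> measurableTypeR R).
Hypothesis g_ge0 : forall x, 0 <= g x.
Hypothesis g_supp : forall x : 'rV[R]_d, ~ obox (const_mx (- (k%:R * eta))) (const_mx (k%:R * eta)) x -> g x = 0.
Local Notation J := {ffun 'I_d -> 'I_k.*2}.

Lemma cell_lt (j : J) i : cell_lo eta j 0 i < cell_hi eta j 0 i.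
Proof. by rewrite !mxE /wall ltr_pM2l// -natr1; lra. Qed.

Lemma cell_vol (j : J) : \prod_(i < d) (cell_hi eta j 0 i - cell_lo eta j 0 i) = eta ^+ d.
Proof.
rewrite (eq_bigr (fun=> eta)) ?prodr_const ?card_ord// => i _.
by rewrite !mxE /wall -natr1; ring.
Qed.

Lemma lebesgue_cell (j : J) : lebesgue_rV d (cell eta j) = (eta ^+ d)%:E.
Proof. by rewrite lebesgue_obox ?cell_vol//; exact: cell_lt. Qed.

Lemma cell_measurable (j : J) : measurable (cell eta j : set (borel_rV R d)).
Proof. exact: obox_measurable. Qed.

Let cube : set (borel_rV R d) := obox (const_mx (- (k%:R * eta))) (const_mx (k%:R * eta)).
Let cells : set (borel_rV R d) := \big[setU/set0]_(j <- index_enum J) cell eta j.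

Lemma trivIset_cells : trivIset [set` index_enum J] (fun j : J => cell eta j : set (borel_rV R d)).
Proof.
move=> j j' _ _ [x [xj xj']]; apply: (@cell_disj _ _ k eta j j' (x 0)) => // i.
  by have := xj i; rewrite !mxE.
by have := xj' i; rewrite !mxE.
Qed.

Lemma cell_sub_cube (j : J) : cell eta j `<=` cube.
Proof.
move=> x xj i; have /andP[x1 x2] := xj i; move: x1 x2; rewrite !mxE => x1 x2.
have w0 : - (k%:R * eta) = wall k eta 0 by rewrite /wall; ring.
have w1 : k%:R * eta = wall k eta k.*2 by rewrite /wall -mul2n natrM; ring.
rewrite w0 w1; apply/andP; split.
  by apply: le_lt_trans x1; exact: wall_mono.
by apply: lt_le_trans x2 _; exact: wall_mono.
Qed.

(** The walls are negligible, since the open cells have the volume of the cube in total. *)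
Lemma integral_cells :
  (\int[mu]_x (g x)%:E = \sum_(j : J) \int[mu]_(x in cell eta j) (g x)%:E)%E.
Proof.
have mcube : measurable cube by exact: obox_measurable.
have mcells : measurable cells by apply: bigsetU_measurable => j _; exact: cell_measurable.
have mg (D : set (borel_rV R d)) : measurable_fun D (EFin \o g).
  by apply: measurable_funTS; exact/measurable_EFinP.
have sub : cells `<=` cube.
  rewrite /cells; elim/big_ind : _ => [//|A B hA hB|j _]; last exact: cell_sub_cube.
  by rewrite subUset.
have vcube : lebesgue_rV d cube = ((2 * (k%:R * eta)) ^+ d)%:E.
  rewrite lebesgue_obox; last by move=> i; rewrite !mxE; have := mulr_gt0 (_ : 0 < k%:R) eta0; rewrite ltr0n => /(_ k0); lra.
  congr EFin; rewrite (eq_bigr (fun=> 2 * (k%:R * eta))) ?prodr_const ?card_ord// => i _.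
  by rewrite !mxE; ring.
have vcells : lebesgue_rV d cells = ((2 * (k%:R * eta)) ^+ d)%:E.
  have one (A : set (borel_rV R d)) : measurable A -> (\int[mu]_(x in A) cst 1 x = lebesgue_rV d A)%E.
    by move=> mA; rewrite integral_cst// mul1e.
  rewrite -(one _ mcells) /cells.
  transitivity (\sum_(j <- index_enum J) \int[mu]_(x in cell eta j) cst 1 x)%E.
    apply: ge0_integral_bigsetU => //; first by move=> j; exact: cell_measurable.
    - exact: index_enum_uniq.
    - exact: trivIset_cells.
  rewrite (eq_bigr (fun=> (eta ^+ d)%:E)); last first.
    by move=> j _; rewrite one; [exact: lebesgue_cell|exact: cell_measurable].
  rewrite sumEFin; congr EFin; rewrite sumr_const card_ffun !card_ord -mul2n.
  by rewrite -[LHS]mulr_natl natrX -exprMn natrM; congr (_ ^+ _); ring.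
have null : lebesgue_rV d (cube `\` cells) = 0%E.
  have fin : (lebesgue_rV d cube < +oo)%E by rewrite vcube ltry.
  have := measureD mcube mcells fin; rewrite (setIidr sub) => D0.
  apply: (etrans D0); have : (lebesgue_rV d cube - lebesgue_rV d cells = 0)%E.
    by rewrite vcube vcells -EFinB subrr.
  by [].
have -> : (\int[mu]_x (g x)%:E = \int[mu]_(x in cube) (g x)%:E)%E.
  rewrite [RHS]integral_mkcond; apply: eq_integral => x _.
  rewrite /patch; case: ifPn => //; rewrite notin_setE => /g_supp ->.
  by [].
rewrite (ge0_negligible_integral (N := cube `\` cells))//; last 2 first.
- exact: measurableD.
- by move=> x _; rewrite lee_fin.
rewrite setDD (setIidr sub).
apply: ge0_integral_bigsetU.
- by move=> j; exact: cell_measurable.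
- exact: index_enum_uniq.
- exact: trivIset_cells.
- exact: mg.
by move=> x _; rewrite lee_fin.
Qed.

Lemma integral_cells_bounds (lo hi : J -> R) : (forall j, 0 <= lo j) ->
  (forall j x, cell eta j x -> lo j <= g x <= hi j) ->
  exists I : R, [/\ (\int[mu]_x (g x)%:E = I%:E)%E,
    eta ^+ d * \sum_j lo j <= I & I <= eta ^+ d * \sum_j hi j].
Proof.
move=> lo0 lh.
have mg (D : set (borel_rV R d)) : measurable_fun D (EFin \o g).
  by apply: measurable_funTS; exact/measurable_EFinP.
have low : ((eta ^+ d * \sum_j lo j)%:E <= \int[mu]_x (g x)%:E)%E.
  rewrite integral_cells mulr_sumr -sumEFin; apply: lee_sum => j _.
  rewrite mulrC EFinM -(lebesgue_cell j) -(integral_cst mu); last exact: cell_measurable.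
  apply: ge0_le_integral => //; first exact: cell_measurable.
  - by move=> x _; rewrite lee_fin.
  by move=> x /lh/andP[h _]; rewrite lee_fin.
have upp : (\int[mu]_x (g x)%:E <= (eta ^+ d * \sum_j hi j)%:E)%E.
  rewrite integral_cells mulr_sumr -sumEFin; apply: lee_sum => j _.
  rewrite mulrC EFinM -(lebesgue_cell j) -(integral_cst mu); last exact: cell_measurable.
  apply: ge0_le_integral => //; first exact: cell_measurable.
  - by move=> x _; rewrite lee_fin.
  by move=> x /lh/andP[_ h]; rewrite lee_fin.
exists (fine (\int[mu]_x (g x)%:E)).
have E : (\int[mu]_x (g x)%:E = (fine (\int[mu]_x (g x)%:E))%:E)%E.
  rewrite fineK// fin_numElt; apply/andP; split.
    by apply: lt_le_trans low; rewrite ltNyr.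
  by apply: le_lt_trans upp _; rewrite ltry.
by split=> //; rewrite -lee_fin -E.
Qed.

End integral_over_cells.

(** * Counting cell by cell *)

Section count_by_cells.
Context {R : realType} {d : nat}.
Local Notation Zd := 'rV[int]_d.
Variables (f V : Zd -> R) (rho : R -> R) (lam K e : R).
Hypotheses (d0 : (0 < d)%N) (rho_dos : density_of_states f rho).
Hypotheses (V_ge0 : forall n, 0 <= V n) (HW : bounded_inverse (fun n => f n - lam) K).
Hypotheses (e0 : 0 <= e) (Ke : 4 * K * e ^+ 2 <= 1).
Variables (k : nat) (eta : R) (a : R -> R).
Hypotheses (eta0 : 0 < eta).
Hypothesis a_gt0 : \forall beta \near +oo, 0 < a beta.
Hypothesis tail : \forall beta \near +oo,
  forall n, n \notin cube_lat k (beta * eta) -> a beta * V n <= e.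
Local Notation J := {ffun 'I_d -> 'I_k.*2}.
(* A selects the cells on which lam + a beta V is compared with a constant mu j;
   the others will be those close to the origin. *)
Variables (A : pred J) (mu : J -> R).

Let cnt (j : J) beta W := count_in (cell_lo eta j) (cell_hi eta j) beta W.

Lemma cell_latE (beta : R) (j : J) :
  cell_lat (beta * eta) j = lat (beta *: cell_lo eta j) (beta *: cell_hi eta j).
Proof. by congr lat; apply/rowP => i; rewrite !mxE /wall mulrA. Qed.

Let D beta : R := \sum_(j | A j) ((cnt j beta (fun n => f n - mu j))%:R - (cnt j beta (fun n => f n - lam))%:R).

Lemma cells_limit :
  (fun beta : R => (beta ^+ d)^-1 * D beta) @ +oo -->
  eta ^+ d * \sum_(j | A j) (rho (mu j) - rho lam).
Proof.
have FF : Filter (pinfty_nbhs R) by exact: _.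
rewrite mulr_sumr.
have -> : (fun beta : R => (beta ^+ d)^-1 * D beta) = (fun beta : R => \sum_(j | A j)
    ((beta ^+ d)^-1 * (cnt j beta (fun n => f n - mu j))%:R -
    (beta ^+ d)^-1 * (cnt j beta (fun n => f n - lam))%:R)).
  by apply/funext => beta; rewrite /D mulr_sumr; apply: eq_bigr => j _; rewrite mulrBr.
apply: cvg_big => [|j _]; first exact: add_continuous.
rewrite mulrBr; apply: (cvgB (FF := FF)).
  by rewrite -(cell_vol eta j); apply: cell_limit => // i; exact: cell_lt.
by rewrite -(cell_vol eta j); apply: cell_limit => // i; exact: cell_lt.
Qed.

Lemma crossing_count_sum (eps : R) : 0 < eps -> \forall beta \near +oo, exists2 N : nat,
  crossing_count f V lam (a beta) = N%:R%:E &
  `|N%:R - \sum_(j : J) ((cnt j beta (fun n => f n - lam - a beta * V n))%:R -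
     (cnt j beta (fun n => f n - lam))%:R)| <= eps * beta ^+ d.
Proof.
move=> eps0; near=> beta.
have b0 : 0 < beta by near: beta; exact: nbhs_pinfty_gt.
have ab : 0 < a beta by near: beta; exact: a_gt0.
have tl n : n \notin cube_lat k (beta * eta) -> a beta * V n <= e by move: n; near: beta; exact: tail.
have bad : (bad_points (d := d) k (beta * eta))%:R <= eps / 4 * beta ^+ d.
  by near: beta; apply: bad_small => //; lra.
have be : 0 < beta * eta by exact: mulr_gt0.
have [N [NE N1 N2]] := crossing_count_cells (P := fun (j : J) z => z \in cell_lat (beta * eta) j)
  (sJ := fun j : J => cell_lat (beta * eta) j) (lat_uniq _ _) ab V_ge0 HW tl e0 Ke
  (fun j => lat_uniq _ _) (fun j => @cell_lat_sub _ _ _ _ j be) (fun _ _ => erefl)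
  (fun j j' z => fun h h' => cell_disj be (elimT (mem_cell_lat _ _ _) h) (elimT (mem_cell_lat _ _ _) h')).
exists N => //; rewrite -/(bad_points _ _) in N1 N2.
have E W : (\sum_(j : J) negi (opmx (cell_lat (beta * eta) j) W) = \sum_(j : J) cnt j beta W)%N.
  by apply: eq_bigr => j _; rewrite cell_latE.
rewrite !E in N1 N2; rewrite sumrB -!natr_sum.
rewrite -(ler_nat R) 2!natrD natrM in N1; rewrite -(ler_nat R) 2!natrD natrM in N2.
rewrite ler_norml; apply/andP; split; lra.
Unshelve. all: by end_near. Qed.

(** A cell outside A contributes at most its number of sites, which is at most
    (2 beta eta)^d as soon as beta eta >= 1. *)
Lemma crossing_count_le (eps : R) : 0 < eps ->
  (\forall beta \near +oo, forall j n, A j -> n \in cell_lat (beta * eta) j ->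
     lam + a beta * V n <= mu j) ->
  \forall beta \near +oo, exists2 N : nat, crossing_count f V lam (a beta) = N%:R%:E &
    N%:R <= beta ^+ d * (eta ^+ d * \sum_(j | A j) (rho (mu j) - rho lam)
                         + #|predC A|%:R * (2 * eta) ^+ d + eps).
Proof.
move=> eps0 up; near=> beta.
have b0 : 0 < beta by near: beta; exact: nbhs_pinfty_gt.
have bd : 0 < beta ^+ d by exact: exprn_gt0.
have be : eta^-1 <= beta by near: beta; apply: nbhs_pinfty_ge; exact: num_real.
have be1 : 1 <= beta * eta by rewrite -ler_pdivrMr// div1r.
have upb j n : A j -> n \in cell_lat (beta * eta) j -> lam + a beta * V n <= mu j.
  by move: j n; near: beta.
have : exists2 N : nat, crossing_count f V lam (a beta) = N%:R%:E &
  `|N%:R - \sum_(j : J) ((cnt j beta (fun n => f n - lam - a beta * V n))%:R -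
     (cnt j beta (fun n => f n - lam))%:R)| <= eps / 2 * beta ^+ d.
  by near: beta; apply: crossing_count_sum; lra.
case=> N NE; rewrite ler_norml => /andP[_ N1]; exists N => //.
have lim : (beta ^+ d)^-1 * D beta <= eta ^+ d * \sum_(j | A j) (rho (mu j) - rho lam) + eps / 2.
  by near: beta; apply: (cvgr_le _ cells_limit); lra.
rewrite mulrC ler_pdivrMr// in lim.
move: N1; rewrite lerBlDr (bigID A)/= => N1.
have sA : \sum_(j | A j) ((cnt j beta (fun n => f n - lam - a beta * V n))%:R -
     (cnt j beta (fun n => f n - lam))%:R) <= D beta.
  rewrite /D; apply: ler_sum => j Aj; rewrite lerD2r ler_nat.
  apply: negi_opmx_mono; first exact: lat_uniq.
  by move=> z zj; rewrite -cell_latE in zj; have := upb j z Aj zj; lra.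
have sC : \sum_(j | ~~ A j) ((cnt j beta (fun n => f n - lam - a beta * V n))%:R -
     (cnt j beta (fun n => f n - lam))%:R) <= #|predC A|%:R * (2 * eta) ^+ d * beta ^+ d.
  rewrite -mulrA -exprMn mulr_natl -sumr_const.
  apply: ler_sum => j _; rewrite lerBlDr ler_wpDr//.
  apply: le_trans (count_in_le_size _ _ (ltW b0)) _; first by move=> i; rewrite ltW// cell_lt.
  rewrite -[d in leRHS]card_ord -prodr_const; apply: ler_prod => i _; rewrite !mxE /wall -natr1.
  by apply/andP; split; nra.
move: N1 sA sC lim; lra.
Unshelve. all: by end_near. Qed.

(** A cell outside A contributes a nonnegative number, since V is nonnegative. *)
Lemma crossing_count_ge (eps : R) : 0 < eps ->
  (\forall beta \near +oo, forall j n, A j -> n \in cell_lat (beta * eta) j ->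
     mu j <= lam + a beta * V n) ->
  \forall beta \near +oo, exists2 N : nat, crossing_count f V lam (a beta) = N%:R%:E &
    beta ^+ d * (eta ^+ d * \sum_(j | A j) (rho (mu j) - rho lam) - eps) <= N%:R.
Proof.
move=> eps0 up; near=> beta.
have b0 : 0 < beta by near: beta; exact: nbhs_pinfty_gt.
have bd : 0 < beta ^+ d by exact: exprn_gt0.
have ab : 0 < a beta by near: beta; exact: a_gt0.
have upb j n : A j -> n \in cell_lat (beta * eta) j -> mu j <= lam + a beta * V n.
  by move: j n; near: beta.
have : exists2 N : nat, crossing_count f V lam (a beta) = N%:R%:E &
  `|N%:R - \sum_(j : J) ((cnt j beta (fun n => f n - lam - a beta * V n))%:R -
     (cnt j beta (fun n => f n - lam))%:R)| <= eps / 2 * beta ^+ d.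
  by near: beta; apply: crossing_count_sum; lra.
case=> N NE; rewrite ler_norml => /andP[N1 _]; exists N => //.
have lim : eta ^+ d * \sum_(j | A j) (rho (mu j) - rho lam) - eps / 2 <= (beta ^+ d)^-1 * D beta.
  by near: beta; apply: (cvgr_ge _ cells_limit); lra.
rewrite [leRHS]mulrC ler_pdivlMr// in lim.
move: N1; rewrite lerBrDr (bigID A)/= => N1.
have sA : D beta <= \sum_(j | A j) ((cnt j beta (fun n => f n - lam - a beta * V n))%:R -
     (cnt j beta (fun n => f n - lam))%:R).
  rewrite /D; apply: ler_sum => j Aj; rewrite lerD2r ler_nat.
  apply: negi_opmx_mono; first exact: lat_uniq.
  by move=> z zj; rewrite -cell_latE in zj; have := upb j z Aj zj; lra.
have sC : 0 <= \sum_(j | ~~ A j) ((cnt j beta (fun n => f n - lam - a beta * V n))%:R -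
     (cnt j beta (fun n => f n - lam))%:R :> R).
  apply: sumr_ge0 => j _; rewrite subr_ge0 ler_nat.
  apply: negi_opmx_mono; first exact: lat_uniq.
  by move=> z _; have := mulr_ge0 (ltW ab) (V_ge0 z); lra.
move: N1 sA sC lim; lra.
Unshelve. all: by end_near. Qed.

End count_by_cells.

(** * A partition adapted to the profile *)

Section partition.
Context {R : realType} {d : nat}.
Local Notation Zd := 'rV[int]_d.
Local Notation rV := ('rV[R]_d).
Variables (Psi : rV -> R) (p : R).
Hypotheses (d0 : (0 < d)%N) (p0 : 0 < p) (Psi_cont : {within unit_sphere, continuous Psi}).

Definition near_cell k q : pred {ffun 'I_d -> 'I_k.*2} :=
  fun j => [forall i, (k - q <= j i < k + q)%N].

Lemma near_cell_card k q : (#|near_cell (k := k) q| <= (q.*2) ^ d)%N.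
Proof.
pose S : {pred 'I_k.*2} := [pred m : 'I_k.*2 | (k - q <= m < k + q)%N].
have -> : #|near_cell (k := k) q| = #|@ffun_on 'I_d S|.
  apply: eq_card => j; rewrite [LHS]/(near_cell q j).
  by apply/forallP/ffun_onP.
rewrite card_ffun_on card_ord; case: d d0 => // d' _; rewrite leq_exp2r//.
have -> : #|S| = size (map val (enum S)) by rewrite size_map -cardE.
apply: leq_trans (_ : size (iota (k - q) (k + q - (k - q))) <= _)%N; last first.
  by rewrite size_iota; lia.
apply: uniq_leq_size; first by rewrite map_inj_uniq ?enum_uniq//; exact: val_inj.
move=> m /mapP[x]; rewrite mem_enum inE => /andP[x1 x2] ->.
by rewrite mem_iota x1/=; lia.
Qed.

Lemma enorm_cube (x : rV) (C : R) : 0 < C -> ~ obox (const_mx (- C)) (const_mx C) x ->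
  C <= enorm x.
Proof.
move=> C0 xC; have [i ] : exists i, ~ (- C < x 0 i < C).
  by apply/existsNP => h; apply: xC => i; rewrite !mxE.
rewrite -ltr_norml => /negP; rewrite -leNgt => h.
by apply: le_trans h _; exact: enorm_coord.
Qed.

(** The profile is at most e outside the cube of half side C. The cells inside the
    cube of half side r0 = C / l are given up, with l so large that even 2^d times
    their volume is small. The side eta = r0 / q of the cells is below the modulus
    of continuity of the profile on the shell that remains. *)
Lemma partition_exists (e del eps : R) : 0 < e -> 0 < del -> 0 < eps ->
  exists k eta (A : pred {ffun 'I_d -> 'I_k.*2}) (r0 : R),
  [/\ (0 < k)%N, 0 < eta & 0 < r0] /\
  [/\ forall x, ~ obox (const_mx (- (k%:R * eta))) (const_mx (k%:R * eta)) x ->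
        profile Psi p x <= e,
      forall j x, A j -> cell eta j x -> r0 <= enorm x,
      forall j x y, A j -> cell eta j x -> cell eta j y ->
        `|profile Psi p x - profile Psi p y| <= del &
      #|predC A|%:R * (2 * eta) ^+ d <= eps].
Proof.
move=> e0 del0 eps0; have [M M0 HM] := profile_decay p0 Psi_cont.
pose C : R := (e / M) `^ (- p^-1).
have C0 : 0 < C by rewrite powR_gt0// divr_gt0.
have MC : M * C `^ (- p) = e.
  by rewrite /C -powRrM mulrNN mulVf ?gt_eqF// powRr1 ?divr_ge0 ?ltW// mulrC divfK// gt_eqF.
pose l := (Num.truncn (4 * C / Num.min eps 1)).+1.
have m0 : 0 < Num.min eps 1 by rewrite lt_min eps0 ltr01.
have l0 : 0 < l%:R :> R by rewrite ltr0n.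
have lC : 4 * C / l%:R <= Num.min eps 1.
  have := truncnS_gt (4 * C / Num.min eps 1); rewrite -/l ltr_pdivrMr// => h.
  by rewrite ler_pdivrMr // [leRHS]mulrC; exact: ltW.
pose r0 := C / l%:R; have r00 : 0 < r0 by rewrite divr_gt0.
pose r1 : R := Num.sqrt (\sum_(i < d) C ^+ 2).
have [w w0 Hw] := profile_oscillation p Psi_cont r1 r00 del0.
pose q := (Num.truncn (r0 / w)).+1.
have q0 : 0 < q%:R :> R by rewrite ltr0n.
have qw : r0 / q%:R <= w.
  have := truncnS_gt (r0 / w); rewrite -/q ltr_pdivrMr// => h.
  by rewrite ler_pdivrMr // [leRHS]mulrC; exact: ltW.
pose k := (q * l)%N; pose eta : R := r0 / q%:R.
have kE : k%:R * eta = C by rewrite /k /eta /r0 natrM; field; rewrite !gt_eqF.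
have qE : q%:R * eta = r0 by rewrite /eta; field; rewrite gt_eqF.
have eta0 : 0 < eta by rewrite divr_gt0.
have far j x : ~~ near_cell (k := k) q j -> cell eta j x -> r0 <= enorm x.
  move=> /forallPn[i ji] xj; apply: le_trans (enorm_coord x i).
  have := xj i; rewrite !mxE => /andP[x1 x2].
  move: ji; rewrite negb_and -!ltnNge ltnS => /orP[ji|ji].
    have : wall k eta (j i).+1 <= - r0.
      apply: le_trans (wall_mono k eta0 ji) _.
      by rewrite /wall natrB ?leq_pmulr// -qE; lra.
    by rewrite ler_normr => h; apply/orP; right; lra.
  have : r0 <= wall k eta (j i).
    by apply: le_trans (wall_mono k eta0 ji); rewrite /wall natrD -qE; lra.
  by rewrite ler_normr => h; apply/orP; left; lra.
exists k, eta, (fun j => ~~ near_cell q j), r0; split; first by split=> //; rewrite muln_gt0.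
split.
- move=> x; rewrite kE => /(enorm_cube C0) Cx.
  by apply: le_trans (ler_norm _) _; rewrite -MC; exact: HM.
- exact: far.
- move=> j x y Aj xj yj; apply/ltW/Hw; first exact: far xj.
    rewrite /r1 /enorm ler_wsqrtr//; apply: ler_sum => i _.
    have := cell_sub_cube eta0 xj i; rewrite kE !mxE -ltr_norml => h.
    by rewrite -[x 0 i ^+ 2]real_normK ?num_real//; apply: lerXn2r; rewrite ?nnegrE//; exact: ltW.
  move=> i; have := xj i; have := yj i; rewrite !mxE /wall -natr1 => /andP[y1 y2] /andP[x1 x2].
  rewrite ltr_norml; apply/andP; split; move: qw; rewrite -/eta; lra.
- have -> : #|predC (fun j => ~~ near_cell (k := k) q j)| = #|near_cell (k := k) q|.
    by apply: eq_card => j; rewrite !inE negbK.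
  apply: (@le_trans _ _ ((4 * C / l%:R) ^+ d)).
    have -> : 4 * C / l%:R = q.*2%:R * (2 * eta).
      by rewrite -mul2n natrM mulrACA qE /r0; ring.
    rewrite [leRHS]exprMn -natrX; apply: ler_wpM2r; first by rewrite exprn_ge0// mulr_ge0// ltW.
    by rewrite ler_nat near_cell_card.
  have h0 : 0 <= 4 * C / l%:R by rewrite divr_ge0// ?ltW// mulr_gt0.
  move: lC; rewrite le_min => /andP[h1 h2].
  apply: le_trans h1; rewrite -[leRHS]expr1; exact: ler_wiXn2l.
Qed.

End partition.

(** * Upper and lower asymptotics *)

Section asymptotics.
Context {R : realType} {d : nat}.
Local Notation Zd := 'rV[int]_d.
Local Notation rV := ('rV[R]_d).
Local Notation leb := (lebesgue_rV d : {sigma_finite_measure set (borel_rV R d) -> \bar R}).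
Variables (f V : Zd -> R) (rho : R -> R) (Psi : rV -> R) (p lam K : R).
Hypotheses (d0 : (0 < d)%N) (p0 : 0 < p) (rho_dos : density_of_states f rho).
Hypotheses (Psi_cont : {within unit_sphere, continuous Psi}).
Hypotheses (V_ge0 : forall n, 0 <= V n) (V_asymp : asymptotic_potential V Psi p).
Hypothesis HW : bounded_inverse (fun n => f n - lam) K.

Local Notation h := (profile Psi p).
Local Notation g := (limit_density rho Psi p lam).

Lemma limit_densityE x : g x = rho (lam + h x) - rho lam. Proof. by []. Qed.

Let h_ge0 x : 0 <= h x. Proof. exact: profile_ge0 Psi_cont V_ge0 V_asymp x. Qed.

Lemma limit_density_ge0 x : 0 <= g x.
Proof. by rewrite limit_densityE subr_ge0; apply: (rho_mono rho_dos); rewrite lerDl. Qed.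

Lemma limit_density_le x : g x <= 2 ^+ d.
Proof.
rewrite limit_densityE; have := rho_le rho_dos (lam + h x); have := rho_ge0 rho_dos lam; lra.
Qed.

Lemma limit_density_measurable :
  measurable_fun [set: borel_rV R d] (g : borel_rV R d -> measurableTypeR R).
Proof.
have m1 : measurable_fun [set: measurableTypeR R]
    (fun y : R => rho (lam + y) - rho lam : measurableTypeR R).
  apply: nondecreasing_measurable => // x y xy.
  by rewrite lerD2r; apply: (rho_mono rho_dos); rewrite lerD2l.
exact: (measurableT_comp m1 (profile_measurable p Psi_cont)).
Qed.

(* A perturbation of size e keeps lam outside the spectrum. *)
Let e : R := (4 * `|K| + 1)^-1.
Let k40 : 0 < 4 * `|K| + 1. Proof. by have := normr_ge0 K; lra. Qed.
Let e0 : 0 < e. Proof. by rewrite invr_gt0. Qed.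
Let Ke : 4 * K * e ^+ 2 <= 1.
Proof.
have e1 : e <= 1 by rewrite invf_le1//; have := normr_ge0 K; lra.
have ee : e * (4 * `|K| + 1) = 1 by rewrite mulVf// gt_eqF.
have := ler_norm K; have := normr_ge0 K; have := e0; nra.
Qed.

Let gap_const c : 0 <= c -> c <= e -> rho (lam + c) = rho lam.
Proof.
move=> c0 ce; apply: (rho_const rho_dos d0 HW c0).
have c2 : c ^+ 2 <= e ^+ 2 by rewrite lerXn2r ?nnegrE// ltW.
have [K0|K0] := leP K 0.
  by apply: le_trans (_ : 0 <= 1) => //; rewrite mulr_le0_ge0 ?sqr_ge0//; lra.
by apply: le_trans Ke; rewrite ler_pM2l// mulr_gt0.
Qed.

Lemma limit_density_support x : h x <= e -> g x = 0.
Proof. by move=> he; rewrite limit_densityE gap_const// subrr. Qed.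

Let scaled_cell k (eta beta : R) (j : {ffun 'I_d -> 'I_k.*2}) (n : Zd) : 0 < beta ->
  n \in cell_lat (beta * eta) j -> cell eta j (beta^-1 *: embed n).
Proof.
move=> b0 /mem_cell_lat nj i; have := nj i; rewrite !mxE /wall -!mulrA.
by rewrite mulrC ltr_pdivlMl// ltr_pdivrMl// mulrC.
Qed.

Let scaled_cube k (eta beta : R) (n : Zd) : 0 < beta ->
  n \notin cube_lat k (beta * eta) ->
  ~ obox (const_mx (- (k%:R * eta))) (const_mx (k%:R * eta)) (beta^-1 *: embed n).
Proof.
move=> b0 /negP nj xc; apply: nj; apply/mem_cube_lat => i; have := xc i; rewrite !mxE.
rewrite ltr_pdivlMl// ltr_pdivrMl// => /andP[h1 h2]; apply/andP; split; nra.
Qed.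

(* One partition serves both estimates; H j is the value of the profile at the
   centre of the cell j. *)
Let setup (kappa del eps : R) : 0 < kappa -> kappa <= 2 -> 0 < del -> del <= e / 4 -> 0 < eps ->
  exists k eta (A : pred {ffun 'I_d -> 'I_k.*2}) (H : {ffun 'I_d -> 'I_k.*2} -> R),
  [/\ (0 < k)%N, 0 < eta & forall j, 0 <= H j] /\
  [/\ forall x : rV, ~ obox (const_mx (- (k%:R * eta))) (const_mx (k%:R * eta)) x -> g x = 0,
      \forall beta \near +oo, forall n, n \notin cube_lat k (beta * eta) ->
        kappa * beta `^ p * V n <= e,
      forall j x, A j -> cell eta j x -> `|h x - H j| <= del,
      \forall beta \near +oo, forall j n, A j -> n \in cell_lat (beta * eta) j ->
        `|kappa * beta `^ p * V n - kappa * H j| <= 4 * del &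
      #|predC A|%:R * (2 * eta) ^+ d <= eps].
Proof.
move=> kp0 kp2 del0 dele eps0; have e4 : 0 < e / 4 by have := e0; lra.
have [k [eta [A [r0 [[k0 eta0 r00] [Hout Hr Hosc Hcard]]]]]] :=
  partition_exists d0 p0 Psi_cont e4 del0 eps0.
pose c (j : {ffun 'I_d -> 'I_k.*2}) : rV := 2^-1 *: (cell_lo eta j + cell_hi eta j).
have cc j : cell eta j (c j).
  move=> i; have := @cell_lt _ _ k _ eta0 j i.
  have -> : c j 0 i = 2^-1 * (cell_lo eta j 0 i + cell_hi eta j 0 i) by rewrite /c mxE [X in _ * X]mxE.
  by move=> ?; apply/andP; split; lra.
exists k, eta, A, (fun j => h (c j)); split=> //; split=> //.
- by move=> x /Hout hx; apply: limit_density_support; have := e0; lra.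
- have C0 : 0 < k%:R * eta by rewrite mulr_gt0// ltr0n.
  have sc := potential_scaling p0 V_asymp C0 e4.
  near=> beta => n nc.
  have b0 : 0 < beta by near: beta; exact: nbhs_pinfty_gt.
  have scb : forall n : Zd, k%:R * eta <= enorm (beta^-1 *: embed n) ->
    `|beta `^ p * V n - h (beta^-1 *: embed n)| <= e / 4 by near: beta; exact: sc.
  have xc := scaled_cube b0 nc.
  have := scb n (enorm_cube C0 xc); have := Hout _ xc; rewrite ler_norml => h1 /andP[_ h2].
  have v0 : 0 <= beta `^ p * V n by rewrite mulr_ge0 ?powR_ge0.
  by rewrite -mulrA; have := e0; nra.
- by move=> j x Aj xj; exact: Hosc (cc j).
have sc := potential_scaling p0 V_asymp r00 del0.
near=> beta => j n Aj nj.
have b0 : 0 < beta by near: beta; exact: nbhs_pinfty_gt.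
have scb : forall n : Zd, r0 <= enorm (beta^-1 *: embed n) ->
  `|beta `^ p * V n - h (beta^-1 *: embed n)| <= del by near: beta; exact: sc.
have xj := scaled_cell b0 nj.
have := scb n (Hr _ _ Aj xj); have := Hosc _ _ _ Aj xj (cc j).
rewrite -mulrA -mulrBr normrM (gtr0_norm kp0) => h1 h2.
have h3 : `|beta `^ p * V n - h (c j)| <= 2 * del.
  have -> : 2 * del = del + del by ring.
  have tri (x y z r s : R) : `|x - y| <= r -> `|y - z| <= s -> `|x - z| <= r + s.
    by move=> xy yz; apply: le_trans (ler_distD y x z) _; exact: lerD.
  exact: tri h2 h1.
apply: le_trans (ler_wpM2l (ltW kp0) h3) _; rewrite mulrA ler_wpM2r ?(ltW del0)//.
by rewrite (_ : 4 = 2 * 2) ?ler_pM2r//; ring.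
Unshelve. all: by end_near. Qed.

Let I : R := fine (\int[leb]_x (g x)%:E).

(** The integrand is bounded, and vanishes where the profile is small because rho
    is constant in the gap. *)
Lemma limit_density_integrable :
  leb.-integrable [set: borel_rV R d] (fun x => (g x)%:E) /\
  (\int[leb]_x (g x)%:E = I%:E)%E.
Proof.
have [k [eta [A [H [[k0 eta0 H0] [Hout _ _ _ _]]]]]] :=
  @setup 1 (e / 4) 1 ltr01 ltac:(lra) ltac:(have := e0; lra) (lexx _) ltr01.
have [J [JE _ _]] := integral_cells_bounds eta0 k0 limit_density_measurable limit_density_ge0 Hout
  (lo := fun=> 0) (hi := fun=> 2 ^+ d) (fun _ => lexx 0)
  (fun j x _ => introT andP (conj (limit_density_ge0 x) (limit_density_le x))).
split; last by rewrite /I JE.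
apply/integrableP; split; last first.
  rewrite (eq_integral (fun x => (g x)%:E)); last first.
    by move=> x _; rewrite /= ger0_norm//; exact: limit_density_ge0.
  by rewrite JE ltry.
apply/measurable_EFinP; exact: limit_density_measurable.
Qed.

Let I_E : (\int[leb]_x (g x)%:E = I%:E)%E := limit_density_integrable.2.

Let a_gt0 kappa : 0 < kappa -> \forall beta \near +oo, 0 < kappa * beta `^ p.
Proof.
by move=> kp0; near=> beta; rewrite mulr_gt0// powR_gt0//; near: beta; exact: nbhs_pinfty_gt.
Unshelve. all: by end_near. Qed.

(** As rho may jump, the uncertainty on h is compensated by kappa < 1: one has
    kappa h + 4 del <= h - del unless h is small, and then rho does not vary. *)
Lemma crossing_count_upper (kappa eps : R) : 0 < kappa -> kappa < 1 -> 0 < eps ->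
  \forall beta \near +oo, exists2 N : nat,
    crossing_count f V lam (kappa * beta `^ p) = N%:R%:E & N%:R <= beta ^+ d * (I + eps).
Proof.
move=> kp0 kp1 eps0.
(* The comparison of kappa (H j) + 4 del with h x uses 9 del <= (1 - kappa) e. *)
pose del := (1 - kappa) * e / 10.
have ke : 0 < (1 - kappa) * e by rewrite mulr_gt0// subr_gt0.
have del0 : 0 < del by rewrite divr_gt0.
have del4 : del <= e / 4 by rewrite /del; have := mulr_gt0 kp0 e0; have := e0; lra.
have eps2 : 0 < eps / 2 by lra.
have [k [eta [A [H [[k0 eta0 H0] [Hout tail Hosc HV Hcard]]]]]] :=
  @setup kappa del (eps / 2) kp0 ltac:(lra) del0 del4 eps2.
pose mu j := lam + (kappa * H j + 4 * del).
have low j x : cell eta j x -> (if A j then rho (mu j) - rho lam else 0) <= g x <= 2 ^+ d.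
  move=> xj; rewrite limit_density_le andbT; case: ifP => [Aj|_]; last exact: limit_density_ge0.
  rewrite limit_densityE lerD2r.
  have := Hosc j x Aj xj; rewrite ler_norml => /andP[h1 h2].
  have m0 : 0 <= kappa * H j + 4 * del by apply: addr_ge0; apply: mulr_ge0 => //; exact: ltW.
  have [c1|c1] := leP (kappa * H j + 4 * del) e.
    by rewrite /mu (gap_const m0 c1); apply: (rho_mono rho_dos); rewrite lerDl.
  apply: (rho_mono rho_dos); rewrite /mu lerD2l.
  have : 10 * del = (1 - kappa) * e by rewrite /del; lra.
  have := H0 j; nra.
have lo0 j : 0 <= (if A j then rho (mu j) - rho lam else 0).
  case: ifP => // _; rewrite subr_ge0; apply: (rho_mono rho_dos); rewrite /mu lerDl.
  by apply: addr_ge0; apply: mulr_ge0 => //; exact: ltW.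
have [J [JE J1 _]] := integral_cells_bounds eta0 k0 limit_density_measurable limit_density_ge0 Hout
  lo0 low.
have JI : J = I by move: JE; rewrite I_E => -[].
rewrite JI -big_mkcond/= in J1.
have up : \forall beta \near +oo, forall j n, A j -> n \in cell_lat (beta * eta) j ->
    lam + kappa * beta `^ p * V n <= mu j.
  near=> beta => j n Aj nj.
  have hv : forall j n, A j -> n \in cell_lat (beta * eta) j ->
    `|kappa * beta `^ p * V n - kappa * H j| <= 4 * del by near: beta; exact: HV.
  by have := hv j n Aj nj; rewrite ler_norml /mu => /andP[_ h1]; lra.
have main := crossing_count_le d0 rho_dos V_ge0 HW (ltW e0) Ke eta0 (a_gt0 kp0) tail eps2 up.
near=> beta.
have b0 : 0 < beta by near: beta; exact: nbhs_pinfty_gt.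
have : exists2 N : nat, crossing_count f V lam (kappa * beta `^ p) = N%:R%:E &
    N%:R <= beta ^+ d * (eta ^+ d * \sum_(j | A j) (rho (mu j) - rho lam)
                         + #|predC A|%:R * (2 * eta) ^+ d + eps / 2) by near: beta; exact: main.
move=> [N NE N1]; exists N => //; apply: le_trans N1 _.
by apply: ler_wpM2l; [rewrite exprn_ge0// ltW|lra].
Unshelve. all: by end_near. Qed.

(** Now kappa > 1 makes room: kappa h - 4 del >= h + del unless h is small. *)
Lemma crossing_count_lower (kappa eps : R) : 1 < kappa -> kappa <= 2 -> 0 < eps ->
  \forall beta \near +oo, exists2 N : nat,
    crossing_count f V lam (kappa * beta `^ p) = N%:R%:E & beta ^+ d * (I - eps) <= N%:R.
Proof.
move=> kp1 kp2 eps0; have kp0 : 0 < kappa by lra.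
(* The comparison of kappa (H j) - 4 del with h x uses 6 del <= (kappa - 1) e. *)
pose del := (kappa - 1) * e / 10.
have ke : 0 < (kappa - 1) * e by rewrite mulr_gt0// subr_gt0.
have del0 : 0 < del by rewrite divr_gt0.
have del4 : del <= e / 4 by rewrite /del; have := e0; nra.
have eps2 : 0 < eps / 2 by lra.
have [k [eta [A [H [[k0 eta0 H0] [Hout tail Hosc HV Hcard]]]]]] :=
  @setup kappa del (eps / 2) kp0 kp2 del0 del4 eps2.
pose mu j := lam + Num.max 0 (kappa * H j - 4 * del).
have mu_lam j : rho lam <= rho (mu j).
  by apply: (rho_mono rho_dos); rewrite /mu lerDl le_max lexx.
have upp j x : cell eta j x -> 0 <= g x <= (if A j then rho (mu j) - rho lam else 2 ^+ d).
  move=> xj; rewrite limit_density_ge0/=; case: ifP => [Aj|_]; last exact: limit_density_le.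
  have := Hosc j x Aj xj; rewrite ler_norml => /andP[h1 h2].
  have [c1|c1] := leP (h x) e; first by rewrite limit_density_support// subr_ge0.
  rewrite limit_densityE lerD2r; apply: (rho_mono rho_dos); rewrite /mu lerD2l le_max.
  apply/orP; right.
  have : 10 * del = (kappa - 1) * e by rewrite /del; lra.
  have := H0 j; nra.
have [J [JE _ J2]] := integral_cells_bounds eta0 k0 limit_density_measurable limit_density_ge0 Hout
  (fun j => lexx 0) upp.
have JI : J = I by move: JE; rewrite I_E => -[].
rewrite JI in J2.
have {}J2 : I <= eta ^+ d * \sum_(j | A j) (rho (mu j) - rho lam) + #|predC A|%:R * (2 * eta) ^+ d.
  apply: le_trans J2 _; rewrite (bigID A)/= mulrDr; apply: lerD.
    by rewrite le_eqVlt; apply/orP; left; apply/eqP; congr (_ * _); apply: eq_bigr => j ->.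
  rewrite (eq_bigr (fun=> 2 ^+ d)); last by move=> j /negbTE ->.
  rewrite sumr_const -[2 ^+ d *+ _]mulr_natr exprMn.
  by rewrite le_eqVlt; apply/orP; left; apply/eqP; rewrite -[#|_|]/(#|predC A|); ring.
have low : \forall beta \near +oo, forall j n, A j -> n \in cell_lat (beta * eta) j ->
    mu j <= lam + kappa * beta `^ p * V n.
  near=> beta => j n Aj nj.
  have hv : forall j n, A j -> n \in cell_lat (beta * eta) j ->
    `|kappa * beta `^ p * V n - kappa * H j| <= 4 * del by near: beta; exact: HV.
  have := hv j n Aj nj; rewrite ler_norml /mu lerD2l ge_max => /andP[h1 _].
  apply/andP; split; last by lra.
  by apply: mulr_ge0 => //; rewrite mulr_ge0 ?powR_ge0// ltW.
have main := crossing_count_ge d0 rho_dos V_ge0 HW (ltW e0) Ke eta0 (a_gt0 kp0) tail eps2 low.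
near=> beta.
have b0 : 0 < beta by near: beta; exact: nbhs_pinfty_gt.
have : exists2 N : nat, crossing_count f V lam (kappa * beta `^ p) = N%:R%:E &
    beta ^+ d * (eta ^+ d * \sum_(j | A j) (rho (mu j) - rho lam) - eps / 2) <= N%:R
  by near: beta; exact: main.
move=> [N NE N1]; exists N => //; apply: le_trans N1.
by apply: ler_wpM2l; [rewrite exprn_ge0// ltW|lra].
Unshelve. all: by end_near. Qed.

End asymptotics.

(** * Passage to the limit *)

Section substitution.
Context {R : realType}.

Lemma near_power_substitution (kappa p : R) (P : R -> Prop) : 0 < kappa -> 0 < p ->
  (\forall beta \near +oo, P beta) ->
  \forall alpha \near +oo, exists2 beta, 0 < beta /\ P beta & alpha = kappa * beta `^ p.
Proof.
move=> k0 p0 [M [_ HM]].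
pose M' := Num.max M 1.
near=> alpha.
have a0 : kappa * M' `^ p < alpha by near: alpha; apply: nbhs_pinfty_gt; exact: num_real.
have M0 : 0 < M' by rewrite lt_max ltr01 orbT.
have ap : 0 < alpha / kappa.
  by rewrite divr_gt0//; apply: le_lt_trans a0; rewrite mulr_ge0 ?powR_ge0 ?ltW.
pose beta := (alpha / kappa) `^ p^-1.
have bp : beta `^ p = alpha / kappa by rewrite -powRrM mulVf ?gt_eqF// powRr1// ltW.
have b0 : 0 < beta by exact: powR_gt0.
exists beta; last by rewrite bp mulrC divfK// gt_eqF.
split=> //; apply: HM; apply: (@le_lt_trans _ _ M'); first by rewrite le_max lexx.
rewrite ltNge; apply/negP => bM.
have : beta `^ p <= M' `^ p by apply: ge0_ler_powR => //; rewrite ?nnegrE; exact: ltW.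
by rewrite bp ler_pdivrMr// mulrC leNgt a0.
Unshelve. all: by end_near. Qed.

Lemma power_near1 (q eps : R) : 0 < eps ->
  exists2 w : R, 0 < w < 1 & forall x, `|x - 1| <= w -> `|x `^ q - 1| <= eps.
Proof.
move=> eps0; have := @powR_continuous R q 1 ltr01 => /cvgrPdist_le /(_ _ eps0).
move=> /nbhs_ballP[w /= w0 Hw].
have m0 : 0 < Num.min w 1 by rewrite lt_min w0 ltr01.
have m1 : Num.min w 1 <= 1 by rewrite ge_min lexx orbT.
have mw : Num.min w 1 <= w by rewrite ge_min lexx.
exists (Num.min w 1 / 2); first by apply/andP; split; lra.
move=> x x1; rewrite distrC; have := Hw x; rewrite powR1; apply; rewrite /ball/= distrC.
by apply: le_lt_trans x1 _; lra.
Qed.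

End substitution.

Theorem theorem1p1 (R : realType) (d : nat) (p : R)
  (f V : 'rV[int]_d -> R) (rho : R -> R) (Psi : 'rV[R]_d -> R)
  (lam_minus lam_plus lam : R)
  (d_ge1 : (1 <= d)%N) (p_gt0 : 0 < p)
  (f_bounded : exists M : R, forall n, `|f n| <= M)
  (gap : spectral_gap (schrodinger [set: 'rV[int]_d] f) lam_minus lam_plus)
  (rho_dos : density_of_states f rho)
  (Psi_cont : {within unit_sphere, continuous Psi})
  (V_ge0 : forall n, 0 <= V n)
  (V_asymp : asymptotic_potential V Psi p)
  (lam_in_gap : lam_minus < lam < lam_plus) :
  (lebesgue_rV d).-integrable [set: borel_rV R d]
    (fun x => (limit_density rho Psi p lam x)%:E) /\
  ((alpha `^ (- (d%:R / p)))%:E * crossing_count f V lam alpha)%E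
    @[alpha --> +oo]
    --> (\int[lebesgue_rV d]_x (limit_density rho Psi p lam x)%:E)%E.
Proof.
have res : resolvent_set (schrodinger [set: 'rV[int]_d] f) lam%:C%C.
  by case: gap => _ gapP _ _; exact: contrapT (gapP _ lam_in_gap).
have [K HW] := resolvent_bounded_inverse f_bounded res.
have [int IE] := limit_density_integrable d_ge1 p_gt0 rho_dos Psi_cont V_ge0 V_asymp HW.
split=> //; rewrite IE; set I := fine _.
have I0 : 0 <= I.
  apply: fine_ge0; apply: integral_ge0 => x _; rewrite lee_fin.
  exact: limit_density_ge0 p_gt0 rho_dos Psi_cont V_ge0 V_asymp x.
set q := - (d%:R / p).
have FF : Filter (pinfty_nbhs R) by exact: _.
suff lim eps : 0 < eps -> \forall alpha \near +oo, exists2 c : R,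
    ((alpha `^ q)%:E * crossing_count f V lam alpha)%E = c%:E & `|I - c| <= eps.
  apply/fine_cvgP; split.
    by near=> alpha; have [c -> _] : exists2 c : R,
      ((alpha `^ q)%:E * crossing_count f V lam alpha)%E = c%:E & `|I - c| <= 1
      by near: alpha; exact: lim.
  apply/cvgrPdist_le => eps eps0; near=> alpha.
  have [c /= cE cI] : exists2 c : R,
      ((alpha `^ q)%:E * crossing_count f V lam alpha)%E = c%:E & `|I - c| <= eps
    by near: alpha; exact: lim.
  by rewrite cE.
move=> eps0.
(* The powers of 1 - w and 1 + w are within th of 1, which changes I +- eps / 2 by at most eps / 2. *)
pose th := eps / 2 / (I + eps + 1); have e2 : 0 < eps / 2 by lra.
have th0 : 0 < th by rewrite divr_gt0//; lra.
have thE : th * (I + eps + 1) = eps / 2 by rewrite divfK// gt_eqF//; lra.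
have [w /andP[w0 w1] Hw] := power_near1 q th0.
have kl0 : 0 < 1 - w by lra.
have ku0 : 0 < 1 + w by lra.
have powE (kappa beta : R) : 0 < kappa -> 0 < beta ->
    (kappa * beta `^ p) `^ q = kappa `^ q * (beta ^+ d)^-1.
  move=> k0 b0; rewrite powRM ?powR_ge0 ?(ltW k0)// -powRrM; congr (_ * _).
  have -> : p * q = - d%:R by rewrite /q; field; rewrite gt_eqF.
  by rewrite powRN powR_mulrn// ltW.
have U := near_power_substitution kl0 p_gt0
  (crossing_count_upper d_ge1 p_gt0 rho_dos Psi_cont V_ge0 V_asymp HW kl0 ltac:(lra) e2).
have L := near_power_substitution ku0 p_gt0
  (@crossing_count_lower _ _ _ _ _ _ _ _ _ d_ge1 p_gt0 rho_dos Psi_cont V_ge0 V_asymp HW (1 + w) (eps / 2)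
     ltac:(lra) ltac:(lra) e2).
near=> alpha.
have : exists2 beta, 0 < beta /\ exists2 N : nat,
    crossing_count f V lam ((1 - w) * beta `^ p) = N%:R%:E & N%:R <= beta ^+ d * (I + eps / 2)
  & alpha = (1 - w) * beta `^ p by near: alpha; exact: U.
case=> b [b0 [N NE N1]] ab.
have : exists2 beta, 0 < beta /\ exists2 N : nat,
    crossing_count f V lam ((1 + w) * beta `^ p) = N%:R%:E & beta ^+ d * (I - eps / 2) <= N%:R
  & alpha = (1 + w) * beta `^ p by near: alpha; exact: L.
case=> b' [b'0 [N' NE' N1']] ab'.
rewrite -ab in NE; rewrite -ab' NE in NE'.
have NN : N%:R = N'%:R :> R by case: NE'.
exists (alpha `^ q * N%:R); first by rewrite NE.
have bd : 0 < b ^+ d by exact: exprn_gt0.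
have bd' : 0 < b' ^+ d by exact: exprn_gt0.
have h1 : alpha `^ q * N%:R <= (1 - w) `^ q * (I + eps / 2).
  rewrite ab powE// -mulrA; apply: ler_wpM2l; first exact: powR_ge0.
  by rewrite mulrC ler_pdivrMr// mulrC.
have h2 : (1 + w) `^ q * (I - eps / 2) <= alpha `^ q * N%:R.
  rewrite ab' powE// -mulrA; apply: ler_wpM2l; first exact: powR_ge0.
  by rewrite [leRHS]mulrC ler_pdivlMr// mulrC NN.
have := Hw (1 - w); have := Hw (1 + w).
rewrite !ler_norml => /(_ ltac:(lra)) /andP[p1 p2] /(_ ltac:(lra)) /andP[p3 p4].
apply/andP; split; nra.
Unshelve. all: by end_near. Qed.
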